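(* Assume that: (a) for all $x\in\mathbb{T}$ and $l\in\{2,3\}$, $|x-B_1|<|x-B_l|$ implies $c_1(x)<c_l(x)$; (b) $c(te^{i\theta})=c(te^{-i\theta-i\pi/3})$ for all $\theta\in[0,2\pi]$ and $t>0$ such that $te^{i\theta}\in\mathbb{T}$, and $c$ is Lipschitz in a neighborhood (in $\mathbb{T}$) of $D_1\cup D_3$. Let $\gamma=\int_{\mathbb{T}_1}c(x)\,dx$ and $\sigma^2=\int_{\mathbb{T}_1}c^2(x)\,dx$. Then, as $n\to\infty$, $$n^{-1/2}(\rho_n-\gamma n)\stackrel{d}{\rightarrow}G,$$ where $G$ is a Gaussian random variable with zero mean and variance $\sigma^2/3-\gamma^2$. Moreover, as $n\to\infty$, $$n^{-1/2}(\overline\rho_n-\gamma n)\stackrel{d}{\rightarrow}\max\{G_1,G_2,G_3\}-\tfrac13(G_1+G_2+G_3)+G$$ and $$n^{-1/2}(\overline\rho_n-\rho_n)\stackrel{d}{\rightarrow}\max\{G_1,G_2,G_3\}-\tfrac13(G_1+G_2+G_3),$$ where $G_1,G_2,G_3$ are independent Gaussian random variables with zero mean and variance $\sigma^2$, independent of $G$. Finally, $$\mathrm{E}[\rho_n]=n\gamma+o(\sqrt n)\quad\text{and}\quad \mathrm{E}[\overline\rho_n]=n\gamma+m\sqrt n+o(\sqrt n),$$ where $m=\mathrm{E}[\max\{G_1,G_2,G_3\}]>0$ depends linearly on $\sigma$.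
   Context: Identify the plane with $\mathbb{C}$. Set $\lambda=2(3\sqrt3)^{-1/2}$, $i=\sqrt{-1}$, $j=e^{2i\pi/3}$, $B_2=\lambda i$, $B_1=j^2B_2$, $B_3=jB_2$, and let $\mathbb{T}\subset\mathbb{C}$ be the (closed, filled) equilateral triangle with vertices $B_1,B_2,B_3$; it has unit area. $|\cdot|$ is the Euclidean norm, $dx$ is Lebesgue measure. Let $D_1=\{ijt: t<0\}$ and, for $l=2,3$, $D_l=\{ij^lt: t\le 0\}$; the cells $\mathbb{T}_l=\{x\in\mathbb{T}: |x-B_l|=\min_{1\le m\le 3}|x-B_m|\}\setminus D_l$, $l=1,2,3$, form a partition of $\mathbb{T}$. The cost function $c:\mathbb{T}\to[0,\infty)$ is measurable with $\|c\|_\infty=\sup_{x\in\mathbb{T}}c(x)<\infty$; put $c_1(x)=c(x)$, $c_2(x)=c(j^2x)$, $c_3(x)=c(jx)$. $X_1,X_2,\ldots$ are independent random variables uniformly distributed on $\mathbb{T}$. Let $\mathcal{A}_n$ be the set of matrices $A=(a_{kl})_{1\le k\le n,\,1\le l\le 3}$ with $a_{kl}\in\{0,1\}$ and $a_{k1}+a_{k2}+a_{k3}=1$ for every $k$. Define $\rho_n(A)=\max_{1\le l\le3}\sum_{k=1}^n a_{kl}c_l(X_k)$, the optimal load $\rho_n=\min_{A\in\mathcal{A}_n}\rho_n(A)$, and the suboptimal load $\overline{\rho}_n=\rho_n(\overline A)$, where $\overline A=(\overline a_{kl})$ with $\overline a_{kl}=\mathbf{1}(X_k\in\mathbb{T}_l)$.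 $\stackrel{d}{\rightarrow}$ denotes convergence in distribution.
   Formalization: The limit law of ρ_n, that of ρ̄_n−ρ_n, the expansion of E[ρ_n] and m>0 are proved assuming also that c(x)>0 for some x in (D_1∪D_3)∩T; the claims can fail when c vanishes there (e.g. c=dist(x,D_1∪D_3) on T_1 and 2·dist(x,T_1) elsewhere). *)

(* Defs.v *)
From HB Require Import structures.
From mathcomp Require Import all_boot all_order all_algebra.
From mathcomp Require Import finmap complex.
From mathcomp Require Import all_classical all_reals all_analysis.

Set Implicit Arguments.
Unset Strict Implicit.
Unset Printing Implicit Defensive.

Import Order.TTheory GRing.Theory Num.Theory.
Import numFieldNormedType.Exports.

Local Open Scope classical_set_scope.
Local Open Scope complex_scope.
Local Open Scope ring_scope.

(* Euclidean norm, with values in R (the norm `|z| of R[i] is R[i]-valued). *)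
Notation normc := ComplexField.Normc.normc.

Section plane.
Variable R : realType.

Definition pair_of (z : R[i]) : R * R := (complex.Re z, complex.Im z).

HB.instance Definition _ := isPointed.Build R[i] 0.

(* The sigma-algebra of R[i] is transported from R * R. *)
HB.instance Definition _ :=
  Measurable.copy R[i] (@g_sigma_algebra_preimageType _ R[i] (R * R)%type pair_of).

Local Notation mu := (@lebesgue_measure R).

Definition area (A : set R[i]) : \bar R :=
  (mu \x mu)%E [set p : R * R | A (p.1 +i* p.2)].

Lemma measurable_complex_of (A : set R[i]) : measurable A ->
  measurable [set p : R * R | A (p.1 +i* p.2)].
Proof.
move=> [B mB <-].
rewrite [X in measurable X](_ : _ = B) //.
by apply/seteqP; split=> -[x y] /=; rewrite /preimage /pair_of /= ?setTI; tauto.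
Qed.

Let area0 : area set0 = 0%E.
Proof. by rewrite /area measure0. Qed.

Let area_ge0 A : (0 <= area A)%E.
Proof. exact: measure_ge0. Qed.

Let area_sigma_additive : semi_sigma_additive area.
Proof.
move=> F mF tF mUF; rewrite /area.
rewrite (_ : [set p | _] =
    \bigcup_k [set p : R * R | F k (p.1 +i* p.2)]); last by apply/seteqP; split.
apply: measure_semi_sigma_additive.
- by move=> k; exact: measurable_complex_of.
- by apply/trivIsetP => i k _ _ ik; rewrite -subset0 => p /= Fp;
    move/trivIsetP : tF => /(_ i k I I ik); rewrite -subset0; apply; exact: Fp.
- by rewrite (_ : \bigcup_k _ = [set p : R * R | (\bigcup_k F k) (p.1 +i* p.2)]);
    [exact: measurable_complex_of | apply/seteqP; split].
Qed.

HB.instance Definition _ := isMeasure.Build _ _ _ area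
  area0 area_ge0 area_sigma_additive.

Definition expi (theta : R) : R[i] := cos theta +i* sin theta.

Definition jrot : R[i] := expi (2 * pi / 3).

Definition lambda : R := 2 * (Num.sqrt (3 * Num.sqrt 3))^-1.

(* The labels 1, 2, 3 of the three bins are encoded as 0, 1, 2 : 'I_3. *)
Definition bin (l : 'I_3) : R[i] :=
  let B2 := lambda%:C * 'i%C in nth 0 [:: jrot ^+ 2 * B2; B2; jrot * B2] l.

Definition triangle : set R[i] :=
  [set z | exists w : 'I_3 -> R, [/\ forall l, 0 <= w l,
     \sum_(l < 3) w l = 1 & z = \sum_(l < 3) (w l)%:C * bin l]].

Definition ray (l : 'I_3) : set R[i] :=
  [set z | exists2 t : R, (if l == ord0 then t < 0 else t <= 0)
                        & z = 'i%C * jrot ^+ l.+1 * t%:C].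

Definition cell (l : 'I_3) : set R[i] :=
  [set x | triangle x /\ forall m, normc (x - bin l) <= normc (x - bin m)]
  `\` ray l.

(* A cost function on the triangle is given by a map on the whole plane, whose
   values off the triangle are discarded: c \_ triangle is 0 there. *)
Definition cost (c : R[i] -> R) (l : 'I_3) (x : R[i]) : R :=
  (c \_ triangle) (nth 0 [:: x; jrot ^+ 2 * x; jrot * x] l).

Definition max3 (f : 'I_3 -> R) : R := \big[Num.max/f ord0]_(l < 3) f l.

Definition assignments n : pred 'M[bool]_(n, 3) :=
  [pred A : 'M[bool]_(n, 3) | [forall k, (\sum_(l < 3) A k l)%N == 1%N]].

Definition load c (x : nat -> R[i]) n (A : 'M[bool]_(n, 3)) : R :=
  max3 (fun l => \sum_(k < n) (A k l)%:R * cost c l (x k)).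

(* The default value of the iterated minimum is the load of an element of
   assignments n, so that this is the minimum over assignments n. *)
Definition optimal_load c (x : nat -> R[i]) n : R :=
  \big[Num.min/load c x (\matrix_(k < n, l < 3) (l == ord0))]_(A in @assignments n)
    load c x A.

Definition suboptimal_load c (x : nat -> R[i]) n : R :=
  load c x (\matrix_(k < n, l < 3) `[< cell l (x k) >]).

End plane.

Arguments area {R}.
Arguments bin {R}.
Arguments triangle {R}.
Arguments assignments : clear implicits.

Section probability.
Context {R : realType}.

Definition mutually_independent d (T : measurableType d) (P : probability T R)
    d' (T' : measurableType d') (I : choiceType) (X : I -> {RV P >-> T'}) : Prop :=
  forall (J : {fset I}) (A : I -> set T'), (forall i, measurable (A i)) ->
  P (\bigcap_(i in [set` J]) (X i @^-1` A i)) =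
  (\prod_(i <- J) P (X i @^-1` A i))%E.

Definition uniform_on d (T : measurableType d) (P : probability T R)
    (S : set R[i]) (X : {RV P >-> R[i]}) : Prop :=
  forall A : set R[i], measurable A ->
  distribution P X A = (area (S `&` A) / area S)%E.

(* v is the variance; normal_prob m s takes the standard deviation s, and is not
   the Dirac mass at m when s = 0. *)
Definition gaussian d (T : measurableType d) (P : probability T R)
    (m v : R) (X : {RV P >-> R}) : Prop :=
  forall A : set R, measurable A ->
  distribution P X A = if v == 0 then \d_m A else normal_prob m (Num.sqrt v) A.

Definition cvg_in_distribution d (T : measurableType d) (P : probability T R)
    (Y : nat -> T -> R) d' (T' : measurableType d') (P' : probability T' R)
    (Z : T' -> R) : Prop :=
  forall f : R -> R, continuous f -> (exists M, forall x, `|f x| <= M) ->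
  ('E_P[f \o Y n] @[n --> \oo] --> 'E_P'[f \o Z])%E.

End probability.

(* Main.v *)
Require Import Defs.
From HB Require Import structures.
From mathcomp Require Import all_boot all_order all_algebra.
From mathcomp Require Import finmap complex.
From mathcomp Require Import all_classical all_reals all_analysis.
From mathcomp Require Import measurable_realfun ring lra.

Set Implicit Arguments.
Unset Strict Implicit.
Unset Printing Implicit Defensive.

Import Order.TTheory GRing.Theory Num.Theory.
Import numFieldNormedType.Exports.

Local Open Scope classical_set_scope.
Local Open Scope complex_scope.
Local Open Scope ring_scope.

(** The plane is read in the coordinates [height z l], the component of [z] in
    the direction of bin [l] (lemma [sqr_dist_bin]): a point is nearest to the
    bin of largest height, the rotation of order three permutes the heights
    cyclically, and the triangle is cut out by three lower bounds on them. In
    these coordinates assumptions (a) and (b) of the theorem say that the cost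
    of serving [x] at a bin decreases with the height of [x] towards this bin,
    with equality on ties ([cost_le]).

    Let [contribution c l x] be the cost of [x] at bin [l] if [x] lies in cell
    [l], and 0 otherwise, and let S_l be the sum of these contributions over the
    first n points. The suboptimal load is the maximum of S_1, S_2, S_3. Since a
    point pays least at its nearest bin, every assignment has total load at
    least S_1 + S_2 + S_3, so that the average [mean_load] of the S_l bounds the
    optimal load from below ([mean_load_le_optimal]). For the converse bound,
    points are moved between the bins. Near a point of the symmetry rays where
    the cost is c0 > 0, and near its rotated images, there are for all l <> m
    regions of positive area inside cell l where serving at l or at m costs c0
    up to eps ([positive_swappable]). Of order n points fall in each of them,
    whereas the imbalance of the S_l is of order sqrt n, so moving about
    (S_l - S_m) / (3 c0) points from l to m evens out the loads up to a bounded
    error and a multiple eps of the imbalance ([rebalance_load],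
    [optimal_load_upper]). Second moments bound the exceptional event on which
    there are not enough points, and therefore the optimal load exceeds the mean
    load by o(sqrt n) in expectation ([optimal_near_mean]).

    It remains to find the limits of three quantities that are all maxima of
    three sums of independent identically distributed vectors, namely
    max S_l, (S_1 + S_2 + S_3) / 3 and their difference. The contributions have
    mean gamma, second moment sigma2, and vanishing products, since the cells
    are disjoint ([contribution_mean], [contribution_cov]). Hence the vector of
    the centred S_l has the covariance of G_l - (G_1 + G_2 + G_3) / 3 + G, where
    the variance sigma2 / 3 - gamma ^ 2 of G is that of the average. The central
    limit theorem for the maximum ([clt_max]) is proved by Lindeberg's exchange
    of the summands for Gaussian ones ([clt_soft_step]), applied to the smooth
    functions [soft_step], which approximate the indicator of the event that all
    coordinates are below a level. Their combinations approximate every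
    continuous function of a truncated maximum ([step_approximation]). The only
    properties of Gaussian vectors that enter are stability under addition of
    independent copies, and moments ([gauss_vec]).

    Second moments are bounded throughout, so that limits of expectations follow
    from limits in distribution ([tight_cvg]). The constant kappa is the
    expected maximum of three independent standard normal variables
    ([gaussian_max_mean]). *)

(** * Bounded measurable functions and their expectations *)

Local Notation L1 P f := (P.-integrable setT (EFin \o f)).

Section bounded_measurable.
Context {R : realType}.

(** The functions for which every integrability and measurability question
    about iterated expectations is settled at once: the class is closed
    under sums, products, composition and integration in one of two
    variables. *)
Definition bmeas d (T : measurableType d) (f : T -> R) : Prop :=
  measurable_fun setT f /\ exists M, forall x, `|f x| <= M.

Lemma bmeas_integrable d (T : measurableType d) (P : probability T R)
  (f : T -> R) : bmeas f -> L1 P f.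
Proof.
move=> [mf [M fM]]; apply: measurable_bounded_integrable => //.
  by apply: (@le_lt_trans _ _ 1%E); [exact: probability_le1|rewrite ltry].
by exists M; split; [exact: num_real | move=> x Mx y _; exact: le_trans (fM y) (ltW Mx)].
Qed.

Lemma bmeas_cst d (T : measurableType d) (r : R) : bmeas (fun _ : T => r).
Proof. by split; [exact: measurable_cst | exists `|r|]. Qed.

Lemma bmeasD d (T : measurableType d) (f g : T -> R) :
  bmeas f -> bmeas g -> bmeas (fun x => f x + g x).
Proof.
move=> [mf [M fM]] [mg [N gN]]; split; first exact: measurable_funD.
by exists (M + N) => x; rewrite (le_trans (ler_normD _ _))// lerD.
Qed.

Lemma bmeasM d (T : measurableType d) (f g : T -> R) :
  bmeas f -> bmeas g -> bmeas (fun x => f x * g x).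
Proof.
move=> [mf [M fM]] [mg [N gN]]; split; first exact: measurable_funM.
by exists (M * N) => x; rewrite normrM ler_pM.
Qed.

Lemma bmeasN d (T : measurableType d) (f : T -> R) :
  bmeas f -> bmeas (fun x => - f x).
Proof.
move=> [mf [M fM]]; split; first exact: measurableT_comp.
by exists M => x; rewrite normrN.
Qed.

Lemma bmeasB d (T : measurableType d) (f g : T -> R) :
  bmeas f -> bmeas g -> bmeas (fun x => f x - g x).
Proof. by move=> bf bg; apply: bmeasD => //; exact: bmeasN. Qed.

Lemma bmeas_sum d (T : measurableType d) (I : Type) (s : seq I) (Q : pred I)
    (f : I -> T -> R) :
  (forall i, Q i -> bmeas (f i)) -> bmeas (fun x => \sum_(i <- s | Q i) f i x).
Proof.
move=> bf; elim: s => [|i s IH].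
  by under eq_fun do rewrite big_nil; exact: bmeas_cst.
under eq_fun do rewrite big_cons.
by case Qi : (Q i) => //; apply: bmeasD => //; exact: bf.
Qed.

Lemma bmeas_comp d (T : measurableType d) d' (T' : measurableType d')
    (f : T -> R) (g : T' -> T) :
  bmeas f -> measurable_fun setT g -> bmeas (fun x => f (g x)).
Proof.
move=> [mf [M fM]] mg; split; first exact: measurableT_comp mf mg.
by exists M => x; exact: fM.
Qed.

Lemma bmeas_bound d (T : measurableType d) (f : T -> R) :
  bmeas f -> exists2 M, 0 <= M & forall x, `|f x| <= M.
Proof.
move=> [_ [M fM]]; exists `|M|; first exact: normr_ge0.
by move=> x; exact: le_trans (fM x) (ler_norm _).
Qed.

End bounded_measurable.

Section expectation.
Context {R : realType} d (T : measurableType d) (P : probability T R).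

Lemma Exp_cst (r : R) : \int[P]_(w in setT) r = r.
Proof. by rewrite Rintegral_cst//= probability_setT mulr1. Qed.

Lemma L1_cst (r : R) : L1 P (fun _ : T => r).
Proof. exact/bmeas_integrable/bmeas_cst. Qed.

Lemma L1D (f g : T -> R) : L1 P f -> L1 P g -> L1 P (fun x => f x + g x).
Proof. by move=> lf lg; exact: (integrableD _ lf lg). Qed.

Lemma L1Z (r : R) (f : T -> R) : L1 P f -> L1 P (fun x => r * f x).
Proof. by move=> lf; exact: (integrableZl _ _ lf). Qed.

Lemma L1N (f : T -> R) : L1 P f -> L1 P (fun x => - f x).
Proof. by move=> lf; exact: (integrableN lf). Qed.

Lemma L1B (f g : T -> R) : L1 P f -> L1 P g -> L1 P (fun x => f x - g x).
Proof. by move=> lf lg; apply: L1D => //; exact: L1N. Qed.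

Lemma L1_sum (I : Type) (s : seq I) (Q : pred I) (f : I -> T -> R) :
  (forall i, L1 P (f i)) -> L1 P (fun x => \sum_(i <- s | Q i) f i x).
Proof.
move=> lf; elim: s => [|i s IH].
  have -> : (fun x => \sum_(i <- [::] | Q i) f i x) = cst 0.
    by apply/funext => x; rewrite big_nil.
  exact: L1_cst.
have -> : (fun x => \sum_(j <- i :: s | Q j) f j x) =
    fun x => if Q i then f i x + \sum_(j <- s | Q j) f j x
             else \sum_(j <- s | Q j) f j x.
  by apply/funext => x; rewrite big_cons.
by case: (Q i) => //; exact: L1D.
Qed.

Lemma Exp_sum (I : Type) (s : seq I) (Q : pred I) (f : I -> T -> R) :
  (forall i, L1 P (f i)) ->
  \int[P]_w (\sum_(i <- s | Q i) f i w) = \sum_(i <- s | Q i) \int[P]_w f i w.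
Proof.
move=> lf; elim: s => [|i s IH].
  by under eq_Rintegral do rewrite big_nil; rewrite Exp_cst big_nil.
under eq_Rintegral do rewrite big_cons.
rewrite big_cons; case: ifP => // _.
by rewrite RintegralD//; [rewrite IH|exact: L1_sum].
Qed.

Lemma L1_le (f g : T -> R) : measurable_fun setT f -> L1 P g ->
  (forall x, `|f x| <= g x) -> L1 P f.
Proof.
move=> mf lg fg; apply: (le_integrable _ _ _ lg) => //.
  exact/measurable_EFinP.
by move=> x _ /=; rewrite lee_fin (le_trans (fg x))// ler_norm.
Qed.

Lemma Exp_norm_le (f : T -> R) (M : R) : measurable_fun setT f ->
  (forall x, `|f x| <= M) -> `|\int[P]_w f w| <= M.
Proof.
move=> mf fM; have bf : bmeas f by split=> //; exists M.
apply: le_trans (le_normr_Rintegral _ (bmeas_integrable P bf)) _ => //.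
rewrite -[leRHS]Exp_cst; apply: le_Rintegral => //; last exact: L1_cst.
apply: bmeas_integrable; split; first exact: measurableT_comp.
by exists M => x; rewrite normr_id.
Qed.

Lemma L1_norm (f : T -> R) : L1 P f -> L1 P (fun w => `|f w|).
Proof. by move=> lf; exact: (integrable_norm lf). Qed.

Lemma L1_measurable (f : T -> R) : L1 P f -> measurable_fun setT f.
Proof. by move=> /integrableP[mf _]; exact/measurable_EFinP. Qed.

Lemma Exp_EFin (f : T -> R) : L1 P f ->
  (\int[P]_w (f w)%:E = (\int[P]_w f w)%:E)%E.
Proof.
by move=> lf; rewrite /Rintegral fineK//; exact: integrable_fin_num.
Qed.

End expectation.

Section partial_expectation.
Context {R : realType} d1 d2 (T1 : measurableType d1) (T2 : measurableType d2).

Lemma bmeas_pair (f : T1 -> T2 -> R) :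
  bmeas (fun z : T1 * T2 => f z.1 z.2) -> forall x, bmeas (f x).
Proof.
move=> bf x; apply: (bmeas_comp (g := fun y => (x, y)) bf).
exact: pair1_measurable.
Qed.

Lemma bmeas_pairl (f : T1 -> T2 -> R) :
  bmeas (fun z : T1 * T2 => f z.1 z.2) -> forall y, bmeas (f ^~ y).
Proof.
move=> bf y; apply: (bmeas_comp (g := fun x => (x, y)) bf).
exact: pair2_measurable.
Qed.

Variable P2 : probability T2 R.

Lemma bmeas_Exp (f : T1 -> T2 -> R) :
  bmeas (fun z : T1 * T2 => f z.1 z.2) -> bmeas (fun x => \int[P2]_y f x y).
Proof.
move=> bf; have [mf [M fM]] := bf; split; last first.
  exists M => x; apply: Exp_norm_le; first by case: (bmeas_pair bf x).
  by move=> y; exact: (fM (x, y)).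
have -> : (fun x => \int[P2]_y f x y) =
    (fun x => \int[P2]_y (f x y + M) - M).
  apply/funext => x; rewrite RintegralD//; last 2 first.
  - exact/bmeas_integrable/bmeas_pair.
  - exact: L1_cst.
  by rewrite Exp_cst addrK.
apply: measurable_funB => //; apply: measurableT_comp => //.
apply: (measurable_fun_fubini_tonelli_F (fun z => (f z.1 z.2 + M)%:E)) => //.
  by apply/measurable_EFinP; exact: measurable_funD.
by move=> z; rewrite lee_fin -lerBlDr sub0r; have := fM z; rewrite ler_norml => /andP[].
Qed.

End partial_expectation.

Section fubini.
Context {R : realType} d1 d2 (T1 : measurableType d1) (T2 : measurableType d2)
  (P1 : probability T1 R) (P2 : probability T2 R).

Lemma prod_integrable (f : T1 -> T2 -> R) :
  bmeas (fun z : T1 * T2 => f z.1 z.2) ->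
  (P1 \x P2)%E.-integrable setT (fun z => (f z.1 z.2)%:E).
Proof.
move=> bf; have [mf [M fM]] := bf.
apply: (@measurable_bounded_integrable _ _ _ (P1 \x P2)%E (fun z => f z.1 z.2)) => //.
  have e : (P1 \x P2)%E setT = 1%E.
    by rewrite -setXTT product_measure1E//= !probability_setT mule1.
  by move: (ltry (1 : R)); rewrite -e.
by exists M; split; [exact: num_real | move=> x Mx y _; exact: le_trans (fM y) (ltW Mx)].
Qed.

Lemma Exp_prod (f : T1 -> T2 -> R) :
  bmeas (fun z : T1 * T2 => f z.1 z.2) ->
  \int[(P1 \x P2)%E]_z f z.1 z.2 = \int[P1]_x \int[P2]_y f x y.
Proof.
move=> bf; rewrite /Rintegral; congr fine.
rewrite -integral12_prod_meas1; last exact: prod_integrable.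
by apply: eq_integral => x _; rewrite /fubini_F (Exp_EFin (bmeas_integrable P2 (bmeas_pair bf x))).
Qed.

Lemma Exp_swap (f : T1 -> T2 -> R) :
  bmeas (fun z : T1 * T2 => f z.1 z.2) ->
  \int[P1]_x \int[P2]_y f x y = \int[P2]_y \int[P1]_x f x y.
Proof.
move=> bf; rewrite -Exp_prod// /Rintegral; congr fine.
rewrite -integral21_prod_meas1; last exact: prod_integrable.
by apply: eq_integral => y _; rewrite /fubini_G (Exp_EFin (bmeas_integrable P1 (bmeas_pairl bf y))).
Qed.

End fubini.

(** * Equality in law and independence of two variables *)

Section law.
Context {R : realType}.

(** Equality of image measures, for maps that need not live on the same
    space; with the identity on one side it says that a measure is the image
    of another. *)
Definition same_law d1 d2 d (T1 : measurableType d1) (T2 : measurableType d2)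
    (T : measurableType d) (mu1 : {measure set T1 -> \bar R})
    (A : T1 -> T) (mu2 : {measure set T2 -> \bar R}) (B : T2 -> T) : Prop :=
  forall C, measurable C -> mu1 (A @^-1` C) = mu2 (B @^-1` C).

Section same_law.
Context d1 d2 d (T1 : measurableType d1) (T2 : measurableType d2)
  (T : measurableType d).
Variables (mu1 : {measure set T1 -> \bar R}) (A : T1 -> T).
Variables (mu2 : {measure set T2 -> \bar R}) (B : T2 -> T).
Hypotheses (mA : measurable_fun setT A) (mB : measurable_fun setT B).
Hypothesis AB : same_law mu1 A mu2 B.

Lemma ge0_same_law_integral (f : T -> \bar R) :
  measurable_fun setT f -> (forall x, 0 <= f x)%E ->
  (\int[mu1]_w f (A w) = \int[mu2]_w f (B w))%E.
Proof.
move=> mf f0.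
have -> : (\int[mu1]_w f (A w) = \int[pushforward mu1 A]_x f x)%E.
  by rewrite ge0_integral_pushforward.
have -> : (\int[mu2]_w f (B w) = \int[pushforward mu2 B]_x f x)%E.
  by rewrite ge0_integral_pushforward.
by apply: eq_measure_integral => C mC _; exact: AB.
Qed.

Lemma same_law_integral (f : T -> \bar R) : measurable_fun setT f ->
  (\int[mu1]_w f (A w) = \int[mu2]_w f (B w))%E.
Proof.
move=> mf; rewrite [LHS]integralE [RHS]integralE.
have hp := ge0_same_law_integral (measurable_funepos mf) (fun x => funepos_ge0 f x).
have hn := ge0_same_law_integral (measurable_funeneg mf) (fun x => funeneg_ge0 f x).
have := funepos_comp f A; have := funeneg_comp f A.
have := funepos_comp f B; have := funeneg_comp f B.
by rewrite /comp => -> -> -> ->; rewrite /= hp hn.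
Qed.

Lemma same_law_Exp (f : T -> R) : measurable_fun setT f ->
  \int[mu1]_w f (A w) = \int[mu2]_w f (B w).
Proof.
move=> mf; congr fine.
apply: (same_law_integral (f := EFin \o f)).
exact/measurable_EFinP.
Qed.

Lemma same_law_L1 (f : T -> R) : measurable_fun setT f ->
  L1 mu2 (fun w => f (B w)) -> L1 mu1 (fun w => f (A w)).
Proof.
move=> mf /integrableP[_ fB]; apply/integrableP; split.
  by apply/measurable_EFinP; exact: measurableT_comp.
rewrite (le_lt_trans _ fB)//=.
rewrite (@ge0_same_law_integral (fun x => `|(f x)%:E|)%E)//.
by apply: measurableT_comp => //; exact/measurable_EFinP.
Qed.

End same_law.

Lemma same_law_comp d1 d2 d d' (T1 : measurableType d1) (T2 : measurableType d2)
    (T : measurableType d) (T' : measurableType d')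
    (mu1 : {measure set T1 -> \bar R}) (A : T1 -> T)
    (mu2 : {measure set T2 -> \bar R}) (B : T2 -> T) (g : T -> T') :
  measurable_fun setT g -> same_law mu1 A mu2 B ->
  same_law mu1 (g \o A) mu2 (g \o B).
Proof.
move=> mg AB C mC; apply: (AB (g @^-1` C)).
by rewrite -[X in measurable X]setTI; exact: mg.
Qed.

End law.

Section independence.
Context {R : realType} d (T : measurableType d) (P : probability T R).

Definition indep2 d1 d2 (T1 : measurableType d1) (T2 : measurableType d2)
    (A : T -> T1) (B : T -> T2) : Prop :=
  forall a b, measurable a -> measurable b ->
  P (A @^-1` a `&` B @^-1` b) = (P (A @^-1` a) * P (B @^-1` b))%E.

Section pair.
Context d1 d2 (T1 : measurableType d1) (T2 : measurableType d2).
Variables (A : T -> T1) (B : T -> T2).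
Hypotheses (mA : measurable_fun setT A) (mB : measurable_fun setT B).

(** Both sides are measures that take product values on rectangles. *)
Lemma indep2_law : indep2 A B ->
  same_law P (fun w => (A w, B w)) (P \x P)%E (fun z => (A z.1, B z.2)).
Proof.
move=> AB C mC.
pose A' : {mfun _ >-> _} := HB.pack A (isMeasurableFun.Build _ _ _ _ _ mA).
pose B' : {mfun _ >-> _} := HB.pack B (isMeasurableFun.Build _ _ _ _ _ mB).
have mp1 : measurable_fun setT (fun w => (A w, B w)).
  exact: measurable_fun_pair.
have mp2 : measurable_fun setT (fun z : T * T => (A z.1, B z.2)).
  by apply: measurable_fun_pair; exact: measurableT_comp.
pose f1 : {mfun _ >-> _} := HB.pack (fun w => (A w, B w)) (isMeasurableFun.Build _ _ _ _ _ mp1).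
pose f2 : {mfun _ >-> _} := HB.pack (fun z : T * T => (A z.1, B z.2)) (isMeasurableFun.Build _ _ _ _ _ mp2).
transitivity ((distribution P A' \x distribution P B')%E C).
  apply/esym; apply: (@product_measure_unique _ _ _ _ _ _ _ (pushforward P f1)).
    by move=> a b ma mb; exact: AB.
  exact: mC.
apply: (@product_measure_unique _ _ _ _ _ _ _ (pushforward (P \x P)%E f2)); last exact: mC.
move=> a b ma mb.
apply: (@product_measure1E _ _ _ _ _ P P (A @^-1` a) (B @^-1` b)).
  by rewrite -[X in measurable X]setTI; exact: mA.
by rewrite -[X in measurable X]setTI; exact: mB.
Qed.

Lemma indep2_Exp (f : T1 -> T2 -> R) : indep2 A B ->
  bmeas (fun z : T1 * T2 => f z.1 z.2) ->
  \int[P]_w f (A w) (B w) = \int[P]_w \int[P]_w' f (A w) (B w').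
Proof.
move=> AB bf; have [mf _] := bf.
have mp2 : measurable_fun setT (fun z : T * T => (A z.1, B z.2)).
  by apply: measurable_fun_pair; exact: measurableT_comp.
have mp1 : measurable_fun setT (fun w => (A w, B w)).
  exact: measurable_fun_pair.
rewrite -(@Exp_prod _ _ _ _ _ P P (fun w w' => f (A w) (B w'))); last first.
  exact: (bmeas_comp bf mp2).
exact: (same_law_Exp mp1 mp2 (indep2_law AB) mf).
Qed.

End pair.

(** Each event of one coordinate is a box, and a box is a finite
    intersection of such events. *)
Lemma tuple_box_sigma d' (T' : measurableType d') n :
  @measurable _ (n.-tuple T') =
  <<s [set a | exists2 A : 'I_n -> set T', forall k, measurable (A k) &
               a = [set t | forall k, A k (tnth t k)]] >>.
Proof.
apply/seteqP; split.
  apply: smallest_sub; first exact: smallest_sigma_algebra.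
  move=> a; rewrite -bigcup_seq => -[k /= _ [b mb <-]].
  apply: sub_sigma_algebra => /=.
  exists (fun i => if i == k then b else setT).
    by move=> i; case: ifP.
  rewrite setTI; apply/seteqP; split=> t /=.
    by move=> bt i; case: eqP => // ->.
  by move=> /(_ k); rewrite eqxx.
apply: smallest_sub; first exact: sigma_algebra_measurable.
move=> _ [A mA ->].
rewrite (_ : [set _ | _] = \bigcap_(k in [set: 'I_n]) (fun t => tnth t k) @^-1` (A k)).
  apply: fin_bigcap_measurable => // k _.
  by rewrite -[X in measurable X]setTI; exact: measurable_tnth.
by apply/seteqP; split=> t /= h k => [_|]; apply: h.
Qed.

(** For a fixed event of [X i0], the two sides of the product rule are
    finite measures in the event of the tuple. They agree on boxes, which
    are stable under intersection and generate the sigma-algebra. *)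
Lemma mutually_independent_tuple d' (T' : measurableType d') (I : choiceType)
    (X : I -> {RV P >-> T'}) n (iota : 'I_n -> I) (i0 : I) :
  mutually_independent X -> injective iota -> (forall k, iota k != i0) ->
  indep2 (fun w => [tuple X (iota k) w | k < n]) (X i0).
Proof.
move=> Xi inj_iota ni0.
have mpast : measurable_fun setT (fun w => [tuple X (iota k) w | k < n]).
  apply/measurable_fun_tnthP => k.
  rewrite (_ : _ \o _ = X (iota k))//.
  by apply/funext => w /=; rewrite tnth_mktuple.
have box (A : 'I_n -> set T') b : (forall k, measurable (A k)) -> measurable b ->
    P ([set w | forall k, A k (X (iota k) w)] `&` X i0 @^-1` b) =
    (P (X i0 @^-1` b) * \prod_(k < n) P (X (iota k) @^-1` (A k)))%E.
  move=> mA mb.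
  pose A' i := if [pick k | iota k == i] is Some k then A k else b.
  have A'iota k : A' (iota k) = A k.
    rewrite /A'; case: pickP => [j /eqP/inj_iota ->//|/(_ k)].
    by rewrite eqxx.
  have A'i0 : A' i0 = b.
    by rewrite /A'; case: pickP => [j|//]; rewrite (negbTE (ni0 j)).
  pose J := [fset x in i0 :: [seq iota k | k <- enum 'I_n]]%fset.
  have := Xi J A'; rewrite (perm_big (i0 :: [seq iota k | k <- enum 'I_n])).
    rewrite big_cons A'i0 big_map big_enum/=.
    under eq_bigr do rewrite A'iota.
    move=> <-; last by move=> i; rewrite /A'; case: pickP.
    congr (P _); apply/seteqP; split => w /=.
      move=> [Aw bw] i; rewrite /= !inE => /orP[/eqP ->|/mapP[k _ ->]].
        by rewrite A'i0.
      by rewrite A'iota.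
    move=> h; split.
      move=> k; rewrite -A'iota; apply: h => /=.
      by rewrite !inE map_f ?orbT// mem_enum.
    by rewrite -A'i0; apply: h; rewrite /= !inE eqxx.
  apply: uniq_perm => //.
    rewrite /= map_inj_uniq// enum_uniq andbT.
    by apply/mapP => -[k _ /eqP]; rewrite eq_sym (negbTE (ni0 k)).
  by move=> i; rewrite !inE.
move=> a b ma mb.
have mB : measurable (X i0 @^-1` b).
  by rewrite -[X in measurable X]setTI; exact: measurable_funP.
pose past := fun w => [tuple X (iota k) w | k < n].
pose past' : {mfun T >-> [the measurableType _ of n.-tuple T']} := HB.pack past (isMeasurableFun.Build _ _ _ _ _ mpast).
pose pB := fine (P (X i0 @^-1` b)).
have pBE : P (X i0 @^-1` b) = pB%:E.
  by rewrite /pB fineK// fin_num_measure.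
have pB0 : 0 <= pB by rewrite /pB fine_ge0.
pose m1 := pushforward (mrestr P mB) past'.
pose m2 := mscale (NngNum pB0) (distribution P past').
suff: m1 a = m2 a.
  by rewrite /m1 /m2 /mscale /pushforward/= /mrestr pBE muleC.
apply: (measure_unique _ (fun=> setT) (tuple_box_sigma T' n)) => //.
- move=> _ _ [A mA ->] [B mB' ->]; exists (fun k => A k `&` B k).
    by move=> k; exact: measurableI.
  by apply/seteqP; split=> t /=; [move=> [h1 h2] k|move=> h; split=> k; case: (h k)].
- by move=> _; exists (fun=> setT) => //; apply/seteqP; split.
- by apply/seteqP; split => // t _; exists 0%N.
- move=> _ [A mA ->].
  set box' := [set t | _].
  change (P ((past @^-1` box') `&` (X i0 @^-1` b)) =
          ((NngNum pB0)%:num%:E * P (past @^-1` box'))%E).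
  have -> : past @^-1` box' = [set w | forall k, A k (X (iota k) w)].
    by apply/seteqP; split=> w /= h k; move: (h k); rewrite tnth_mktuple.
  rewrite box//; have := box A setT mA measurableT.
  rewrite preimage_setT setIT probability_setT mul1e => ->.
  by rewrite pBE.
- move=> _; change (P (past @^-1` setT `&` (X i0 @^-1` b)) < +oo)%E.
  by rewrite preimage_setT setTI (le_lt_trans (probability_le1 P _)) ?ltry.
Qed.

End independence.

(** * Lebesgue measure under affine maps, and densities *)

Section lebesgue_affine.
Context {R : realType}.
Local Notation mu := (@lebesgue_measure R).
Local Notation RR := (measurableTypeR R).

Lemma lebesgue_measure_shift (a : R) (A : set R) : measurable A ->
  mu ((fun x => x + a) @^-1` A) = mu A.
Proof.
move=> mA; pose f : RR -> RR := fun x => x + a.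
have mf : measurable_fun setT f by exact: measurable_funD.
pose f' : {mfun _ >-> _} := HB.pack f (isMeasurableFun.Build _ _ _ _ _ mf).
apply/esym.
suff H : forall X, ocitv X -> mu X = pushforward mu f' X.
  exact: (@lebesgue_measure_unique R (pushforward mu f') H A mA).
move=> _ [[x y]] _ <-; rewrite /pushforward/=.
have -> : f @^-1` `]x, y]%classic = `]x - a, y - a]%classic.
  by apply/seteqP; split=> z /=; rewrite !in_itv/= ltrBlDr lerBrDr.
rewrite !lebesgue_measure_itv/= !lte_fin ltrD2r; case: ifP => // _.
by rewrite -!EFinB; congr _%:E; ring.
Qed.

Lemma lebesgue_measure_scale (s : R) (A : set R) : s != 0 -> measurable A ->
  mu A = (`|s|%:E * mu ((fun x => s * x)%R @^-1` A))%E.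
Proof.
move=> s0 mA; pose f : RR -> RR := fun x => s * x.
have mf : measurable_fun setT f by exact: measurable_funM.
pose f' : {mfun _ >-> _} := HB.pack f (isMeasurableFun.Build _ _ _ _ _ mf).
pose m : {measure set RR -> \bar R} := mscale (NngNum (normr_ge0 s))
  (measure_function_pushforward__canonical__measure_function_Measure mu mf).
suff H : forall X, ocitv X -> mu X = m X.
  exact: (@lebesgue_measure_unique R m H A mA).
move=> _ [[x y]] _ <-.
change (mu `]x, y]%classic = `|s|%:E * mu (f @^-1` `]x, y]%classic))%E.
have [s_gt0|s_lt0|/eqP] := ltgtP s 0; last by rewrite (negbTE s0).
  have -> : f @^-1` `]x, y]%classic = `[y / s, x / s[%classic.
    by apply/seteqP; split=> z /=; rewrite !in_itv/= /f ler_ndivrMr// ltr_ndivlMr// ![z * s]mulrC andbC.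
  rewrite !lebesgue_measure_itv/= !lte_fin ltr_ndivlMr// divfK//.
  case: ifP => _; rewrite ?mule0// -!EFinB -EFinM; congr _%:E.
  by rewrite ltr0_norm// mulrBr !mulNr ![s * _]mulrC !divfK// opprK addrC.
have -> : f @^-1` `]x, y]%classic = `]x / s, y / s]%classic.
  by apply/seteqP; split=> z /=; rewrite !in_itv/= /f ler_pdivlMr// ltr_pdivrMr// ![z * s]mulrC.
rewrite !lebesgue_measure_itv/= !lte_fin ltr_pdivrMr// divfK//.
case: ifP => _; rewrite ?mule0// -!EFinB -EFinM; congr _%:E.
by rewrite gtr0_norm// mulrBr ![s * _]mulrC !divfK.
Qed.

(** By Fubini: on each vertical line a shear is a translation. *)
Lemma lebesgue2_shearx (p : R) :
  same_law (mu \x mu)%E (fun z : RR * RR => (z.1, z.2 + p * z.1)) (mu \x mu)%E id.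
Proof.
move=> C mC; rewrite preimage_id.
apply: eq_integral => x _ /=.
rewrite -[RHS](lebesgue_measure_shift (p * x)); last exact: measurable_xsection.
congr (mu _); apply/seteqP; split => y /=;
  by rewrite /xsection /= !inE.
Qed.

Lemma lebesgue2_sheary (p : R) :
  same_law (mu \x mu)%E (fun z : RR * RR => (z.1 + p * z.2, z.2)) (mu \x mu)%E id.
Proof.
move=> C mC; rewrite preimage_id.
have E D : measurable D -> (mu \x mu)%E D = (mu \x^ mu)%E D.
  move=> mD; apply: product_measure_unique => // a b ma mb.
  exact: product_measure2E.
have mf : measurable_fun setT (fun z : RR * RR => (z.1 + p * z.2, z.2)).
  apply: measurable_fun_pair => //; apply: measurable_funD => //.
  exact: measurable_funM.
transitivity ((mu \x^ mu)%E ((fun z : RR * RR => (z.1 + p * z.2, z.2)) @^-1` C)).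
  by apply: E; rewrite -[X in measurable X]setTI; exact: mf.
transitivity ((mu \x^ mu)%E C); last exact/esym/E.
apply: eq_integral => y _ /=.
rewrite -[RHS](lebesgue_measure_shift (p * y)); last exact: measurable_ysection.
congr (mu _); apply/seteqP; split => x /=;
  by rewrite /ysection /= !inE.
Qed.

Definition rot2 (c s : R) (z : RR * RR) : RR * RR :=
  (c * z.1 + s * z.2, - s * z.1 + c * z.2).

Lemma measurable_rot2 c s : measurable_fun setT (rot2 c s).
Proof.
apply: measurable_fun_pair; apply: measurable_funD => //.
- exact: measurable_funM.
- exact: measurable_funM.
- exact: measurable_funM.
- exact: measurable_funM.
Qed.

(** A rotation is a product of three shears. *)
Lemma lebesgue2_rot (c s : R) : c ^+ 2 + s ^+ 2 = 1 -> s != 0 ->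
  same_law (mu \x mu)%E (rot2 c s) (mu \x mu)%E id.
Proof.
move=> cs1 s0 C mC.
(* the slope of the outer shears is the tangent of half the angle *)
have E : rot2 c s = (fun z : RR * RR => (z.1 + (1 - c) / s * z.2, z.2)) \o
    (fun z => (z.1, z.2 + (- s) * z.1)) \o (fun z => (z.1 + (1 - c) / s * z.2, z.2)).
  apply/funext => -[x y]; rewrite /rot2 /=; congr pair; last by field.
  apply/(@mulfI _ s) => //.
  have -> : s * (c * x + s * y) = s * c * x + (1 - c ^+ 2) * y.
    by rewrite -cs1; ring.
  by field.
have mx p : measurable_fun setT (fun z : RR * RR => (z.1, z.2 + p * z.1)).
  apply: measurable_fun_pair => //; apply: measurable_funD => //.
  exact: measurable_funM.
have my p : measurable_fun setT (fun z : RR * RR => (z.1 + p * z.2, z.2)).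
  apply: measurable_fun_pair => //; apply: measurable_funD => //.
  exact: measurable_funM.
rewrite E 2!comp_preimage lebesgue2_sheary.
  rewrite preimage_id lebesgue2_shearx.
    by rewrite preimage_id lebesgue2_sheary.
  by rewrite -[X in measurable X]setTI; exact: my.
rewrite -[X in measurable X]setTI; apply: mx => //.
by rewrite -[X in measurable X]setTI; exact: my.
Qed.

End lebesgue_affine.

Section density.
Context {R : realType}.
Local Notation mu := (@lebesgue_measure R).
Local Notation RR := (measurableTypeR R).

Lemma integral_lebesgue_indic_co (r : R) : 0 <= r ->
  (\int[mu]_t (\1_[set u : R | 0 <= u < r] t)%:E = r%:E)%E.
Proof.
move=> r0.
have -> : [set u : R | 0 <= u < r] = `[0, r[%classic.
  by apply/seteqP; split=> t /=; rewrite in_itv.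
rewrite integral_indic//= setIT lebesgue_measure_itv/= lte_fin.
by case: ltgtP r0 => // [r0 _|<-//]; rewrite oppr0 adde0.
Qed.

(** The layer-cake formula: the subgraph of [f] is measured by integrating
    first along the fibres, which turns integrals of [f] into measures of
    its level sets. *)
Lemma integral_density d (T : measurableType d)
    (nu m : {sigma_finite_measure set T -> \bar R}) (p f : T -> R) :
  measurable_fun setT p -> (forall x, 0 <= p x) ->
  (forall A, measurable A -> nu A = \int[m]_(x in A) (p x)%:E)%E ->
  measurable_fun setT f -> (forall x, 0 <= f x) ->
  (\int[nu]_x (f x)%:E = \int[m]_x (f x * p x)%:E)%E.
Proof.
move=> mp p0 nuE mf f0.
pose D : set (T * RR) := [set z | 0 <= z.2 < f z.1].
have mD : measurable D.
  rewrite (_ : D = [set z | 0 <= z.2] `&` [set z | z.2 < f z.1]).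
    apply: measurableI.
      rewrite -[X in measurable X]setTI.
      exact: measurable_fun_ler.
    rewrite -[X in measurable X]setTI.
    apply: measurable_fun_ltr => //; exact: measurableT_comp.
  by apply/seteqP; split=> z; rewrite /D/= => /andP.
have fE x : (f x)%:E = (\int[mu]_t (\1_D (x, t))%:E)%E.
  by rewrite -(integral_lebesgue_indic_co (f0 x)); congr (integral _ _ _).
under eq_integral do rewrite fE.
rewrite (fubini_tonelli (fun z => (\1_D z)%:E))/=; last 2 first.
- exact/measurable_EFinP/measurable_indic.
- by move=> z; rewrite lee_fin.
transitivity (\int[mu]_t \int[m]_x (\1_D (x, t) * p x)%:E)%E.
  apply: eq_integral => t _.
  have mDt : measurable (ysection D t) by exact: measurable_ysection.
  have -> : (\int[nu]_x (\1_D (x, t))%:E = \int[nu]_x (\1_(ysection D t) x)%:E)%E.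
    by apply: eq_integral => x _; rewrite !indicE mem_ysection.
  rewrite integral_indic//= setIT nuE// integral_mkcond.
  apply: eq_integral => x _; rewrite patchE indicE mem_ysection.
  by case: ((x, t) \in D); rewrite ?mul1r ?mul0r.
rewrite -(fubini_tonelli (fun z => (\1_D z * p z.1)%:E))/=; last 2 first.
- apply/measurable_EFinP; apply: measurable_funM; first exact: measurable_indic.
  exact: measurableT_comp.
- by move=> z; rewrite lee_fin mulr_ge0.
apply: eq_integral => x _.
under eq_integral do rewrite EFinM muleC.
rewrite ge0_integralZl//.
- by rewrite -fE EFinM muleC.
- apply/measurable_EFinP.
  apply: (@measurableT_comp _ _ _ _ _ _ (\1_D : T * RR -> R) _ (fun t => (x, t))).
    exact: measurable_indic.
  exact: pair1_measurable.
- by rewrite lee_fin.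
Qed.

End density.

(** * The standard normal law *)

Section normal_law.
Context {R : realType}.
Local Notation mu := (@lebesgue_measure R).
Local Notation RR := (measurableTypeR R).
Local Notation N01 := (@normal_prob R 0 1).

Lemma Exp_density_normal (s : R) (f : R -> R) :
  measurable_fun setT f -> (forall x, 0 <= f x) ->
  (\int[normal_prob 0 s]_x (f x)%:E = \int[mu]_x (f x * normal_pdf 0 s x)%:E)%E.
Proof.
move=> mf f0; apply: integral_density => //.
- exact: measurable_normal_pdf.
- by move=> x; exact: normal_pdf_ge0.
Qed.

Lemma normal_pdf1E (x : R) :
  normal_pdf 0 1 x = normal_peak 1 * expR (- (x ^+ 2 / 2)).
Proof.
by rewrite normal_pdfE ?oner_eq0// /normal_fun subr0 expr1n mulNr.
Qed.

Lemma normal_peakE (s : R) : normal_peak s = `|s|^-1 * normal_peak 1.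
Proof.
rewrite /normal_peak -mulrnAr sqrtrM ?sqr_ge0// sqrtr_sqr invfM.
by congr (_ * (Num.sqrt _)^-1); rewrite expr1n mul1r.
Qed.

Lemma normal_pdf_scale (s x : R) : s != 0 ->
  normal_pdf 0 1 x = `|s| * normal_pdf 0 s (s * x).
Proof.
move=> s0; rewrite !normal_pdfE ?oner_eq0// /normal_fun !subr0 mulrA; congr (_ * expR _).
  by rewrite [in RHS]normal_peakE mulrA divff ?mul1r// normr_eq0.
by rewrite exprMn expr1n -mulr_natr; field.
Qed.

Lemma normal_pdfN (s : R) : normal_pdf 0 (- s) = normal_pdf 0 s :> (R -> R).
Proof.
apply/funext => x; have [->|s0] := eqVneq s 0; first by rewrite oppr0.
by rewrite !normal_pdfE ?oppr_eq0// /normal_peak /normal_fun sqrrN.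
Qed.

Lemma ge0_integral_scale (s : R) (h : RR -> \bar R) : s != 0 ->
  measurable_fun setT h -> (forall x, 0 <= h x)%E ->
  (\int[mu]_x h x = `|s|%:E * \int[mu]_x h (s * x)%R)%E.
Proof.
move=> s0 mh h0.
have mf : measurable_fun setT (fun z : RR => s * z : RR) by exact: measurable_funM.
pose m : {measure set RR -> \bar R} := mscale (NngNum (normr_ge0 s))
  (measure_function_pushforward__canonical__measure_function_Measure mu mf).
transitivity (\int[m]_x h x)%E.
  apply: eq_measure_integral => A mA _.
  exact: lebesgue_measure_scale.
rewrite ge0_integral_mscale//; congr (_ * _)%E.
by rewrite ge0_integral_pushforward.
Qed.

Lemma normal_probE (s : R) (C : set R) :
  normal_prob 0 s C = (\int[mu]_x (\1_C x * normal_pdf 0 s x)%:E)%E.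
Proof.
rewrite /normal_prob integral_mkcond; apply: eq_integral => x _.
by rewrite patchE indicE; case: (x \in C); rewrite ?mul1r ?mul0r.
Qed.

Lemma normal_scale (s : R) : s != 0 ->
  same_law N01 (fun z : RR => s * z : RR) (normal_prob 0 s) id.
Proof.
move=> s0 C mC; rewrite preimage_id.
change (N01 ((fun z : RR => s * z : RR) @^-1` C) = normal_prob 0 s C).
rewrite !normal_probE.
have ms : measurable_fun setT (fun x : R => \1_C x * normal_pdf 0 s x).
  by apply: measurable_funM; [exact: measurable_indic|exact: measurable_normal_pdf].
rewrite [RHS](@ge0_integral_scale s)//; last 2 first.
- exact/measurable_EFinP.
- by move=> x; rewrite lee_fin mulr_ge0// normal_pdf_ge0.
rewrite -ge0_integralZl//; last 2 first.
- apply/measurable_EFinP; apply: (measurableT_comp ms).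
  exact: measurable_funM.
- by move=> x _; rewrite lee_fin mulr_ge0// normal_pdf_ge0.
apply: eq_integral => x _; rewrite -EFinM; congr _%:E.
rewrite (normal_pdf_scale _ s0) mulrCA; congr (_ * (_ * _)).
Qed.

(** The density of a pair of independent standard normal variables depends
    only on the radius, so their law is rotation invariant, and so is the
    law of the first coordinate. *)
Lemma normal_rot (c e : R) : c ^+ 2 + e ^+ 2 = 1 -> e != 0 ->
  same_law (N01 \x N01)%E (fun z : RR * RR => c * z.1 + e * z.2 : RR) N01 id.
Proof.
move=> ce1 e0 C mC; rewrite preimage_id.
pose q (z : RR * RR) := normal_pdf 0 1 z.1 * normal_pdf 0 1 z.2.
pose F (z : RR * RR) := (\1_C z.1 * q z)%:E.
have mp1 : measurable_fun setT (fun z : RR * RR => normal_pdf 0 1 z.1).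
  by apply: measurableT_comp => //; exact: measurable_normal_pdf.
have mp2 : measurable_fun setT (fun z : RR * RR => normal_pdf 0 1 z.2).
  by apply: measurableT_comp => //; exact: measurable_normal_pdf.
have mq : measurable_fun setT q by exact: measurable_funM.
have mF : measurable_fun setT F.
  apply/measurable_EFinP; apply: measurable_funM => //.
  by apply: (measurableT_comp (f := \1_C : RR -> R)) => //; exact: measurable_indic.
have F0 z : (0 <= F z)%E by rewrite lee_fin mulr_ge0// mulr_ge0// normal_pdf_ge0.
have mrot := measurable_rot2 c e.
have q_rot z : q (rot2 c e z) = q z.
  rewrite /q !normal_pdf1E /= mulrACA [RHS]mulrACA -!expRD; congr (_ * expR _).
  rewrite -!opprD -!mulrDl; congr (- (_ / _)).
  transitivity ((c ^+ 2 + e ^+ 2) * (z.1 ^+ 2 + z.2 ^+ 2)); first by ring.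
  by rewrite ce1 mul1r.
have mg : measurable_fun setT (fun z : RR * RR => c * z.1 + e * z.2 : RR).
  exact: (measurableT_comp measurable_fst mrot).
transitivity (\int[(mu \x mu)%E]_z F (rot2 c e z))%E.
  rewrite fubini_tonelli1//; last by apply: measurableT_comp.
  pose D := (fun z : RR * RR => c * z.1 + e * z.2 : RR) @^-1` C.
  have mD : measurable D by rewrite -[X in measurable X]setTI; exact: mg.
  have mG : measurable_fun setT (fun x => N01 (xsection D x)).
    exact: measurable_fun_xsection.
  transitivity (\int[N01]_x (fine (N01 (xsection D x)))%:E)%E.
    apply: eq_integral => x _; rewrite fineK// fin_num_measure//.
    exact: measurable_xsection.
  rewrite Exp_density_normal; last 2 first.
  - exact: measurableT_comp.
  - by move=> x; rewrite fine_ge0.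
  apply: eq_integral => x _.
  rewrite EFinM fineK; last by rewrite fin_num_measure//; exact: measurable_xsection.
  pose h y := (\1_(xsection D x) y * normal_pdf 0 1 y)%:E.
  transitivity ((normal_pdf 0 1 x)%:E * \int[mu]_y h y)%E.
    by rewrite muleC; congr (_ * _)%E; exact: normal_probE.
  transitivity (\int[mu]_y ((normal_pdf 0 1 x)%:E * h y))%E.
    apply/esym/ge0_integralZl => //.
    - apply/measurable_EFinP; apply: measurable_funM; last exact: measurable_normal_pdf.
      by apply: measurable_indic; exact: measurable_xsection.
    - by move=> y _; rewrite lee_fin mulr_ge0// normal_pdf_ge0.
    - by rewrite lee_fin normal_pdf_ge0.
  rewrite /h /fubini_F.
  apply: eq_integral => y _; rewrite -EFinM /F q_rot /q mulrCA; congr (_ * _)%:E.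
  by rewrite !indicE /rot2/= mem_xsection; congr (_%:R); apply/idP/idP; rewrite !inE.
rewrite (ge0_same_law_integral mrot (@measurable_id _ _ setT) (lebesgue2_rot ce1 e0) mF F0).
rewrite fubini_tonelli1//; transitivity (normal_prob 0 1 C) => //.
rewrite normal_probE; apply: eq_integral => x _.
rewrite /fubini_F /F /q/=.
under eq_integral do rewrite mulrA EFinM.
rewrite ge0_integralZl//; last 3 first.
- by apply/measurable_EFinP; exact: measurable_normal_pdf.
- by move=> y _; rewrite lee_fin normal_pdf_ge0.
- by rewrite lee_fin mulr_ge0// normal_pdf_ge0.
by rewrite integral_normal_pdf mule1.
Qed.

(** The integrand times the standard normal density is a multiple of the
    normal density of standard deviation [t]. This Laplace transform of the
    square gives all the moment bounds below. *)
Lemma Exp_normal_sqr_exp (t : R) : 0 < t ->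
  (\int[N01]_z (expR ((1 - t ^- 2) / 2 * z ^+ 2))%:E = t%:E)%E.
Proof.
move=> t0; rewrite (@Exp_density_normal 1 (fun z => expR ((1 - t ^- 2) / 2 * z ^+ 2))); last 2 first.
- by apply: measurableT_comp => //; apply: measurable_funM => //; exact: measurable_funX.
- by move=> x; exact: expR_ge0.
transitivity (\int[mu]_x (t%:E * (normal_pdf 0 t x)%:E))%E; last first.
  by rewrite integralZl//; [rewrite integral_normal_pdf mule1|exact: integrable_normal_pdf].
apply: eq_integral => x _; rewrite -EFinM; congr _%:E.
rewrite normal_pdf1E mulrCA -expRD normal_pdfE ?gt_eqF// /normal_fun subr0.
rewrite [RHS]mulrA; congr (_ * expR _).
  by rewrite [in RHS]normal_peakE mulrA gtr0_norm// divff ?mul1r// gt_eqF.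
by rewrite -[_ *+ 2]mulr_natr; field; rewrite gt_eqF.
Qed.

Lemma L1_normal_sqr_exp (t : R) : 0 < t ->
  L1 N01 (fun z => expR ((1 - t ^- 2) / 2 * z ^+ 2)).
Proof.
move=> t0; apply/integrableP; split.
  apply/measurable_EFinP.
  by apply: measurableT_comp => //; apply: measurable_funM => //; exact: measurable_funX.
under eq_integral do rewrite /= ger0_norm ?expR_ge0//.
by rewrite Exp_normal_sqr_exp// ltry.
Qed.

(** The cube is dominated by the exponential of a small multiple of the
    square. *)
Lemma L1_normal_norm3 : L1 N01 (fun z => `|z| ^+ 3).
Proof.
(* the standard deviation 2 corresponds to the exponent 3 / 8 * x ^+ 2 *)
have l := L1_normal_sqr_exp (ltr0Sn R 1).
apply: (L1_le _ (L1Z 64 l)).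
  by apply: measurable_funX; exact: normr_measurable.
move=> x; rewrite normrX normr_id.
set y := (1 - _) / 2 * x ^+ 2.
have yE : y = 3 / 8 * `|x| ^+ 2.
  by rewrite /y real_normK ?num_real//; field.
have y0 : 0 <= y by rewrite yE mulr_ge0// ?divr_ge0// sqr_ge0.
have h : (1 + y / 2) ^+ 2 <= expR y.
  rewrite (_ : expR y = expR (y / 2) ^+ 2).
    by apply: lerXn2r; [rewrite nnegrE; lra|exact: expR_ge0|exact: expR_ge1Dx].
  by rewrite -expRM_natl mulr_natl -mulr_natr divfK.
apply: le_trans (_ : 64 * (1 + y / 2) ^+ 2 <= _); last by rewrite ler_pM2l.
rewrite yE; have := normr_ge0 x; move: `|x| => a a0; nra.
Qed.

Lemma L1_normal_sqr : L1 N01 (fun z => z ^+ 2).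
Proof.
apply: (@L1_le _ _ RR N01 (fun z => z ^+ 2) (fun z => 1 + `|z| ^+ 3)).
- exact: measurable_funX.
- by apply: L1D; [exact: L1_cst|exact: L1_normal_norm3].
- move=> x; rewrite normrX; have := normr_ge0 x; move: `|x| => a a0.
  have h : 0 <= (a - 1) ^+ 2 * (a + 1) by rewrite mulr_ge0 ?sqr_ge0//; lra.
  lra.
Qed.

Lemma L1_normal_id : L1 N01 (fun z : R => z).
Proof.
apply: (@L1_le _ _ RR N01 id (fun z => 1 + z ^+ 2)) => //.
  by apply: L1D; [exact: L1_cst|exact: L1_normal_sqr].
by move=> x; rewrite -[x ^+ 2]real_normK ?num_real//; nra.
Qed.

(** Since exp x >= 1 + x, the Laplace transform of the square gives an
    affine bound on the second moment for each [t]; values of [t] close to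
    1, on either side, give both inequalities. *)
Lemma Exp_normal_sqr : \int[N01]_z (z ^+ 2) = 1.
Proof.
set v := \int[_]_z _.
have h t : 0 < t -> 1 + (1 - t ^- 2) / 2 * v <= t.
  move=> t0; pose k := (1 - t ^- 2) / 2.
  suff : 1 + k * v <= t by [].
  rewrite [leRHS](_ : _ = \int[N01]_z expR ((1 - t ^- 2) / 2 * z ^+ 2)); last first.
    by rewrite /Rintegral Exp_normal_sqr_exp.
  rewrite -/k; have <- : \int[N01]_z (1 + k * z ^+ 2) = 1 + k * v.
    rewrite RintegralD//; last 2 first.
    - exact: L1_cst.
    - by apply: L1Z; exact: L1_normal_sqr.
    by rewrite Exp_cst RintegralZl//; exact: L1_normal_sqr.
  apply: le_Rintegral => //.
  - apply: L1D; first exact: L1_cst.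
    by apply: L1Z; exact: L1_normal_sqr.
  - exact: L1_normal_sqr_exp.
  - by move=> x _; exact: expR_ge1Dx.
have key t : 0 < t -> (t ^+ 2 - 1) * v <= 2 * t ^+ 2 * (t - 1).
  move=> t0; have t2 : 0 < 2 * t ^+ 2 by rewrite mulr_gt0// exprn_gt0.
  have := ler_wpM2l (ltW t2) (h t t0).
  rewrite (_ : 2 * t ^+ 2 * (1 + _) = 2 * t ^+ 2 + (t ^+ 2 - 1) * v); last first.
    by field; rewrite gt_eqF.
  lra.
apply/eqP; rewrite eq_le; apply/andP; split.
  apply/ler_addgt0Pr => e e0; rewrite leNgt; apply/negP => ve.
  pose u := e / 2; have u0 : 0 < u by rewrite /u; lra.
  have := key (1 + u) ltac:(lra).
  have : 0 < u * (2 + u) * (v - (1 + 2 * u)).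
    by rewrite !mulr_gt0//; rewrite /u; lra.
  have : 0 < u * u by rewrite mulr_gt0.
  nra.
rewrite leNgt; apply/negP => v1.
have [v0|v0] := leP v 0.
  by have := key (1 / 2) ltac:(lra); lra.
pose t := (1 + v) / 2.
have := key t ltac:(rewrite /t; lra).
have : 0 < (1 - t) * (1 - t) * (1 + 2 * t).
  by rewrite !mulr_gt0//; rewrite /t; lra.
have -> : v = 2 * t - 1 by rewrite /t; field.
nra.
Qed.

Lemma Exp_normal_id : \int[N01]_z z = 0.
Proof.
have h : same_law N01 (fun z : RR => - z : RR) N01 id.
  move=> C mC; have N1 : -1 != 0 :> R by rewrite oppr_eq0 oner_eq0.
  transitivity (N01 ((fun z : RR => -1 * z : RR) @^-1` C)).
    by congr (N01 _); apply/seteqP; split=> z /=; rewrite mulN1r.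
  rewrite (normal_scale N1 mC) preimage_id.
  change (normal_prob 0 (-1) C = normal_prob 0 1 C).
  by rewrite !normal_probE normal_pdfN.
have : \int[N01]_z (- z) = \int[N01]_z z.
  have mN : measurable_fun setT (fun z : RR => - z : RR) by exact: measurableT_comp.
  have mid := @measurable_id _ RR setT.
  exact: (same_law_Exp mN mid h mid).
have -> : \int[N01]_z (- z) = - \int[N01]_z z.
  under eq_Rintegral do rewrite -mulN1r.
  by rewrite RintegralZl// ?mulN1r//; exact: L1_normal_id.
clear h; lra.
Qed.

End normal_law.

(** * Gaussian vectors *)

Section normal_stability.
Context {R : realType}.
Local Notation RR := (measurableTypeR R).
Local Notation N01 := (@normal_prob R 0 1).

(** After normalisation the coefficients are the cosine and the sine of a
    rotation. *)
Lemma normal_stable (a b : R) : 0 <= a -> 0 <= b ->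
  same_law (N01 \x N01)%E (fun z : RR * RR => a * z.1 + b * z.2 : RR)
           N01 (fun z : RR => Num.sqrt (a ^+ 2 + b ^+ 2) * z : RR).
Proof.
move=> a0 b0; have [->|bN0] := eqVneq b 0.
  have -> : Num.sqrt (a ^+ 2 + 0 ^+ 2) = a by rewrite expr0n addr0 sqrtr_sqr ger0_norm.
  move=> C mC.
  have mC' : measurable ((fun z : RR => a * z : RR) @^-1` C).
    by rewrite -[X in measurable X]setTI; apply: measurable_funM.
  transitivity ((N01 \x N01)%E (((fun z : RR => a * z : RR) @^-1` C) `*` setT)).
    by congr ((N01 \x N01)%E _); apply/seteqP; split=> z /=; rewrite mul0r addr0// => -[].
  rewrite [LHS]product_measure1E// [X in (_ * X)%E](_ : _ = 1%E) ?mule1//.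
  exact: (@probability_setT _ _ _ N01).
pose r := Num.sqrt (a ^+ 2 + b ^+ 2).
have r2 : r ^+ 2 = a ^+ 2 + b ^+ 2 by rewrite sqr_sqrtr// addr_ge0 ?sqr_ge0.
have r0 : 0 < r.
  by rewrite sqrtr_gt0 ltr_wpDl ?sqr_ge0// exprn_even_gt0.
have ce : (a / r) ^+ 2 + (b / r) ^+ 2 = 1.
  by rewrite !expr_div_n -mulrDl -r2 divff// gt_eqF// exprn_gt0.
have e0 : b / r != 0 by rewrite mulf_neq0// invr_eq0 gt_eqF.
have mr : measurable_fun setT (fun z : RR => r * z : RR) by exact: measurable_funM.
move=> C mC; rewrite -[RHS](same_law_comp mr (normal_rot ce e0) mC).
have E (z : RR * RR) : r * (a / r * z.1 + b / r * z.2) = a * z.1 + b * z.2.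
  by field; rewrite gt_eqF.
by congr ((N01 \x N01)%E _); apply/seteqP; split=> z /=; rewrite E.
Qed.

End normal_stability.

Section independence_more.
Context {R : realType} d (T : measurableType d) (P : probability T R).

Lemma indep2_comp d1 d2 d1' d2' (T1 : measurableType d1) (T2 : measurableType d2)
    (T1' : measurableType d1') (T2' : measurableType d2')
    (A : T -> T1) (B : T -> T2) (g : T1 -> T1') (h : T2 -> T2') :
  measurable_fun setT g -> measurable_fun setT h ->
  indep2 P A B -> indep2 P (g \o A) (h \o B).
Proof.
move=> mg mh AB a b ma mb; apply: (AB (g @^-1` a) (h @^-1` b)).
  by rewrite -[X in measurable X]setTI; exact: mg.
by rewrite -[X in measurable X]setTI; exact: mh.
Qed.

Lemma indep2_ExpM (A B : T -> R) : indep2 P A B -> L1 P A -> L1 P B ->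
  L1 P (fun w => A w * B w) /\
  \int[P]_w (A w * B w) = (\int[P]_w A w) * (\int[P]_w B w).
Proof.
move=> AB lA lB.
have mA := L1_measurable lA; have mB := L1_measurable lB.
have mp2 : measurable_fun setT (fun z : T * T => (A z.1, B z.2)).
  by apply: measurable_fun_pair; exact: measurableT_comp.
have mp1 : measurable_fun setT (fun w => (A w, B w)).
  exact: measurable_fun_pair.
have mm : measurable_fun setT (fun z : R * R => z.1 * z.2).
  exact: measurable_funM.
have law := indep2_law mA mB AB.
have lprod : (P \x P)%E.-integrable setT (fun z => (A z.1 * B z.2)%:E).
  apply/integrable12ltyP.
    apply/measurable_EFinP; exact: (measurableT_comp mm mp2).
  have -> : (\int[P]_x \int[P]_y `|(A (x, y).1 * B (x, y).2)%:E| =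
      \int[P]_x (`|A x| * \int[P]_y `|B y|)%R%:E)%E.
    apply: eq_integral => x _; rewrite EFinM -(Exp_EFin (L1_norm lB)).
    rewrite -ge0_integralZl//=.
    - by apply: eq_integral => y _; rewrite normrM EFinM.
    - by apply/measurable_EFinP; exact: measurableT_comp.
  have lA' : L1 P (fun x => `|A x| * \int[P]_y `|B y|).
    have -> : (fun x => `|A x| * \int[P]_y `|B y|) =
      (fun x => \int[P]_y `|B y| * `|A x|) by apply/funext => x; rewrite mulrC.
    exact/L1Z/L1_norm.
  by rewrite (Exp_EFin lA') ltry.
split.
  exact: (same_law_L1 mp1 mp2 law mm).
have -> : \int[P]_w (A w * B w) = \int[(P \x P)%E]_z (A z.1 * B z.2).
  exact: (same_law_Exp mp1 mp2 law mm).
rewrite {1}/Rintegral -integral12_prod_meas1//.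
rewrite -[RHS]mulrC -RintegralZl// /Rintegral; congr fine.
apply: eq_integral => x _; rewrite /fubini_F /= mulrC EFinM.
rewrite -(Exp_EFin lB) -integralZl//.
Qed.

End independence_more.

Section gaussian_vectors.
Context {R : realType} d (T : measurableType d) (P : probability T R).
Local Notation RR := (measurableTypeR R).
Local Notation N01 := (@normal_prob R 0 1).
Variable n : nat.

(** Stability in the sense of expectations: a combination of two independent
    copies with coefficients [a] and [b] has the law of one copy scaled by
    the square root of [a ^+ 2 + b ^+ 2]. The two copies are expressed by a
    double integral, so that no product space has to be formed. *)
Definition stable (N : 'I_n -> T -> R) : Prop :=
  forall F : n.-tuple R -> R, bmeas F -> forall a b : R, 0 <= a -> 0 <= b ->
  \int[P]_w \int[P]_w' F [tuple a * N l w + b * N l w' | l < n] =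
  \int[P]_w F [tuple Num.sqrt (a ^+ 2 + b ^+ 2) * N l w | l < n].

Lemma measurable_mktuple d' (T' : measurableType d') (f : 'I_n -> T' -> R) :
  (forall l, measurable_fun setT (f l)) ->
  measurable_fun setT (fun w => [tuple f l w | l < n] : n.-tuple R).
Proof.
move=> mf; apply/measurable_fun_tnthP => l.
rewrite (_ : _ \o _ = f l)//.
by apply/funext => w /=; rewrite tnth_mktuple.
Qed.

Lemma bmeas_mktuple d' (T' : measurableType d') (f : 'I_n -> T' -> R)
    (F : n.-tuple R -> R) : bmeas F -> (forall l, measurable_fun setT (f l)) ->
  bmeas (fun w => F [tuple f l w | l < n]).
Proof. by move=> bF mf; apply: (bmeas_comp bF); exact: measurable_mktuple. Qed.

(** For a vector that is a multiple of one normal variable, stability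
    reduces to the rotation invariance of a pair of such variables. *)
Lemma stable_line (X : T -> R) (s : R) (u : 'I_n -> R) :
  measurable_fun setT X -> same_law P X N01 (fun z : RR => s * z : RR) ->
  stable (fun l w => u l * X w).
Proof.
move=> mX law F bF a b a0 b0.
have ms : measurable_fun setT (fun z : RR => s * z : RR) by exact: measurable_funM.
pose H (x y : RR) := F [tuple a * (u l * x) + b * (u l * y) | l < n].
have bH : bmeas (fun z : RR * RR => H z.1 z.2).
  apply: (bmeas_mktuple bF) => l.
  by apply: measurable_funD; apply: measurable_funM => //; exact: measurable_funM.
pose K (x : RR) := \int[N01]_z H x (s * z).
have bHs : bmeas (fun z : RR * RR => H z.1 (s * z.2)).
  apply: (bmeas_comp (g := fun z : RR * RR => (z.1, s * z.2 : RR)) bH).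
  by apply: measurable_fun_pair => //; exact: measurable_funM.
have bK : bmeas K by exact: (@bmeas_Exp _ _ _ RR RR N01 (fun x z => H x (s * z)) bHs).
transitivity (\int[P]_w K (X w)).
  apply: eq_Rintegral => w _.
  exact: (same_law_Exp mX ms law (bmeas_pair bH (X w)).1).
rewrite (same_law_Exp mX ms law bK.1).
have bF' : bmeas (fun x : RR => F [tuple u l * (s * x) | l < n]).
  apply: (bmeas_mktuple bF) => l; apply: measurable_funM => //.
have bF2 : bmeas (fun x : RR => F [tuple Num.sqrt (a ^+ 2 + b ^+ 2) * (u l * x) | l < n]).
  apply: (bmeas_mktuple bF) => l; apply: measurable_funM => //; exact: measurable_funM.
rewrite (same_law_Exp mX ms law bF2.1).
have bHss : bmeas (fun z : RR * RR => H (s * z.1) (s * z.2)).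
  apply: (bmeas_comp (g := fun z : RR * RR => (s * z.1 : RR, s * z.2 : RR)) bH).
  by apply: measurable_fun_pair => //; exact: measurable_funM.
rewrite /K -(@Exp_prod _ _ _ RR RR N01 N01 (fun x y => H (s * x) (s * y)))//.
have mab : measurable_fun setT (fun z : RR * RR => a * z.1 + b * z.2 : RR).
  by apply: measurable_funD; exact: measurable_funM.
have mr : measurable_fun setT (fun z : RR => Num.sqrt (a ^+ 2 + b ^+ 2) * z : RR).
  exact: measurable_funM.
transitivity (\int[(N01 \x N01)%E]_z F [tuple u l * (s * (a * z.1 + b * z.2)) | l < n]).
  apply: eq_Rintegral => z _; congr F; apply: eq_from_tnth => l.
  by rewrite !tnth_mktuple; ring.
rewrite (same_law_Exp mab mr (normal_stable a0 b0) bF'.1).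
apply: eq_Rintegral => z _; congr F; apply: eq_from_tnth => l.
by rewrite !tnth_mktuple; ring.
Qed.

(** Independence allows each of the two copies of the sum to be replaced by
    a sum of independent copies of the summands; then stability is applied
    to each summand separately. *)
Lemma stableD (N M : 'I_n -> T -> R) :
  (forall l, measurable_fun setT (N l)) -> (forall l, measurable_fun setT (M l)) ->
  indep2 P (fun w => [tuple N l w | l < n]) (fun w => [tuple M l w | l < n]) ->
  stable N -> stable M -> stable (fun l w => N l w + M l w).
Proof.
move=> mN mM NM sN sM F bF a b a0 b0.
have [r rE] : exists r, r = Num.sqrt (a ^+ 2 + b ^+ 2) by eexists.
rewrite -rE.
have mtN := measurable_mktuple mN; have mtM := measurable_mktuple mM.
have F_ext (f g : 'I_n -> R) : f =1 g -> F [tuple f l | l < n] = F [tuple g l | l < n].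
  by move=> fg; congr F; apply: eq_from_tnth => l; rewrite !tnth_mktuple.
pose G (w u w' u' : T) := F [tuple a * (N l w + M l u) + b * (N l w' + M l u') | l < n].
have mfst l (f : 'I_n -> T -> R) d1 (T1 : measurableType d1) (g : T1 -> T) :
    measurable_fun setT (f l) -> measurable_fun setT g ->
    measurable_fun setT (fun z => f l (g z)).
  by move=> mf mg; exact: measurableT_comp.
have bG : bmeas (fun z : ((T * T) * T) * T => G z.1.1.1 z.1.1.2 z.1.2 z.2).
  apply: (bmeas_mktuple bF) => l.
  by apply: measurable_funD; apply: measurable_funM => //; apply: measurable_funD;
    apply: mfst => //; do ?[exact: measurableT_comp|apply: measurableT_comp => //].
have bG1 : bmeas (fun z : (T * T) * T => \int[P]_u' G z.1.1 z.1.2 z.2 u').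
  exact: (@bmeas_Exp _ _ _ _ _ P (fun (z : (T * T) * T) u' => G z.1.1 z.1.2 z.2 u')).
(* the two coordinates of the inner copy are replaced by independent copies *)
transitivity (\int[P]_w \int[P]_w' \int[P]_u' G w w w' u').
  apply: eq_Rintegral => w _.
  pose f (x y : n.-tuple R) :=
    F [tuple a * (N l w + M l w) + b * (tnth x l + tnth y l) | l < n].
  have bf : bmeas (fun z : n.-tuple R * n.-tuple R => f z.1 z.2).
    apply: (bmeas_mktuple bF) => l; apply: measurable_funD => //.
    apply: measurable_funM => //; apply: measurable_funD;
      apply: (measurableT_comp (measurable_tnth l)) => //.
  transitivity (\int[P]_w' f [tuple N l w' | l < n] [tuple M l w' | l < n]).
    by apply: eq_Rintegral => w' _; apply: F_ext => l; rewrite !tnth_mktuple.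
  transitivity (\int[P]_w \int[P]_w' f [tuple N l w | l < n] [tuple M l w' | l < n]).
    exact: (indep2_Exp mtN mtM NM bf).
  apply: eq_Rintegral => w' _; apply: eq_Rintegral => u' _.
  by apply: F_ext => l; rewrite !tnth_mktuple.
transitivity (\int[P]_w \int[P]_u \int[P]_w' \int[P]_u' G w u w' u').
  pose f (x y : n.-tuple R) := \int[P]_w' \int[P]_u'
    F [tuple a * (tnth x l + tnth y l) + b * (N l w' + M l u') | l < n].
  have bf3 : bmeas (fun z : ((n.-tuple R * n.-tuple R) * T) * T =>
      F [tuple a * (tnth z.1.1.1 l + tnth z.1.1.2 l) + b * (N l z.1.2 + M l z.2) | l < n]).
    apply: (bmeas_mktuple bF) => l; apply: measurable_funD => //;
      apply: measurable_funM => //; apply: measurable_funD.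
    - by apply: (measurableT_comp (measurable_tnth l)); do 2 apply: measurableT_comp => //.
    - by apply: (measurableT_comp (measurable_tnth l)); do 2 apply: measurableT_comp => //.
    - by apply: mfst => //; exact: measurableT_comp.
    - by apply: mfst.
  have bf2 := @bmeas_Exp _ _ _ _ _ P (fun (z : (n.-tuple R * n.-tuple R) * T) u' =>
    F [tuple a * (tnth z.1.1 l + tnth z.1.2 l) + b * (N l z.2 + M l u') | l < n]) bf3.
  have bf : bmeas (fun z : n.-tuple R * n.-tuple R => f z.1 z.2).
    exact: (@bmeas_Exp _ _ _ _ _ P (fun (z : n.-tuple R * n.-tuple R) w' => \int[P]_u'
      F [tuple a * (tnth z.1 l + tnth z.2 l) + b * (N l w' + M l u') | l < n]) bf2).
  transitivity (\int[P]_w f [tuple N l w | l < n] [tuple M l w | l < n]).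
    apply: eq_Rintegral => w _; apply: eq_Rintegral => w' _; apply: eq_Rintegral => u' _.
    by apply: F_ext => l; rewrite !tnth_mktuple.
  transitivity (\int[P]_w \int[P]_w' f [tuple N l w | l < n] [tuple M l w' | l < n]).
    exact: (indep2_Exp mtN mtM NM bf).
  apply: eq_Rintegral => w _; apply: eq_Rintegral => u _.
  apply: eq_Rintegral => w' _; apply: eq_Rintegral => u' _.
  by apply: F_ext => l; rewrite !tnth_mktuple.
pose G3 (w w' u : T) := F [tuple a * N l w + b * N l w' + r * M l u | l < n].
have bG3 : bmeas (fun z : (T * T) * T => G3 z.1.1 z.1.2 z.2).
  apply: (bmeas_mktuple bF) => l; apply: measurable_funD.
    by apply: measurable_funD; apply: measurable_funM => //; apply: mfst => //;
      exact: measurableT_comp.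
  by apply: measurable_funM => //; apply: mfst.
transitivity (\int[P]_w \int[P]_w' \int[P]_u G3 w w' u).
  apply: eq_Rintegral => w _.
  rewrite (@Exp_swap _ _ _ _ _ P P (fun u w' => \int[P]_u' G w u w' u')); last first.
    apply: (bmeas_comp (g := fun z : T * T => ((w, z.1), z.2)) bG1).
    by do 2 apply: measurable_fun_pair => //.
  apply: eq_Rintegral => w' _.
  pose F' (x : n.-tuple R) := F [tuple a * N l w + b * N l w' + tnth x l | l < n].
  have bF' : bmeas F'.
    apply: (bmeas_mktuple bF) => l; apply: measurable_funD => //; exact: measurable_tnth.
  transitivity (\int[P]_u \int[P]_u' F' [tuple a * M l u + b * M l u' | l < n]).
    apply: eq_Rintegral => u _; apply: eq_Rintegral => u' _.
    by apply: F_ext => l; rewrite tnth_mktuple; ring.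
  rewrite (sM F' bF' a b a0 b0) -rE; apply: eq_Rintegral => u _.
  by apply: F_ext => l; rewrite tnth_mktuple.
have sw : \int[P]_w \int[P]_w' \int[P]_u G3 w w' u =
    \int[P]_u \int[P]_w \int[P]_w' G3 w w' u.
  transitivity (\int[P]_w \int[P]_u \int[P]_w' G3 w w' u).
    apply: eq_Rintegral => w _.
    apply: (@Exp_swap _ _ _ _ _ P P (fun w' u => G3 w w' u)).
    apply: (bmeas_comp (g := fun z : T * T => ((w, z.1), z.2)) bG3).
    by do 2 apply: measurable_fun_pair => //.
  apply: (@Exp_swap _ _ _ _ _ P P (fun w u => \int[P]_w' G3 w w' u)).
  apply: (@bmeas_Exp _ _ _ _ _ P (fun (z : T * T) w' => G3 z.1 w' z.2)).
  apply: (bmeas_comp (g := fun z : (T * T) * T => ((z.1.1, z.2), z.1.2)) bG3).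
  apply: measurable_fun_pair => //; last exact: measurableT_comp.
  by apply: measurable_fun_pair => //; exact: measurableT_comp.
rewrite sw.
pose G2 (w u : T) := F [tuple r * (N l w + M l u) | l < n].
have bG2 : bmeas (fun z : T * T => G2 z.1 z.2).
  apply: (bmeas_mktuple (f := fun l (z : T * T) => r * (N l z.1 + M l z.2)) bF) => l.
  apply: measurable_funM; first exact: measurable_cst.
  by apply: measurable_funD; apply: mfst.
transitivity (\int[P]_u \int[P]_w G2 w u).
  apply: eq_Rintegral => u _.
  pose F' (x : n.-tuple R) := F [tuple tnth x l + r * M l u | l < n].
  have bF' : bmeas F'.
    apply: (bmeas_mktuple (f := fun l (x : n.-tuple R) => tnth x l + r * M l u) bF) => l.
    apply: measurable_funD; [exact: measurable_tnth|exact: measurable_cst].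
  transitivity (\int[P]_w \int[P]_w' F' [tuple a * N l w + b * N l w' | l < n]).
    apply: eq_Rintegral => w _; apply: eq_Rintegral => w' _.
    by apply: F_ext => l; rewrite tnth_mktuple.
  rewrite (sN F' bF' a b a0 b0) -rE; apply: eq_Rintegral => w _.
  by apply: F_ext => l; rewrite tnth_mktuple; ring.
transitivity (\int[P]_w \int[P]_u G2 w u).
  exact: (esym (@Exp_swap _ _ _ _ _ P P (fun w u => G2 w u) bG2)).
pose f (x y : n.-tuple R) := F [tuple r * (tnth x l + tnth y l) | l < n].
have bf : bmeas (fun z : n.-tuple R * n.-tuple R => f z.1 z.2).
  apply: (bmeas_mktuple
    (f := fun l (z : n.-tuple R * n.-tuple R) => r * (tnth z.1 l + tnth z.2 l)) bF) => l.
  apply: measurable_funM; first exact: measurable_cst.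
  by apply: measurable_funD; apply: (measurableT_comp (measurable_tnth l)).
transitivity (\int[P]_w \int[P]_u f [tuple N l w | l < n] [tuple M l u | l < n]).
  apply: eq_Rintegral => w _; apply: eq_Rintegral => u _.
  by apply: F_ext => l; rewrite !tnth_mktuple.
transitivity (\int[P]_w f [tuple N l w | l < n] [tuple M l w | l < n]).
  exact/esym/(indep2_Exp mtN mtM NM bf).
by apply: eq_Rintegral => w _; apply: F_ext => l; rewrite !tnth_mktuple.
Qed.

End gaussian_vectors.

Section gaussian_family.
Context {R : realType} d (T : measurableType d) (P : probability T R).
Local Notation RR := (measurableTypeR R).
Local Notation N01 := (@normal_prob R 0 1).

(** For variance 0 the law is a Dirac mass, which is the image of any law
    under the zero map. *)
Lemma gaussian_law (X : {RV P >-> R}) (v : R) : 0 <= v -> gaussian 0 v X ->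
  same_law P X N01 (fun z : RR => Num.sqrt v * z : RR).
Proof.
move=> v0 gX C mC; rewrite [LHS](gX C mC); case: eqP => [->|/eqP vN0].
  rewrite sqrtr0 diracE; case: (boolP (0 \in C)) => C0.
    rewrite (_ : _ @^-1` _ = setT).
      by have := @probability_setT _ _ _ N01 => <-.
    by apply/seteqP; split=> z //= _; rewrite mul0r; move: C0; rewrite inE.
  rewrite (_ : _ @^-1` _ = set0) ?measure0//.
  by apply/seteqP; split=> z //=; rewrite mul0r; move: C0; rewrite notin_setE.
have sv : Num.sqrt v != 0 by rewrite gt_eqF// sqrtr_gt0 lt0r vN0.
by rewrite (normal_scale sv mC).
Qed.

Section moments.
Variables (X : T -> R) (s : R).
Hypothesis mX : measurable_fun setT X.
Hypothesis law : same_law P X N01 (fun z : RR => s * z : RR).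
Let ms : measurable_fun setT (fun z : RR => s * z : RR).
Proof. exact: measurable_funM. Qed.

Lemma normal_law_L1_norm3 : L1 P (fun w => `|X w| ^+ 3).
Proof.
have m3 : measurable_fun setT (fun x : RR => `|x| ^+ 3 : R).
  by apply: measurable_funX; exact: normr_measurable.
apply: (same_law_L1 mX ms law m3).
have -> : (fun z : RR => `|s * z| ^+ 3) = (fun z => `|s| ^+ 3 * `|z| ^+ 3).
  by apply/funext => z; rewrite normrM exprMn.
by apply: L1Z; exact: L1_normal_norm3.
Qed.

Lemma normal_law_mean : \int[P]_w X w = 0.
Proof.
rewrite (same_law_Exp mX ms law (@measurable_id _ RR setT)) RintegralZl//.
  by rewrite Exp_normal_id mulr0.
exact: L1_normal_id.
Qed.

Lemma normal_law_sqr : \int[P]_w (X w ^+ 2) = s ^+ 2.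
Proof.
have m2 : measurable_fun setT (fun x : RR => x ^+ 2 : RR) by exact: measurable_funX.
rewrite (same_law_Exp mX ms law m2).
under eq_Rintegral do rewrite exprMn.
rewrite RintegralZl//; first by rewrite Exp_normal_sqr mulr1.
exact: L1_normal_sqr.
Qed.

End moments.

Lemma le_1Dcube (a : R) : 0 <= a -> a <= 1 + a ^+ 3.
Proof.
move=> a0; have h : 0 <= (a - 1) ^+ 2 * (a + 1) by rewrite mulr_ge0 ?sqr_ge0//; lra.
nra.
Qed.

Lemma sqr_le_1Dcube (a : R) : 0 <= a -> a ^+ 2 <= 1 + a ^+ 3.
Proof.
move=> a0; have h : 0 <= (a - 1) ^+ 2 * (a + 1) by rewrite mulr_ge0 ?sqr_ge0//; lra.
lra.
Qed.

Lemma cube_normD (a b : R) : `|a + b| ^+ 3 <= 4 * (`|a| ^+ 3 + `|b| ^+ 3).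
Proof.
apply: (@le_trans _ _ ((`|a| + `|b|) ^+ 3)).
  by rewrite lerXn2r ?nnegrE// ?addr_ge0// ler_normD.
have := normr_ge0 a; have := normr_ge0 b; move: `|a| `|b| => x y y0 x0.
have h : 0 <= (x - y) ^+ 2 * (x + y) by rewrite mulr_ge0 ?sqr_ge0// addr_ge0.
lra.
Qed.

Lemma L1_norm3_mul (X Y : T -> R) : measurable_fun setT X -> measurable_fun setT Y ->
  L1 P (fun w => `|X w| ^+ 3) -> L1 P (fun w => `|Y w| ^+ 3) ->
  L1 P (fun w => X w * Y w).
Proof.
move=> mX mY lX lY.
apply: (@L1_le _ _ _ P _ (fun w => (1 + `|X w| ^+ 3) + (1 + `|Y w| ^+ 3))).
- exact: measurable_funM.
- by apply: L1D; apply: L1D => //; exact: L1_cst.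
- move=> w; rewrite normrM.
  have := sqr_le_1Dcube (normr_ge0 (X w)); have := sqr_le_1Dcube (normr_ge0 (Y w)).
  have := sqr_ge0 (`|X w| - `|Y w|).
  have := sqr_ge0 (`|X w|); have := sqr_ge0 (`|Y w|).
  by move: `|X w| `|Y w| => x y; nra.
Qed.

Lemma L1_norm3_id (X : T -> R) : measurable_fun setT X ->
  L1 P (fun w => `|X w| ^+ 3) -> L1 P X.
Proof.
move=> mX lX; apply: (@L1_le _ _ _ P _ (fun w => 1 + `|X w| ^+ 3)) => //.
  by apply: L1D => //; exact: L1_cst.
by move=> w; exact: le_1Dcube.
Qed.

(** What Lindeberg's exchange uses of a centred Gaussian vector with
    covariance [C]. *)
Definition gauss_vec n (N : 'I_n -> T -> R) (C : 'I_n -> 'I_n -> R) : Prop :=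
  [/\ forall l, measurable_fun setT (N l), stable P N,
      forall l, L1 P (fun w => `|N l w| ^+ 3),
      forall l, \int[P]_w N l w = 0 &
      forall l m, \int[P]_w (N l w * N m w) = C l m].

(** By induction on the number of independent normal variables that are
    combined. *)
Lemma gauss_vec_sum n (X : nat -> T -> R) (s : nat -> R) (A : 'I_n -> nat -> R) K :
  (forall j, (j < K)%N -> measurable_fun setT (X j)) ->
  (forall j, (j < K)%N -> same_law P (X j) N01 (fun z : RR => s j * z : RR)) ->
  (forall j, (j < K)%N -> indep2 P (fun w => [tuple X i w | i < j]) (X j)) ->
  gauss_vec (fun l w => \sum_(j < K) A l j * X j w)
            (fun l m => \sum_(j < K) A l j * A m j * s j ^+ 2).
Proof.
elim: K => [|K IH] mX law ind.
  have -> : (fun (l : 'I_n) w => \sum_(j < 0) A l j * X j w) = (fun _ _ => 0).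
    by apply/funext => l; apply/funext => w; rewrite big_ord0.
  split.
  - by move=> l; exact: measurable_cst.
  - move=> F bF a b a0 b0; under eq_Rintegral do rewrite Exp_cst.
    rewrite !Exp_cst; congr F; apply: eq_from_tnth => l.
    by rewrite !tnth_mktuple !mulr0 addr0.
  - by move=> l; exact: L1_cst.
  - by move=> l; rewrite Exp_cst.
  - by move=> l m; rewrite Exp_cst mulr0 big_ord0.
have [||| mN sN lN eN cN] := IH.
- by move=> j jK; apply: mX; exact: ltnW.
- by move=> j jK; apply: law; exact: ltnW.
- by move=> j jK; apply: ind; exact: ltnW.
set N := (fun l w => _) in mN sN lN eN cN.
have mK := mX K (ltnSn _); have lawK := law K (ltnSn _).
pose M (l : 'I_n) w := A l K * X K w.
have mM l : measurable_fun setT (M l) by exact: measurable_funM.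
have -> : (fun (l : 'I_n) w => \sum_(j < K.+1) A l j * X j w) = (fun l w => N l w + M l w).
  by apply/funext => l; apply/funext => w; rewrite big_ord_recr.
have lM l : L1 P (fun w => `|M l w| ^+ 3).
  have -> : (fun w => `|M l w| ^+ 3) = (fun w => `|A l K| ^+ 3 * `|X K w| ^+ 3).
    by apply/funext => w; rewrite /M normrM exprMn.
  by apply: L1Z; exact: normal_law_L1_norm3 lawK.
have L1X : L1 P (X K) by apply: L1_norm3_id => //; exact: normal_law_L1_norm3 lawK.
have eM l : \int[P]_w M l w = 0.
  by rewrite RintegralZl// (normal_law_mean mK lawK) mulr0.
have cM l m : \int[P]_w (M l w * M m w) = A l K * A m K * s K ^+ 2.
  under eq_Rintegral do rewrite /M mulrACA -expr2.
  rewrite RintegralZl//; first by rewrite (normal_law_sqr mK lawK).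
  by under [X in EFin \o X]eq_fun do rewrite expr2; apply: L1_norm3_mul => //;
    exact: normal_law_L1_norm3 lawK.
have NM : indep2 P (fun w => [tuple N l w | l < n]) (fun w => [tuple M l w | l < n]).
  have := @indep2_comp _ _ _ _ _ _ _ _ _ _ _ _ _ _
    (fun x : K.-tuple R => [tuple \sum_(j < K) A l j * tnth x j | l < n])
    (fun x : R => [tuple A l K * x | l < n]) _ _ (ind K (ltnSn _)).
  have -> : (fun x : K.-tuple R => [tuple \sum_(j < K) A l j * tnth x j | l < n]) \o
     (fun w => [tuple X i w | i < K]) = (fun w => [tuple N l w | l < n]).
    apply/funext => w; apply: eq_from_tnth => l /=; rewrite !tnth_mktuple.
    by apply: eq_bigr => j _; rewrite tnth_mktuple.
  apply.
    apply: measurable_mktuple => l; apply: measurable_sum => j.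
    by apply: measurable_funM => //; exact: measurable_tnth.
  by apply: measurable_mktuple => l; exact: measurable_funM.
have cross l m : \int[P]_w (N l w * M m w) = 0.
  have i : indep2 P (N l) (M m).
    have := @indep2_comp _ _ _ _ _ _ _ _ _ _ _ _ _ _ (fun x : n.-tuple R => tnth x l)
      (fun x : n.-tuple R => tnth x m) (measurable_tnth l) (measurable_tnth m) NM.
    have -> : (fun x : n.-tuple R => tnth x l) \o (fun w => [tuple N l w | l < n]) = N l.
      by apply/funext => w /=; rewrite tnth_mktuple.
    have -> // : (fun x : n.-tuple R => tnth x m) \o (fun w => [tuple M l w | l < n]) = M m.
      by apply/funext => w /=; rewrite tnth_mktuple.
  have [_ ->] := indep2_ExpM i (L1_norm3_id (mN l) (lN l)) (L1_norm3_id (mM m) (lM m)).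
  by rewrite eM mulr0.
split.
- by move=> l; apply: measurable_funD; [exact: mN|exact: mM].
- have sM : stable P M := @stable_line R d T P n (X K) (s K) (fun l => A l K) mK lawK.
  exact: stableD.
- move=> l; apply: (@L1_le _ _ _ P _ (fun w => 4 * (`|N l w| ^+ 3 + `|M l w| ^+ 3))).
  + apply: measurable_funX; apply: (measurableT_comp (normr_measurable (D := setT))).
    exact: (measurable_funD (mN l) (mM l)).
  + exact: (L1Z 4 (L1D (lN l) (lM l))).
  + by move=> w; rewrite ger0_norm ?exprn_ge0//; exact: cube_normD.
- move=> l; rewrite RintegralD//; first by rewrite eN eM addr0.
  + exact: (L1_norm3_id (mN l) (lN l)).
  + exact: (L1_norm3_id (mM l) (lM l)).
- move=> l m; rewrite big_ord_recr/= -(cN l m) -(cM l m).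
  transitivity (\int[P]_w ((N l w * N m w + M l w * M m w) + (N l w * M m w + N m w * M l w))).
    by apply: eq_Rintegral => w _; ring.
  have lNN := L1_norm3_mul (mN l) (mN m) (lN l) (lN m).
  have lMM := L1_norm3_mul (mM l) (mM m) (lM l) (lM m).
  have lNM := L1_norm3_mul (mN l) (mM m) (lN l) (lM m).
  have lMN := L1_norm3_mul (mN m) (mM l) (lN m) (lM l).
  rewrite RintegralD//; [|exact: L1D|exact: L1D].
  rewrite RintegralD// RintegralD//.
  by rewrite !cross !addr0.
Qed.

End gaussian_family.

(** * Smooth steps and Lindeberg's exchange *)

Section taylor.
Context {R : realType}.

Lemma derive_bound (f f' : R -> R) (C : R) :
  f 0 = 0 -> (forall s : R, is_derive s 1 f (f' s)) ->
  (forall s, 0 <= s <= 1 -> `|f' s| <= C) ->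
  forall s, 0 <= s <= 1 -> `|f s| <= C.
Proof.
move=> f0 df f'C s /andP[s0 s1].
have [|c] := @MVT_segment R f f' 0 s s0 (fun x _ => df x).
  apply: continuous_subspaceT => x.
  by apply: differentiable_continuous; apply/derivable1_diffP; case: (df x).
rewrite f0 !subr0 in_itv/= => /andP[c0 cs] ->.
rewrite normrM (ger0_norm s0).
have hc : 0 <= c <= 1 by rewrite c0 (le_trans cs).
by apply: le_trans _ (f'C c hc); rewrite ler_piMr.
Qed.

Lemma is_derive1D (f g : R -> R) (x a b : R) :
  is_derive x 1 f a -> is_derive x 1 g b -> is_derive x 1 (fun y => f y + g y) (a + b).
Proof. by move=> df dg; exact: is_deriveD. Qed.

Lemma is_derive1B (f g : R -> R) (x a b : R) :
  is_derive x 1 f a -> is_derive x 1 g b -> is_derive x 1 (fun y => f y - g y) (a - b).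
Proof. by move=> df dg; exact: is_deriveB. Qed.

Lemma is_derive1M (f g : R -> R) (x a b : R) :
  is_derive x 1 f a -> is_derive x 1 g b ->
  is_derive x 1 (fun y => f y * g y) (f x * b + g x * a).
Proof. by move=> df dg; exact: is_deriveM. Qed.

Lemma is_derive1_eq (f : R -> R) (x a b : R) :
  is_derive x 1 f a -> a = b -> is_derive x 1 f b.
Proof. by move=> df <-. Qed.

(** The bound on the third derivative is integrated three times; the factor
    1 / 6 is given away. *)
Lemma taylor2 (g g1 g2 g3 : R -> R) (C : R) :
  (forall s : R, is_derive s 1 g (g1 s)) -> (forall s : R, is_derive s 1 g1 (g2 s)) ->
  (forall s : R, is_derive s 1 g2 (g3 s)) ->
  (forall s, 0 <= s <= 1 -> `|g3 s| <= C) ->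
  `|g 1 - g 0 - g1 0 - g2 0 / 2| <= C.
Proof.
move=> dg dg1 dg2 g3C.
have dc (c x : R) : is_derive x 1 (fun=> c) 0 by exact: is_derive_cst.
have di (x : R) : is_derive x 1 (fun y : R => y) 1 by exact: is_derive_id.
have b2 := @derive_bound (fun s => g2 s - g2 0) g3 C (subrr _).
have {}b2 := b2 (fun s => is_derive1_eq (is_derive1B (dg2 s) (dc _ s)) (subr0 _)) g3C.
have b1 := @derive_bound (fun s => g1 s - g1 0 - s * g2 0) (fun s => g2 s - g2 0) C.
have {}b1 := b1 ltac:(by rewrite mul0r subr0 subrr) _ b2.
have {}b1 : forall s, 0 <= s <= 1 -> `|g1 s - g1 0 - s * g2 0| <= C.
  apply: b1 => s.
  apply: (is_derive1_eq (is_derive1B (is_derive1B (dg1 s) (dc (g1 0) s))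
    (is_derive1M (di s) (dc (g2 0) s)))).
  by rewrite mulr0 add0r mulr1 subr0.
have b0 := @derive_bound (fun s => g s - g 0 - s * g1 0 - s * s * (g2 0 / 2))
  (fun s => g1 s - g1 0 - s * g2 0) C.
have {}b0 := b0 ltac:(by rewrite !mul0r !subr0 subrr) _ b1.
have := b0 _ 1 ltac:(by rewrite ler01 lexx).
rewrite !mul1r; apply => s.
apply: (is_derive1_eq (is_derive1B (is_derive1B (is_derive1B (dg s) (dc (g 0) s))
  (is_derive1M (di s) (dc (g1 0) s)))
  (is_derive1M (is_derive1M (di s) (di s)) (dc (g2 0 / 2) s)))).
by field.
Qed.

Lemma is_derive1_expsum n (c k : 'I_n -> R) (x : R) :
  is_derive x 1 (fun s => \sum_(l < n) c l * expR (k l * s))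
                (\sum_(l < n) c l * k l * expR (k l * x)).
Proof.
have -> : (fun s => \sum_(l < n) c l * expR (k l * s)) =
    \sum_(l < n) (fun s => c l * expR (k l * s)).
  by apply/funext => s; rewrite fct_sumE.
apply: is_derive_sum => l.
have dk : is_derive x 1 (fun s => k l * s) (k l * 1 + x * 0).
  exact: is_derive1M.
have de : is_derive x 1 (fun s => expR (k l * s)) (expR (k l * x) * (k l * 1 + x * 0)).
  exact: (is_derive1_comp (f := expR) (is_derive_expR _) dk).
apply: (is_derive1_eq (is_derive1M (is_derive_cst (c l) x 1) de)).
by rewrite /=; ring.
Qed.

End taylor.

Section test_function.
Context {R : realType}.
Variables (n : nat) (beta a : R).
Hypothesis beta0 : 0 < beta.

(** A smooth version of the indicator of the event that all coordinates of
    [x] are below [a]: it is close to 1 if the coordinates are well below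
    [a], and close to 0 if one of them is well above, the transition having
    width of order [beta^-1]. *)
Definition soft_step (x : 'I_n -> R) : R :=
  (1 + \sum_(l < n) expR (beta * (x l - a)))^-1.

Lemma soft_step_bound x : 0 <= soft_step x <= 1.
Proof.
have h : 0 <= \sum_(l < n) expR (beta * (x l - a)).
  by apply: sumr_ge0 => l _; exact: expR_ge0.
rewrite /soft_step invr_ge0 addr_ge0//= invf_le1 ?lerDl//.
by rewrite (lt_le_trans ltr01)// lerDl.
Qed.

Lemma bmeas_soft_step d (T : measurableType d) (f : 'I_n -> T -> R) :
  (forall l, measurable_fun setT (f l)) -> bmeas (fun w => soft_step (f ^~ w)).
Proof.
move=> mf; split; last first.
  by exists 1 => w; have /andP[h0 h1] := soft_step_bound (f ^~ w); rewrite ger0_norm.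
have -> : (fun w => soft_step (f ^~ w)) =
    (fun w => expR (- ln (1 + \sum_(l < n) expR (beta * (f l w - a))))).
  apply/funext => w; rewrite expRN lnK// posrE ltr_pwDl//.
  by apply: sumr_ge0 => l _; exact: expR_ge0.
apply: measurableT_comp => //; apply: measurableT_comp => //.
apply: measurableT_comp; first exact: measurable_ln.
apply: measurable_funD => //; apply: measurable_sum => l.
apply: measurableT_comp => //; apply: measurable_funM => //.
exact: measurable_funB.
Qed.

Let W (y : 'I_n -> R) l := expR (beta * (y l - a)).
Let V (y : 'I_n -> R) := soft_step y.
Definition soft_step_d1 (y : 'I_n -> R) l := - (V y) ^+ 2 * beta * W y l.
Definition soft_step_d2 (y : 'I_n -> R) l m :=
  (V y) ^+ 3 * beta ^+ 2 * W y l * W y m - (V y) ^+ 2 / 2 * beta ^+ 2 * W y l * (l == m)%:R.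

(** Along the segment from [y] to [y + h] the soft step is the inverse of D,
    where D is one plus a sum of exponentials, so that each derivative of D
    is at most D times a power of the increment. The constant 13 is 6 + 6 +
    1, from the three terms of the third derivative of the inverse. *)
Lemma soft_step_expansion (y h : 'I_n -> R) :
  `|soft_step (fun l => y l + h l) - soft_step y
    - \sum_(l < n) soft_step_d1 y l * h l
    - \sum_(l < n) \sum_(m < n) soft_step_d2 y l m * (h l * h m)|
  <= 13 * beta ^+ 3 * \sum_(l < n) `|h l| ^+ 3.
Proof.
have [kappa kappa0 [hk kle]] : exists2 kappa : R, 0 <= kappa &
    (forall l, `|beta * h l| <= kappa) /\ kappa ^+ 3 <= beta ^+ 3 * \sum_(l < n) `|h l| ^+ 3.
  case: (n) h => [|m] h.
    by exists 0 => //; split; [case=> //|rewrite big_ord0 mulr0 expr0n].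
  have [i _ hi] := @arg_maxP _ _ _ ord0 xpredT (fun i => `|h i|) isT.
  exists (beta * `|h i|); first by rewrite mulr_ge0// ltW.
  split=> [l|]; first by rewrite normrM gtr0_norm// ler_pM2l//; exact: hi.
  rewrite exprMn ler_pM2l ?exprn_gt0//.
  rewrite (bigD1 i)//= lerDl; apply: sumr_ge0 => l _.
  by rewrite exprn_ge0.
pose c l := W y l; pose k l := beta * h l.
pose D s := 1 + \sum_(l < n) c l * expR (k l * s).
pose S1 s := \sum_(l < n) c l * k l * expR (k l * s).
pose S2 s := \sum_(l < n) c l * k l * k l * expR (k l * s).
pose S3 s := \sum_(l < n) c l * k l * k l * k l * expR (k l * s).
pose v s := (D s)^-1.
have c0 l : 0 <= c l by exact: expR_ge0.
have D1 s : 1 <= D s.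
  by rewrite /D lerDl; apply: sumr_ge0 => l _; rewrite mulr_ge0// expR_ge0.
have D0 s : 0 < D s by rewrite (lt_le_trans ltr01).
have v0 s : 0 <= v s by rewrite invr_ge0 ltW.
have v1 s : v s <= 1 by rewrite invf_le1.
have dc (r x : R) : is_derive x 1 (fun=> r) 0 by exact: is_derive_cst.
have dD (s : R) : is_derive s 1 D (S1 s).
  apply: (is_derive1_eq (is_derive1D (dc 1 s) (is_derive1_expsum c k s))).
  by rewrite add0r.
have dS1 (s : R) : is_derive s 1 S1 (S2 s) by exact: is_derive1_expsum.
have dS2 (s : R) : is_derive s 1 S2 (S3 s) by exact: is_derive1_expsum.
have dv (s : R) : is_derive s 1 v (- (v s * v s * S1 s)).
  have DN0 : D s != 0 by rewrite gt_eqF.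
  apply: (is_derive1_eq (is_deriveV DN0 (dD s))).
  by rewrite /GRing.scale/= /v -exprVn expr2 mulNr.
pose g1 s := 0 - v s * v s * S1 s.
pose g2 s := 2 * (v s * v s * v s * (S1 s * S1 s)) - v s * v s * S2 s.
pose g3 s := - 6 * (v s * v s * v s * v s * (S1 s * S1 s * S1 s))
  + 6 * (v s * v s * v s * (S1 s * S2 s)) - v s * v s * S3 s.
have dg (s : R) : is_derive s 1 v (g1 s).
  by apply: (is_derive1_eq (dv s)); rewrite /g1 sub0r.
have dg1 (s : R) : is_derive s 1 g1 (g2 s).
  apply: (is_derive1_eq (is_derive1B (dc 0 s)
    (is_derive1M (is_derive1M (dv s) (dv s)) (dS1 s)))).
  by rewrite /g2; ring.
have dg2 (s : R) : is_derive s 1 g2 (g3 s).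
  apply: (is_derive1_eq (is_derive1B
    (is_derive1M (dc 2 s) (is_derive1M (is_derive1M (is_derive1M (dv s) (dv s)) (dv s))
                                       (is_derive1M (dS1 s) (dS1 s))))
    (is_derive1M (is_derive1M (dv s) (dv s)) (dS2 s)))).
  by rewrite /g3; ring.
have bS (p : 'I_n -> R) (K : R) s : 0 <= K -> (forall l, `|p l| <= K) ->
    `|v s * \sum_(l < n) c l * p l * expR (k l * s)| <= K.
  move=> K0 pK; rewrite normrM (ger0_norm (v0 s)) mulrC ler_pdivrMr//.
  apply: le_trans (ler_norm_sum _ _ _) _.
  apply: (@le_trans _ _ (K * \sum_(l < n) c l * expR (k l * s))); last first.
    by rewrite ler_wpM2l// /D lerDr.
  rewrite mulr_sumr; apply: ler_sum => l _.
  rewrite !normrM (ger0_norm (c0 l)) (ger0_norm (expR_ge0 _)).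
  by rewrite mulrA ler_wpM2r ?expR_ge0// mulrC ler_wpM2r.
have {}hk l : `|k l| <= kappa := hk l.
have b1 s : `|v s * S1 s| <= kappa by exact: bS.
have b2 s : `|v s * S2 s| <= kappa ^+ 2.
  rewrite /S2; under eq_bigr do rewrite -(mulrA (c _)).
  apply: (bS (fun l => k l * k l)) => [|l]; first by rewrite exprn_ge0.
  by rewrite normrM expr2; apply: ler_pM.
have b3 s : `|v s * S3 s| <= kappa ^+ 3.
  rewrite /S3; under eq_bigr do rewrite -2!(mulrA (c _)).
  apply: (bS (fun l => k l * k l * k l)) => [|l]; first by rewrite exprn_ge0.
  move: (k l) (hk l) => x hx.
  have h2 : `|x| * `|x| <= kappa * kappa by apply: ler_pM.
  rewrite !normrM exprSr expr2.
  exact: (ler_pM (mulr_ge0 (normr_ge0 _) (normr_ge0 _)) (normr_ge0 _) h2 hx).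
have b g3s : `|g3 g3s| <= 13 * kappa ^+ 3.
  set s := g3s.
  have -> : g3 s = v s * (- (6 * (v s * S1 s) ^+ 3) + 6 * ((v s * S1 s) * (v s * S2 s)) - v s * S3 s).
    by rewrite /g3; ring.
  rewrite normrM (ger0_norm (v0 s)).
  apply: (@le_trans _ _ (1 * (6 * kappa ^+ 3 + 6 * kappa ^+ 3 + kappa ^+ 3))); last first.
    by rewrite mul1r; lra.
  apply: ler_pM => //.
  apply: le_trans (ler_normB _ _) _; apply: lerD; last exact: b3.
  apply: le_trans (ler_normD _ _) _; apply: lerD.
    rewrite normrN normrM ger0_norm// ler_wpM2l// normrX.
    by rewrite lerXn2r ?nnegrE.
  rewrite normrM ger0_norm// ler_wpM2l// normrM exprS.
  by apply: ler_pM.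
have := taylor2 dg dg1 dg2 (fun s _ => b s).
have -> : v 1 = soft_step (fun l => y l + h l).
  rewrite /v /D /soft_step; congr (_ + _)^-1; apply: eq_bigr => l _.
  by rewrite /c /W -expRD /k; congr expR; ring.
have D0E : D 0 = 1 + \sum_(l < n) W y l.
  by rewrite /D; congr (_ + _); apply: eq_bigr => l _; rewrite mulr0 expR0 mulr1.
have -> : v 0 = soft_step y by rewrite /v D0E.
have VE : v 0 = V y by rewrite /v D0E.
have S1E : S1 0 = \sum_(l < n) W y l * k l.
  by apply: eq_bigr => l _; rewrite mulr0 expR0 mulr1.
have -> : g1 0 = \sum_(l < n) soft_step_d1 y l * h l.
  rewrite /g1 VE S1E sub0r mulr_sumr -sumrN; apply: eq_bigr => l _.
  by rewrite /soft_step_d1 /k; ring.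
have -> : g2 0 / 2 = \sum_(l < n) \sum_(m < n) soft_step_d2 y l m * (h l * h m).
  rewrite /g2 VE.
  have -> : S2 0 = \sum_(l < n) W y l * k l * k l.
    by apply: eq_bigr => l _; rewrite mulr0 expR0 mulr1.
  transitivity (\sum_(l < n) (V y ^+ 3 * (W y l * k l) * S1 0 - V y ^+ 2 / 2 * (W y l * k l * k l))).
    by rewrite sumrB -mulr_suml -!mulr_sumr -S1E; field.
  apply: eq_bigr => l _; rewrite S1E mulr_sumr.
  transitivity (\sum_(m < n) (V y ^+ 3 * (W y l * k l) * (W y m * k m)
      - V y ^+ 2 / 2 * beta ^+ 2 * W y l * (l == m)%:R * (h l * h m))).
    rewrite sumrB; congr (_ - _).
    rewrite (bigD1 l)//= eqxx big1 ?addr0; first by rewrite /k /=; field.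
    by move=> m; rewrite eq_sym => /negbTE ->; rewrite mulr0 mul0r.
  by apply: eq_bigr => m _; rewrite /soft_step_d2 /k; ring.
move=> h1; apply: le_trans h1 _; rewrite -[leRHS]mulrA ler_wpM2l//.
Qed.

End test_function.

Section one_step.
Context {R : realType} d (T : measurableType d) (P : probability T R).
Variables (n : nat) (Y : 'I_n -> T -> R) (C : 'I_n -> 'I_n -> R).
Hypotheses (mY : forall l, measurable_fun setT (Y l))
  (Y3 : forall l, L1 P (fun w => `|Y l w| ^+ 3))
  (Y1 : forall l, \int[P]_w Y l w = 0)
  (Y2 : forall l m, \int[P]_w (Y l w * Y m w) = C l m).

(** The first order term vanishes because [Y] is centred, and the second
    order term depends on the covariance only: two vectors with the same
    covariance have the same expansion up to order [t ^+ 3]. *)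
Lemma one_step_expansion (beta a t : R) (y : 'I_n -> R) : 0 < beta -> 0 <= t ->
  `|\int[P]_w soft_step beta a (fun l => y l + t * Y l w)
    - (soft_step beta a y + t ^+ 2 * \sum_(l < n) \sum_(m < n) soft_step_d2 beta a y l m * C l m)|
  <= 13 * beta ^+ 3 * t ^+ 3 * \sum_(l < n) \int[P]_w `|Y l w| ^+ 3.
Proof.
move=> beta0 t0.
pose F w := soft_step beta a (fun l => y l + t * Y l w).
pose D1 w := \sum_(l < n) soft_step_d1 beta a y l * t * Y l w.
pose D2 w := \sum_(l < n) \sum_(m < n) soft_step_d2 beta a y l m * t ^+ 2 * (Y l w * Y m w).
pose psi w := F w - (soft_step beta a y + D1 w + D2 w).
have lY l : L1 P (Y l) by exact: L1_norm3_id.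
have lYY l m : L1 P (fun w => Y l w * Y m w) by exact: L1_norm3_mul.
have lF : L1 P F.
  apply: bmeas_integrable; apply: (@bmeas_soft_step R n beta a _ T (fun l w => y l + t * Y l w)) => l.
  by apply: measurable_funD => //; exact: measurable_funM.
have lD1 : L1 P D1 by apply: L1_sum => l; exact: L1Z.
have lD2 : L1 P D2 by apply: L1_sum => l; apply: L1_sum => m; exact: L1Z.
have lc : L1 P (fun _ => soft_step beta a y) by exact: L1_cst.
have lcD1 := L1D lc lD1.
have lcD := L1D lcD1 lD2.
have eD1 : \int[P]_w D1 w = 0.
  rewrite Exp_sum; last by move=> l; exact: L1Z.
  by rewrite big1// => l _; rewrite RintegralZl// Y1 mulr0.
have eD2 : \int[P]_w D2 w = t ^+ 2 * \sum_(l < n) \sum_(m < n) soft_step_d2 beta a y l m * C l m.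
  rewrite Exp_sum; last by move=> l; apply: L1_sum => m; exact: L1Z.
  rewrite mulr_sumr; apply: eq_bigr => l _.
  rewrite Exp_sum; last by move=> m; exact: L1Z.
  rewrite mulr_sumr; apply: eq_bigr => m _.
  by rewrite RintegralZl// Y2; ring.
have epsi : \int[P]_w psi w = \int[P]_w F w - (soft_step beta a y
    + t ^+ 2 * \sum_(l < n) \sum_(m < n) soft_step_d2 beta a y l m * C l m).
  rewrite RintegralB//; congr (_ - _).
  by rewrite RintegralD// RintegralD// Exp_cst eD1 addr0 eD2.
rewrite -epsi.
have lpsi : L1 P psi by exact: L1B.
have lY3 : L1 P (fun w => \sum_(l < n) `|Y l w| ^+ 3) by exact: L1_sum.
apply: le_trans (le_normr_Rintegral _ lpsi) _ => //.
rewrite -Exp_sum// -RintegralZl//.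
apply: le_Rintegral => //.
- exact: L1_norm.
- exact: L1Z.
- move=> w _.
  have := soft_step_expansion a beta0 y (fun l => t * Y l w).
  have -> : \sum_(l < n) soft_step_d1 beta a y l * (t * Y l w) = D1 w.
    by apply: eq_bigr => l _; rewrite mulrA.
  have -> : \sum_(l < n) \sum_(m < n) soft_step_d2 beta a y l m * (t * Y l w * (t * Y m w)) = D2 w.
    by apply: eq_bigr => l _; apply: eq_bigr => m _; ring.
  have -> : \sum_(l < n) `|t * Y l w| ^+ 3 = t ^+ 3 * \sum_(l < n) `|Y l w| ^+ 3.
    by rewrite mulr_sumr; apply: eq_bigr => l _; rewrite normrM (ger0_norm t0) exprMn.
  by rewrite !mulrA /psi /F opprD !addrA opprD !addrA.
Qed.

End one_step.

Section clt_soft_step.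
Context {R : realType} d (T : measurableType d) (P : probability T R).
Context dE (E : measurableType dE) (X : nat -> {RV P >-> E}).
Hypothesis X_indep : mutually_independent X.

Definition past k (w : T) : k.-tuple E := [tuple X i w | i < k].

Lemma measurable_past k : measurable_fun setT (past k).
Proof.
apply/measurable_fun_tnthP => i; rewrite (_ : _ \o _ = X i)//.
by apply/funext => w /=; rewrite tnth_mktuple.
Qed.

Lemma indep2_past k : indep2 P (past k) (X k).
Proof.
apply: (mutually_independent_tuple (iota := fun i : 'I_k => i : nat)) => //.
  exact: ord_inj.
by move=> i; rewrite ltn_eqF.
Qed.

Lemma sum_past (u : E -> R) k w : \sum_(i < k) u (X i w) = \sum_(i < k) u (tnth (past k w) i).
Proof. by apply: eq_bigr => i _; rewrite tnth_mktuple. Qed.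

Lemma measurable_tuple_sum (u : E -> R) k : measurable_fun setT u ->
  measurable_fun setT (fun x : k.-tuple E => \sum_(i < k) u (tnth x i)).
Proof.
move=> mu; apply: measurable_sum => i.
by apply: measurableT_comp => //; exact: measurable_tnth.
Qed.

Lemma bmeas_RV (u : E -> R) k : bmeas u -> bmeas (fun w => u (X k w)).
Proof. by move=> bu; apply: (bmeas_comp bu); exact: measurable_funP. Qed.

(** The cross terms vanish, since each summand is centred and independent of
    the past. *)
Lemma sum_second_moment (u : E -> R) (v : R) : bmeas u ->
  (forall k, \int[P]_w u (X k w) = 0) -> (forall k, \int[P]_w u (X k w) ^+ 2 = v) ->
  forall k, \int[P]_w (\sum_(i < k) u (X i w)) ^+ 2 = k%:R * v.
Proof.
move=> bu u1 u2; have bS k : bmeas (fun w => \sum_(i < k) u (X i w)).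
  by apply: bmeas_sum => i _; exact: bmeas_RV.
elim=> [|k IH].
  by under eq_Rintegral do rewrite big_ord0 expr0n/=; rewrite Exp_cst mul0r.
have SU : indep2 P (fun w => \sum_(i < k) u (X i w)) (fun w => u (X k w)).
  have := indep2_comp (@measurable_tuple_sum u k bu.1) bu.1 (@indep2_past k).
  have -> // : (fun x : k.-tuple E => \sum_(i < k) u (tnth x i)) \o past k =
      (fun w => \sum_(i < k) u (X i w)).
  by apply/funext => w; rewrite sum_past.
have lS := bmeas_integrable P (bS k); have lu := bmeas_integrable P (@bmeas_RV u k bu).
have [lSu ESu] := indep2_ExpM SU lS lu.
transitivity (\int[P]_w ((\sum_(i < k) u (X i w)) ^+ 2
    + (u (X k w) ^+ 2 + 2 * (\sum_(i < k) u (X i w) * u (X k w))))).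
  by apply: eq_Rintegral => w _; rewrite big_ord_recr/= -mulr_suml; ring.
have lS2 : L1 P (fun w => (\sum_(i < k) u (X i w)) ^+ 2).
  apply: bmeas_integrable; under eq_fun do rewrite expr2.
  exact: bmeasM.
have lu2 : L1 P (fun w => u (X k w) ^+ 2).
  apply: bmeas_integrable; under eq_fun do rewrite expr2.
  by apply: bmeasM; exact: bmeas_RV.
have lSu' : L1 P (fun w => 2 * (\sum_(i < k) u (X i w) * u (X k w))).
  by apply: L1Z; under [X in EFin \o X]eq_fun do rewrite -mulr_suml.
rewrite RintegralD//; last exact: L1D.
rewrite RintegralD// IH u2 RintegralZl//; last first.
  by under [X in EFin \o X]eq_fun do rewrite -mulr_suml.
under [X in _ + (_ + 2 * X)]eq_Rintegral do rewrite -mulr_suml.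
by rewrite ESu u1 mulr0 mulr0 addr0 -natr1 mulrDl mul1r.
Qed.

Variables (n : nat) (U : 'I_n -> E -> R) (C : 'I_n -> 'I_n -> R) (M0 : R).
Hypotheses (mU : forall l, measurable_fun setT (U l))
  (UM : forall l x, `|U l x| <= M0)
  (U1 : forall k l, \int[P]_w U l (X k w) = 0)
  (U2 : forall k l m, \int[P]_w (U l (X k w) * U m (X k w)) = C l m).
Context d' (T' : measurableType d') (P' : probability T' R).
Variable (N : 'I_n -> T' -> R).
Hypothesis gN : gauss_vec P' N C.

(** Lindeberg's exchange. Between the normalized sum and the Gaussian vector
    one interpolates by a sum of [k] terms plus the Gaussian vector scaled
    by the square root of [(m - k) / m]. By stability the latter splits off
    a Gaussian increment of the size of one summand, and replacing it by the
    summand costs [m^-1] to the power 3/2. *)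
Lemma clt_soft_step (beta a : R) : 0 < beta -> exists2 K : R, 0 <= K &
  forall m, (0 < m)%N ->
  `|\int[P]_w soft_step beta a (fun l => (\sum_(i < m) U l (X i w)) / Num.sqrt m%:R)
    - \int[P']_w soft_step beta a (N ^~ w)| <= K / Num.sqrt m%:R.
Proof.
move=> beta0; have [mN sN lN N1 N2] := gN.
pose F (x : 'I_n -> R) := soft_step beta a x.
have bF d1 (T1 : measurableType d1) (f : 'I_n -> T1 -> R) :
    (forall l, measurable_fun setT (f l)) -> bmeas (fun w => F (f ^~ w)).
  exact: bmeas_soft_step.
have mUX l k : measurable_fun setT (fun w => U l (X k w)).
  by apply: measurableT_comp => //; exact: measurable_funP.
have bU l : bmeas (U l) by split=> //; exists M0.
have M00 (l : 'I_n) (w : T) : 0 <= M0 by exact: le_trans (UM l (X 0%N w)).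
pose KU := n%:R * `|M0| ^+ 3; pose KN := \sum_(l < n) \int[P']_w `|N l w| ^+ 3.
have KU0 : 0 <= KU by rewrite mulr_ge0// exprn_ge0.
have KN0 : 0 <= KN by apply: sumr_ge0 => l _; apply: Rintegral_ge0 => w _; exact: exprn_ge0.
pose kappa := 13 * beta ^+ 3 * (KU + KN).
have beta3 : 0 <= 13 * beta ^+ 3 by apply: mulr_ge0 => //; apply: exprn_ge0; exact: ltW.
have kappa0 : 0 <= kappa by apply: mulr_ge0 => //; exact: addr_ge0.
exists kappa => // m m0.
have sm0 : 0 < Num.sqrt (m%:R : R) by rewrite sqrtr_gt0 ltr0n.
pose t := (Num.sqrt (m%:R : R))^-1.
have t0 : 0 <= t by rewrite invr_ge0 ltW.
pose S l k w := \sum_(i < k) U l (X i w).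
have mS l k : measurable_fun setT (S l k) by exact: measurable_sum.
pose r k := Num.sqrt (m - k)%:R * t.
have r0 k : 0 <= r k by rewrite mulr_ge0.
have rS k : (k < m)%N -> Num.sqrt (r k.+1 ^+ 2 + t ^+ 2) = r k.
  move=> km; rewrite -[RHS](ger0_norm (r0 k)) -sqrtr_sqr; congr (Num.sqrt _).
  rewrite /r !exprMn !sqr_sqrtr ?ler0n// -[in RHS](subnSK km) -natr1.
  by rewrite mulrDl mul1r.
pose aa k := \int[P]_w \int[P']_w'' F (fun l => t * S l k w + r k * N l w'').
(* [A] contains a summand, and [B] a Gaussian increment of the same covariance *)
have step k : (k < m)%N -> `|aa k.+1 - aa k| <= kappa * t ^+ 3.
  move=> km.
  have [r' r'E] : exists r', r' = r k.+1 by eexists.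
  pose A w w'' := \int[P]_w' F (fun l => (t * S l k w + r' * N l w'') + t * U l (X k w')).
  pose B w w'' := \int[P']_v F (fun l => (t * S l k w + r' * N l w'') + t * N l v).
  have bA : bmeas (fun z : T * T' => A z.1 z.2).
    apply: (@bmeas_Exp _ _ _ _ _ P (fun (z : T * T') w' =>
      F (fun l => (t * S l k z.1 + r' * N l z.2) + t * U l (X k w')))).
    apply: (bF _ _ (fun l z => (t * S l k z.1.1 + r' * N l z.1.2) + t * U l (X k z.2))) => l.
    apply: measurable_funD; first apply: measurable_funD.
    - apply: measurable_funM; first exact: measurable_cst.
      apply: (measurableT_comp (mS l k)); exact: measurableT_comp.
    - apply: measurable_funM; first exact: measurable_cst.
      apply: (measurableT_comp (mN l)); exact: measurableT_comp.
    - apply: measurable_funM; first exact: measurable_cst.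
      exact: (measurableT_comp (mUX l k)).
  have bB : bmeas (fun z : T * T' => B z.1 z.2).
    apply: (@bmeas_Exp _ _ _ _ _ P' (fun (z : T * T') v =>
      F (fun l => (t * S l k z.1 + r' * N l z.2) + t * N l v))).
    apply: (bF _ _ (fun l z => (t * S l k z.1.1 + r' * N l z.1.2) + t * N l z.2)) => l.
    apply: measurable_funD; first apply: measurable_funD.
    - apply: measurable_funM; first exact: measurable_cst.
      apply: (measurableT_comp (mS l k)); exact: measurableT_comp.
    - apply: measurable_funM; first exact: measurable_cst.
      apply: (measurableT_comp (mN l)); exact: measurableT_comp.
    - apply: measurable_funM; first exact: measurable_cst.
      exact: (measurableT_comp (mN l)).
  have e1 : aa k.+1 = \int[P]_w \int[P']_w'' A w w''.
    pose g (x : k.-tuple E) (e : E) w'' :=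
      F (fun l => t * (\sum_(i < k) U l (tnth x i)) + r' * N l w'' + t * U l e).
    have bg : bmeas (fun z : (k.-tuple E * E) * T' => g z.1.1 z.1.2 z.2).
      apply: (bF _ _ (fun l (z : (k.-tuple E * E) * T') =>
        t * (\sum_(i < k) U l (tnth z.1.1 i)) + r' * N l z.2 + t * U l z.1.2)) => l.
      apply: measurable_funD; first apply: measurable_funD.
      - apply: measurable_funM; first exact: measurable_cst.
        apply: (measurableT_comp (@measurable_tuple_sum (U l) k (mU l))).
        exact: measurableT_comp.
      - apply: measurable_funM; first exact: measurable_cst.
        exact: (measurableT_comp (mN l)).
      - apply: measurable_funM; first exact: measurable_cst.
        apply: (measurableT_comp (mU l)); exact: measurableT_comp.
    pose f x e := \int[P']_w'' g x e w''.
    have bf : bmeas (fun z : k.-tuple E * E => f z.1 z.2).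
      exact: (@bmeas_Exp _ _ _ _ _ P' (fun (z : k.-tuple E * E) w'' => g z.1 z.2 w'') bg).
    have gE w w' w'' : g (past k w) (X k w') w'' =
        F (fun l => (t * S l k w + r' * N l w'') + t * U l (X k w')).
      congr F; apply/funext => l; rewrite /S; congr (_ * _ + _ + _).
      by apply: eq_bigr => i _; rewrite tnth_mktuple.
    transitivity (\int[P]_w f (past k w) (X k w)).
      apply: eq_Rintegral => w _; apply: eq_Rintegral => w'' _; rewrite gE.
      congr F; apply/funext => l; rewrite /S big_ord_recr/= -r'E; ring.
    transitivity (\int[P]_w \int[P]_w' f (past k w) (X k w')).
      exact: (indep2_Exp (@measurable_past k) (measurable_funP (X k)) (@indep2_past k) bf).
    apply: eq_Rintegral => w _.
    have bgw : bmeas (fun z : T * T' => g (past k w) (X k z.1) z.2).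
      apply: (bmeas_comp (g := fun z : T * T' => ((past k w, X k z.1), z.2)) bg).
      apply: measurable_fun_pair; last exact: measurable_snd.
      apply: measurable_fun_pair; first exact: measurable_cst.
      by apply: measurableT_comp; [exact: measurable_funP|exact: measurable_fst].
    transitivity (\int[P']_w'' \int[P]_w' g (past k w) (X k w') w'').
      exact: (Exp_swap P P' (f := fun w' w'' => g (past k w) (X k w') w'') bgw).
    apply: eq_Rintegral => w'' _; apply: eq_Rintegral => w' _; exact: gE.
  have e2 : aa k = \int[P]_w \int[P']_w'' B w w''.
    apply: eq_Rintegral => w _.
    pose F' (x : n.-tuple R) := F (fun l => t * S l k w + tnth x l).
    have bF' : bmeas F'.
      apply: (bF _ _ (fun l (x : n.-tuple R) => t * S l k w + tnth x l)) => l.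
      apply: measurable_funD; [exact: measurable_cst|exact: measurable_tnth].
    have := sN F' bF' r' t; rewrite r'E => /(_ (r0 _) t0); rewrite rS// => h.
    transitivity (\int[P']_w'' F' [tuple r k * N l w'' | l < n]).
      apply: eq_Rintegral => w'' _; congr F; apply/funext => l.
      by rewrite tnth_mktuple.
    rewrite -h; apply: eq_Rintegral => w'' _; apply: eq_Rintegral => v _.
    by congr F; apply/funext => l; rewrite tnth_mktuple r'E addrA.
  have UM3 l v : `| `|U l (X k v)| ^+ 3| <= `|M0| ^+ 3.
    rewrite normrX normr_id; apply: lerXn2r; [exact: normr_ge0|exact: normr_ge0|].
    exact: le_trans (UM l _) (ler_norm _).
  have AB w w'' : `|A w w'' - B w w''| <= kappa * t ^+ 3.
    pose y := fun l => t * S l k w + r' * N l w''.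
    have lU3 l : L1 P (fun w => `|U l (X k w)| ^+ 3).
      apply: bmeas_integrable; split; last first.
        by exists (`|M0| ^+ 3) => v; exact: UM3.
      apply: measurable_funX; apply: (measurableT_comp (normr_measurable (D := setT))).
      exact: mUX.
    have hA := one_step_expansion (fun l => mUX l k) lU3 (U1 k) (U2 k) a y beta0 t0.
    have hB := one_step_expansion mN lN N1 N2 a y beta0 t0.
    have hU : \sum_(l < n) \int[P]_w `|U l (X k w)| ^+ 3 <= KU.
      have -> : KU = \sum_(l < n) `|M0| ^+ 3 by rewrite sumr_const card_ord -mulr_natl.
      apply: ler_sum => l _; apply: le_trans (ler_norm _) _.
      apply: Exp_norm_le; first exact: L1_measurable (lU3 l).
      by move=> v; exact: UM3.
    have k0 : 0 <= 13 * beta ^+ 3 * t ^+ 3.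
      by apply: mulr_ge0 => //; exact: exprn_ge0.
    have hA' := le_trans hA (ler_wpM2l k0 hU).
    have -> : kappa * t ^+ 3 = 13 * beta ^+ 3 * t ^+ 3 * KU + 13 * beta ^+ 3 * t ^+ 3 * KN.
      by rewrite /kappa; ring.
    move: hA' hB; rewrite -/(A w w'') -/(B w w'') -/KN.
    set cc := soft_step beta a y + _; move: cc (A w w'') (B w w'') => cc A' B' hA' hB.
    have -> : A' - B' = (A' - cc) - (B' - cc) by ring.
    by apply: le_trans (ler_normB _ _) _; exact: lerD.
  have bAB := bmeasB bA bB.
  have lA := bmeas_integrable P (@bmeas_Exp _ _ _ _ _ P' _ bA).
  have lB := bmeas_integrable P (@bmeas_Exp _ _ _ _ _ P' _ bB).
  rewrite e1 e2 -(RintegralB measurableT lA lB).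
  have -> : \int[P]_w (\int[P']_w'' A w w'' - \int[P']_w'' B w w'') =
      \int[P]_w \int[P']_w'' (A w w'' - B w w'').
    apply: eq_Rintegral => w _; apply/esym.
    exact: (RintegralB measurableT (bmeas_integrable P' (bmeas_pair bA w))
                                   (bmeas_integrable P' (bmeas_pair bB w))).
  apply: Exp_norm_le.
    exact: (@bmeas_Exp _ _ _ _ _ P' (fun w w'' => A w w'' - B w w'') bAB).1.
  move=> w; apply: Exp_norm_le; last exact: AB.
  exact: (bmeas_pair (f := fun w w'' => A w w'' - B w w'') bAB w).1.
have tele k : (k <= m)%N -> `|aa k - aa 0%N| <= k%:R * (kappa * t ^+ 3).
  elim: k => [|k IH] km; first by rewrite subrr normr0 mul0r.
  rewrite -natr1 mulrDl mul1r.
  have {}IH := IH (ltnW km); move: (step k km) IH.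
  move: (aa k.+1) (aa k) (aa 0%N) => x y z h1 h2.
  have -> : x - z = (y - z) + (x - y) by ring.
  by apply: le_trans (ler_normD _ _) _; exact: lerD.
have a0E : aa 0%N = \int[P']_w F (N ^~ w).
  rewrite /aa; transitivity (\int[P]_w \int[P']_w'' F (N ^~ w'')); last by rewrite Exp_cst.
  apply: eq_Rintegral => w _; apply: eq_Rintegral => w'' _.
  congr F; apply/funext => l; rewrite /S big_ord0 mulr0 add0r /r subn0 divff ?mul1r//.
  by rewrite gt_eqF.
have amE : aa m = \int[P]_w F (fun l => S l m w / Num.sqrt m%:R).
  apply: eq_Rintegral => w _; rewrite -[RHS](Exp_cst P'); apply: eq_Rintegral => w'' _.
  congr F; apply/funext => l; rewrite /r subnn sqrtr0 !mul0r addr0 mulrC//.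
have := tele m (leqnn m); rewrite a0E amE => h; apply: le_trans h _.
suff -> : m%:R * (kappa * t ^+ 3) = kappa * t by [].
have mt : m%:R * t ^+ 2 = 1.
  by rewrite /t exprVn sqr_sqrtr ?ler0n// divff// pnatr_eq0 -lt0n.
transitivity ((m%:R * t ^+ 2) * (kappa * t)); first by ring.
by rewrite mt mul1r.
Qed.

End clt_soft_step.

(** * Functions of the maximum of three numbers *)

Section max3_theory.
Context {R : realType}.
Implicit Types x y : 'I_3 -> R.

Lemma max3_ge x l : x l <= max3 x.
Proof. by rewrite /max3 (bigD1 l)//= le_max lexx. Qed.

Lemma max3_attained x : exists l, max3 x = x l.
Proof.
rewrite /max3 !big_ord_recl big_ord0.
have h (a b : R) : Num.max a b = a \/ Num.max a b = b.
  by rewrite maxEle; case: ifP; [right|left].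
set c2 := Num.max (x (lift ord0 (lift ord0 ord0))) _.
set c1 := Num.max (x (lift ord0 ord0)) c2.
have [->|->] := h (x ord0) c1; first by exists ord0.
rewrite /c1; have [->|->] := h (x (lift ord0 ord0)) c2; first by exists (lift ord0 ord0).
rewrite /c2; have [->|->] := h (x (lift ord0 (lift ord0 ord0))) (x ord0).
  by exists (lift ord0 (lift ord0 ord0)).
by exists ord0.
Qed.

Lemma max3_leP x (r : R) : reflect (forall l, x l <= r) (max3 x <= r).
Proof.
apply: (iffP idP) => [h l|h]; first exact: le_trans (max3_ge x l) h.
by have [l ->] := max3_attained x.
Qed.

Lemma measurable_max3 d (T : measurableType d) (f : 'I_3 -> T -> R) :
  (forall l, measurable_fun setT (f l)) ->
  measurable_fun setT (fun w => max3 (f ^~ w)).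
Proof.
move=> mf; rewrite /max3; under eq_fun do rewrite !big_ord_recl big_ord0.
by do 3 apply: measurable_maxr => //.
Qed.

Lemma max3D x (r : R) : max3 (fun l => x l + r) = max3 x + r.
Proof.
apply/eqP; rewrite eq_le; apply/andP; split.
  by apply/max3_leP => l; rewrite lerD2r max3_ge.
have [l ->] := max3_attained x.
exact: (max3_ge (fun l => x l + r)).
Qed.

Lemma max3Z x (r : R) : 0 <= r -> max3 (fun l => r * x l) = r * max3 x.
Proof.
move=> r0; apply/eqP; rewrite eq_le; apply/andP; split.
  by apply/max3_leP => l; rewrite ler_wpM2l ?max3_ge.
have [l ->] := max3_attained x.
exact: (max3_ge (fun l => r * x l)).
Qed.

Lemma max3_norm_le x : `|max3 x| <= \sum_(l < 3) `|x l|.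
Proof.
have [l ->] := max3_attained x; rewrite (bigD1 l)//= lerDl.
by apply: sumr_ge0.
Qed.

Lemma max3_sqr_le x : max3 x ^+ 2 <= \sum_(l < 3) x l ^+ 2.
Proof.
have [l ->] := max3_attained x; rewrite (bigD1 l)//= lerDl.
by apply: sumr_ge0 => i _; exact: sqr_ge0.
Qed.

Lemma soft_step_low (beta a h : R) x : 0 < beta -> max3 x <= a - h ->
  1 - soft_step beta a x <= 3 * expR (- (beta * h)).
Proof.
move=> beta0 xa; rewrite /soft_step; set S := \sum_(l < 3) _.
have S0 : 0 <= S by apply: sumr_ge0 => l _; exact: expR_ge0.
have S3 : S <= 3 * expR (- (beta * h)).
  have -> : 3 * expR (- (beta * h)) = \sum_(l < 3) expR (- (beta * h)).
    by rewrite sumr_const card_ord mulr_natl.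
  apply: ler_sum => l _; rewrite ler_expR -mulrN ler_pM2l//.
  have := max3_ge x l; lra.
apply: le_trans S3.
have D0 : 0 < 1 + S by lra.
have -> : 1 - (1 + S)^-1 = S / (1 + S) by field; rewrite gt_eqF.
by rewrite ler_pdivrMr// ler_peMr//; lra.
Qed.

Lemma soft_step_high (beta a h : R) x : 0 < beta -> a + h <= max3 x ->
  soft_step beta a x <= 3 * expR (- (beta * h)).
Proof.
move=> beta0 xa; rewrite /soft_step; set S := \sum_(l < 3) _.
have Sh : expR (beta * h) <= S.
  have [l lE] := max3_attained x; rewrite /S (bigD1 l)//=.
  apply: (@le_trans _ _ (expR (beta * (x l - a)))); last first.
    by rewrite lerDl; apply: sumr_ge0 => i _; exact: expR_ge0.
  by rewrite ler_expR ler_pM2l// -lE; lra.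
have e0 := expR_gt0 (beta * h).
rewrite expRN; apply: (@le_trans _ _ (expR (beta * h))^-1).
  by rewrite lef_pV2 ?posrE//; lra.
rewrite ler_peMl// ?invr_ge0 ?ltW//; lra.
Qed.

End max3_theory.

Section clamp.
Context {R : realType}.

Definition clamp (K y : R) : R := Num.max (- K) (Num.min K y).

Lemma clamp_itv K y : 0 <= K -> - K <= clamp K y <= K.
Proof.
move=> K0; rewrite /clamp le_max lexx/= ge_max ge_min lexx/= andbT; lra.
Qed.

Lemma clamp_id K y : - K <= y <= K -> clamp K y = y.
Proof. by move=> /andP[h1 h2]; rewrite /clamp (min_idPr h2) (max_idPr h1). Qed.

Lemma clamp_dist K y z : `|clamp K y - clamp K z| <= `|y - z|.
Proof.
rewrite /clamp !maxEle !minEle.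
by repeat case: ifPn; rewrite -?ltNge => *; rewrite !ler_norml; apply/andP; split;
  case: (lerP 0 (y - z)) => hyz; rewrite ?(ger0_norm hyz) ?(ltr0_norm hyz); lra.
Qed.

Lemma measurable_clamp K : measurable_fun setT (clamp K).
Proof.
apply: measurable_maxr; first exact: measurable_cst.
by apply: measurable_minr; [exact: measurable_cst|exact: measurable_id].
Qed.

Lemma uniform_continuity (f : R -> R) (K e : R) : continuous f -> 0 < e ->
  exists2 delta : R, 0 < delta & forall u v, - K <= u <= K ->
    `|u - v| <= delta -> `|f u - f v| <= e.
Proof.
move=> cf e0.
have cK : compact `[- K, K]%classic by exact: segment_compact.
move/compact_near_coveringP : cK => /(_ R (at_right (0 : R))
  (fun delta u => forall v, `|u - v| <= delta -> `|f u - f v| <= e)) h.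
have {}h : \forall delta \near (0:R)^'+, `[- K, K]%classic `<=`
    [set u | forall v, `|u - v| <= delta -> `|f u - f v| <= e].
  apply: h => x _.
  have e2 : 0 < e / 2 by lra.
  have /cvgrPdist_le /(_ _ e2) := cf x.
  move=> /nbhs_ballP[eta /= eta0 hx].
  exists (ball x (eta / 2), [set delta | delta < eta / 2]) => /=.
    split; first by apply: nbhsx_ballx; rewrite /=; lra.
    by apply: nbhs_right_lt; lra.
  move=> [x' delta] /= [xx' de] v x'v.
  have h1 := hx x' ltac:(by move: xx'; rewrite /ball/=; lra).
  have h2 := hx v _.
  have {}h2 : `|f x - f v| <= e / 2.
    apply: h2; rewrite /ball/=.
    have -> : x - v = (x - x') + (x' - v) by ring.
    apply: le_lt_trans (ler_normD _ _) _; move: xx'; rewrite /ball/=; lra.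
  have -> : f x' - f v = (f x - f v) - (f x - f x') by ring.
  apply: le_trans (ler_normB _ _) _; lra.
have [delta [d0 hd]] := filter_ex (filterI (nbhs_right_gt (0 : R)) h).
by exists delta => // u v uK; apply: hd; rewrite /= in_itv.
Qed.

Lemma continuous_bounded_itv (f : R -> R) (K : R) : continuous f -> 0 <= K ->
  exists2 M : R, 0 <= M & forall u, - K <= u <= K -> `|f u| <= M.
Proof.
move=> cf K0.
have [|c _ hc] := @EVT_max R (fun u => `|f u|) (- K) K ltac:(lra).
  apply: continuous_subspaceT => x.
  by apply: (continuous_comp (cf x)); exact: norm_continuous.
by exists `|f c| => // u uK; apply: hc; rewrite in_itv.
Qed.

(** On a fine mesh of the interval, the function is replaced by a staircase,
    and each jump of the staircase by a soft step. Only the step at the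
    current value of the maximum lies in its transition zone, and its height
    is small by uniform continuity. *)
Lemma step_approximation (f : R -> R) (K e : R) : continuous f -> 0 < K -> 0 < e ->
  exists (N : nat) (c0 : R) (cs bs : nat -> R) (beta : R), 0 < beta /\
  forall x : 'I_3 -> R,
    `|f (clamp K (max3 x)) - (c0 + \sum_(i < N) cs i * (1 - soft_step beta (bs i) x))| <= e.
Proof.
move=> cf K0 e0; have e4 : 0 < e / 4 by lra.
have [delta d0 ud] := uniform_continuity K cf e4.
have [M M0 fM] := continuous_bounded_itv cf (ltW K0).
(* a mesh finer than the modulus of continuity *)
pose N := (Num.truncn (2 * K / delta)).+1.
pose h := 2 * K / N%:R.
have N0 : 0 < N%:R :> R by rewrite ltr0n.
have h0 : 0 < h by rewrite divr_gt0// mulr_gt0.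
have hd : h <= delta.
  rewrite ler_pdivrMr// [delta * _]mulrC -ler_pdivrMr//; apply: ltW.
  exact: truncnS_gt.
have NK : N%:R * h = 2 * K by rewrite /h mulrC divfK// gt_eqF.
pose a i : R := - K + i%:R * h; pose b i : R := a i + h / 2.
have aS i : a i.+1 = a i + h by rewrite /a -natr1 mulrDl mul1r addrA.
have aN : a N = K by rewrite /a NK; lra.
have a_mono i j : (i <= j)%N -> a i <= a j.
  by move=> ij; rewrite lerD2l ler_pM2r// ler_nat.
have aK i : (i <= N)%N -> - K <= a i <= K.
  move=> iN; rewrite -[X in _ <= _ <= X]aN a_mono// andbT.
  by rewrite /a lerDl mulr_ge0// ltW.
(* beta so large that the steps away from the current value are negligible *)
pose q := e / 4 / (6 * M * N%:R + 1).
have q0 : 0 < q.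
  by rewrite divr_gt0// ltr_wpDl// !mulr_ge0// ltW.
pose beta := q^-1 / (h / 2).
have beta0 : 0 < beta by rewrite divr_gt0 ?invr_gt0// divr_gt0.
have small : expR (- (beta * (h / 2))) <= q.
  rewrite /beta divfK; last by rewrite gt_eqF// divr_gt0.
  rewrite expRN invf_ple ?posrE ?expR_gt0 ?invr_gt0//.
  by apply: le_trans (expR_ge1Dx _); rewrite lerDr.
exists N, (f (- K)), (fun i => f (a i.+1) - f (a i)), b, beta; split => // x.
set y := max3 x; set z := clamp K y.
have /andP[zK1 zK2] := clamp_itv y (ltW K0); rewrite -/z in zK1 zK2.
have [j jN [zj1 [zj2 [yj1 yj2]]]] : exists2 j, (j < N)%N & a j <= z /\ z <= a j.+1 /\
    (forall i, (i < j)%N -> b i + h / 2 <= y) /\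
    (forall i, (j < i)%N -> (i < N)%N -> y <= b i - h / 2).
  have zN : z <= a N by rewrite aN.
  have exj : exists j, z <= a j.+1 by exists N.-1.
  case: (ex_minnP exj) => j zj jmin.
  have jN : (j < N)%N.
    by rewrite /N ltnS; exact: (jmin N.-1 zN).
  have azj : a j <= z.
    case: j zj jmin jN => [|j] zj jmin jN; first by rewrite /a mul0r addr0.
    by rewrite leNgt; apply/negP => /ltW zaj; have := jmin _ zaj; rewrite ltnn.
  exists j => //; split=> //; split=> //; split=> [i ij|i ji iN].
    have : a i.+1 <= z by apply: le_trans azj; exact: a_mono.
    rewrite aS /b => h1; have zKN : - K < z.
      apply: lt_le_trans h1; have /andP[] := aK i (ltnW (ltn_trans ij jN)); lra.
    have : z <= y.
      by move: zKN; rewrite /z /clamp lt_max ltxx/= => h2; rewrite (max_idPr (ltW h2)) ge_min lexx orbT.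
    lra.
  have : z <= a i by apply: le_trans zj _; exact: a_mono.
  rewrite /b => h1; have zKN : z < K.
    apply: le_lt_trans h1 _; rewrite -aN /a ltrD2l ltr_pM2r// ltr_nat//.
  have : y <= z.
    rewrite /z /clamp le_max; apply/orP; right.
    move: zKN; rewrite /z /clamp gt_max => /andP[_]; rewrite gt_min ltxx/= => h2.
    by rewrite (min_idPr (ltW h2)).
  lra.
have tele : \sum_(i < N) (f (a i.+1) - f (a i)) * (i < j)%:R = f (a j) - f (- K).
  have tele' k : \sum_(i < k) (f (a i.+1) - f (a i)) * (i < j)%:R = f (a (minn k j)) - f (- K).
    elim: k => [|k IH]; first by rewrite big_ord0 min0n /a mul0r addr0 subrr.
    rewrite big_ord_recr/= IH; case: (boolP (k < j)%N) => [kj|]; last rewrite -leqNgt => kj.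
      by rewrite mulr1 (minn_idPl (ltnW kj)) (minn_idPl kj); ring.
    by rewrite mulr0 addr0 (minn_idPr kj) (minn_idPr (leqW kj)).
  by rewrite tele' (minn_idPr (ltnW jN)).
have osc i : (i < N)%N -> `|f (a i.+1) - f (a i)| <= e / 4.
  move=> iN; apply: ud; first exact: aK.
  by rewrite aS addrC addKr gtr0_norm.
have term (i : 'I_N) : `|(f (a i.+1) - f (a i)) * ((i < j)%:R - (1 - soft_step beta (b i) x))|
    <= 6 * M * q + (i == Ordinal jN)%:R * (e / 4).
  have /andP[s0 s1] := soft_step_bound beta (b i) x.
  have fi : `|f (a i.+1) - f (a i)| <= 2 * M.
    apply: le_trans (ler_normB _ _) _.
    have := fM _ (aK i.+1 (ltn_ord i)); have := fM _ (aK i (ltnW (ltn_ord i))); lra.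
  have off r : 0 <= r -> r <= 3 * q -> `|f (a i.+1) - f (a i)| * r <= 6 * M * q.
    move=> r0 rq; apply: (@le_trans _ _ (2 * M * (3 * q))); first exact: ler_pM.
    lra.
  have Mq : 0 <= 6 * M * q by apply: mulr_ge0; [exact: mulr_ge0|exact: ltW].
  rewrite normrM; case: ltngtP => ij.
  - have -> : (i == Ordinal jN) = false by apply/eqP => /(congr1 val)/= /eqP; rewrite ltn_eqF.
    rewrite mul0r addr0; apply: off; rewrite ?normr_ge0//.
    have h1 := soft_step_high beta0 (yj1 i ij).
    rewrite opprB addrCA subrr addr0 ger0_norm//; lra.
  - have -> : (i == Ordinal jN) = false by apply/eqP => /(congr1 val)/= /eqP; rewrite gtn_eqF.
    rewrite mul0r addr0; apply: off; rewrite ?normr_ge0//.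
    have h1 := soft_step_low beta0 (yj2 i ij (ltn_ord i)).
    by rewrite sub0r normrN ger0_norm; lra.
  - have -> : (i == Ordinal jN) by apply/eqP/val_inj.
    rewrite mul1r ler_wpDl// sub0r normrN -[leRHS]mulr1.
    apply: ler_pM => //; first exact: osc.
    by rewrite ger0_norm; lra.
have -> : f z - (f (- K) + \sum_(i < N) (f (a i.+1) - f (a i)) * (1 - soft_step beta (b i) x)) =
    (f z - f (a j)) + \sum_(i < N) (f (a i.+1) - f (a i)) * ((i < j)%:R - (1 - soft_step beta (b i) x)).
  under [in RHS]eq_bigr do rewrite mulrBr.
  by rewrite sumrB tele; ring.
apply: le_trans (ler_normD _ _) _.
have hz : `|f z - f (a j)| <= e / 4.
  by apply: ud; [rewrite zK1|rewrite ger0_norm; move: zj2; rewrite aS; lra].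
have : `|\sum_(i < N) (f (a i.+1) - f (a i)) * ((i < j)%:R - (1 - soft_step beta (b i) x))| <= e / 2.
  apply: le_trans (ler_norm_sum _ _ _) _; apply: le_trans (ler_sum _ (fun i _ => term i)) _.
  rewrite big_split/= sumr_const card_ord -mulr_suml.
  rewrite (bigD1 (Ordinal jN))//= eqxx big1 ?addr0 ?mul1r => [|i /negbTE ->//].
  suff : 6 * M * q *+ N <= e / 4 by lra.
  have qD : q * (6 * M * N%:R + 1) = e / 4.
    by rewrite /q divfK// gt_eqF// ltr_wpDl// !mulr_ge0// ltW.
  rewrite -mulr_natr; clear -qD q0; lra.
lra.
Qed.

End clamp.
Section bounded_extrema.
Context {R : realType} d (T : measurableType d).

Lemma bmeas_max3 (f : 'I_3 -> T -> R) : (forall l, bmeas (f l)) ->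
  bmeas (fun w => max3 (f ^~ w)).
Proof.
move=> bf; split; first by apply: measurable_max3 => l; exact: (bf l).1.
have bS : bmeas (fun w => \sum_(l < 3) `|f l w|).
  apply: bmeas_sum => l _; have [mf [M hM]] := bf l; split; first exact: measurableT_comp.
  by exists M => w; rewrite normr_id.
have [_ [M hM]] := bS; exists M => w.
by apply: le_trans (max3_norm_le _) _; apply: le_trans (ler_norm _) (hM w).
Qed.

Lemma bmeas_bigmin (I : Type) (s : seq I) (Q : pred I) (f0 : T -> R) (f : I -> T -> R) :
  bmeas f0 -> (forall i, Q i -> bmeas (f i)) ->
  bmeas (fun w => \big[Num.min/f0 w]_(i <- s | Q i) f i w).
Proof.
move=> b0 bf; elim: s => [|i s IH]; first by under eq_fun do rewrite big_nil.
have -> : (fun w => \big[Num.min/f0 w]_(j <- i :: s | Q j) f j w) = (fun w =>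
    if Q i then Num.min (f i w) (\big[Num.min/f0 w]_(j <- s | Q j) f j w)
    else \big[Num.min/f0 w]_(j <- s | Q j) f j w).
  by apply/funext => w; rewrite big_cons.
case Qi: (Q i) => //.
have [mi [M hM]] := bf i Qi; have [ms [N hN]] := IH.
split; first exact: measurable_minr.
exists (Num.max M N) => w; rewrite minEle; case: ifP => _.
  by apply: le_trans (hM w) _; rewrite le_max lexx.
by apply: le_trans (hN w) _; rewrite le_max lexx orbT.
Qed.

End bounded_extrema.

(** * Convergence of truncated variables *)

Section convergence.
Context {R : realType} d (T : measurableType d) (P : probability T R).
Context d' (T' : measurableType d') (P' : probability T' R).

Lemma cvg_approx (u : nat -> R) (l : R) :
  (forall e, 0 < e -> exists (v : nat -> R) (m : R), v n @[n --> \oo] --> m /\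
     (\forall n \near \oo, `|u n - v n| <= e) /\ `|l - m| <= e) ->
  u n @[n --> \oo] --> l.
Proof.
move=> h; apply/cvgrPdist_le => e e0.
have e3 : 0 < e / 3 by lra.
have [v [m [vm [uv lm]]]] := h _ e3.
move/cvgrPdist_le : vm => /(_ _ e3) vm.
near=> n.
have h1 : `|u n - v n| <= e / 3 by near: n.
have h2 : `|m - v n| <= e / 3 by near: n.
have -> : l - u n = (l - m) + (m - v n) - (u n - v n) by ring.
apply: le_trans (ler_normB _ _) _.
have := ler_normD (l - m) (m - v n); lra.
Unshelve. all: by end_near.
Qed.

(** Convergence in distribution, tested on functions of truncated variables;
    such functions are constant near both infinities, hence uniformly
    continuous. Mass could still escape to infinity. *)
Definition clamp_cvg (Y : nat -> T -> R) (Z : T' -> R) : Prop :=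
  forall f : R -> R, continuous f -> forall K : R, 0 < K ->
  \int[P]_w f (clamp K (Y n w)) @[n --> \oo] --> \int[P']_w f (clamp K (Z w)).

Lemma bmeas_clamp d0 (T0 : measurableType d0) (f : R -> R) (K : R) (y : T0 -> R) :
  continuous f -> 0 < K -> measurable_fun setT y ->
  bmeas (fun w => f (clamp K (y w))).
Proof.
move=> cf K0 my; split.
  apply: measurableT_comp; first exact: continuous_measurable_fun.
  by apply: measurableT_comp => //; exact: measurable_clamp.
have [M _ fM] := continuous_bounded_itv cf (ltW K0).
by exists M => w; apply: fM; exact: clamp_itv (ltW K0).
Qed.

(** By [step_approximation], functions of the truncated maximum are uniform
    limits of combinations of soft steps. *)
Lemma soft_step_clamp_cvg (W : nat -> 'I_3 -> T -> R) (N : 'I_3 -> T' -> R) :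
  (forall n l, measurable_fun setT (W n l)) -> (forall l, measurable_fun setT (N l)) ->
  (forall beta a : R, 0 < beta ->
    \int[P]_w soft_step beta a (W n ^~ w) @[n --> \oo] -->
    \int[P']_w soft_step beta a (N ^~ w)) ->
  clamp_cvg (fun n w => max3 (W n ^~ w)) (fun w => max3 (N ^~ w)).
Proof.
move=> mW mN WN f cf K K0; apply: cvg_approx => e e0.
have [m [c0 [cs [bs [beta [beta0 fg]]]]]] := step_approximation cf K0 e0.
pose g (x : 'I_3 -> R) := c0 + \sum_(i < m) cs i * (1 - soft_step beta (bs i) x).
have bS d0 (T0 : measurableType d0) (V : 'I_3 -> T0 -> R) i :
    (forall l, measurable_fun setT (V l)) ->
    bmeas (fun w => cs i * (1 - soft_step beta (bs i) (V ^~ w))).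
  move=> mV; apply: bmeasM; first exact: bmeas_cst.
  by apply: bmeasB; [exact: bmeas_cst|exact: bmeas_soft_step].
have bg d0 (T0 : measurableType d0) (V : 'I_3 -> T0 -> R) :
    (forall l, measurable_fun setT (V l)) -> bmeas (fun w => g (V ^~ w)).
  move=> mV; apply: bmeasD; first exact: bmeas_cst.
  by apply: bmeas_sum => i _; exact: bS.
have gE d0 (T0 : measurableType d0) (Q : probability T0 R) (V : 'I_3 -> T0 -> R) :
    (forall l, measurable_fun setT (V l)) ->
    \int[Q]_w g (V ^~ w) =
    c0 + \sum_(i < m) cs i * (1 - \int[Q]_w soft_step beta (bs i) (V ^~ w)).
  move=> mV; rewrite RintegralD//; last 2 first.
  - exact: L1_cst.
  - by apply: L1_sum => i; apply: bmeas_integrable; exact: bS.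
  rewrite Exp_cst Exp_sum; last by move=> i; apply: bmeas_integrable; exact: bS.
  congr (_ + _); apply: eq_bigr => i _.
  have ls : L1 Q (fun w => soft_step beta (bs i) (V ^~ w)).
    exact/bmeas_integrable/bmeas_soft_step.
  have l1 : L1 Q (fun w : T0 => 1) by exact: L1_cst.
  rewrite RintegralZl//; last exact: L1B.
  by rewrite RintegralB// Exp_cst.
exists (fun n => \int[P]_w g (W n ^~ w)), (\int[P']_w g (N ^~ w)); split.
  rewrite gE//; under eq_fun do rewrite gE//.
  apply: cvgD; first exact: cvg_cst.
  have sumc k : (\sum_(i < k) cs i * (1 - \int[P]_w soft_step beta (bs i) (W n ^~ w))) @[n --> \oo]
      --> \sum_(i < k) cs i * (1 - \int[P']_w soft_step beta (bs i) (N ^~ w)).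
    elim: k => [|k IH].
      by rewrite big_ord0; under eq_fun do rewrite big_ord0; exact: cvg_cst.
    rewrite big_ord_recr/=; under eq_fun do rewrite big_ord_recr/=.
    apply: cvgD => //; apply: cvgM; first exact: cvg_cst.
    by apply: cvgB; [exact: cvg_cst|exact: WN].
  exact: sumc.
have dist d0 (T0 : measurableType d0) (Q : probability T0 R) (V : 'I_3 -> T0 -> R) :
    (forall l, measurable_fun setT (V l)) ->
    `|\int[Q]_w f (clamp K (max3 (V ^~ w))) - \int[Q]_w g (V ^~ w)| <= e.
  move=> mV.
  have bf : bmeas (fun w => f (clamp K (max3 (V ^~ w)))).
    by apply: bmeas_clamp => //; exact: measurable_max3.
  rewrite -RintegralB//; [|exact: bmeas_integrable|exact/bmeas_integrable/bg].
  by apply: Exp_norm_le => [|w]; [exact: (bmeasB bf (bg _ _ _ mV)).1|exact: fg].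
split; last exact: dist.
by near=> n; exact: dist.
Unshelve. all: by end_near.
Qed.

(** The test functions are uniformly continuous, and by the Markov
    inequality the perturbation is small with high probability. *)
Lemma clamp_cvg_perturb (Y Y' : nat -> T -> R) (Z : T' -> R) :
  (forall n, measurable_fun setT (Y n)) -> (forall n, measurable_fun setT (Y' n)) ->
  (forall n, L1 P (fun w => `|Y' n w - Y n w|)) ->
  \int[P]_w `|Y' n w - Y n w| @[n --> \oo] --> 0 ->
  clamp_cvg Y Z -> clamp_cvg Y' Z.
Proof.
move=> mY mY' lYY YY YZ f cf K K0; apply: cvg_approx => e e0.
have e2 : 0 < e / 2 by lra.
have [delta d0 fd] := uniform_continuity K cf e2.
have [M M0 fM] := continuous_bounded_itv cf (ltW K0).
exists (fun n => \int[P]_w f (clamp K (Y n w))), (\int[P']_w f (clamp K (Z w))).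
split; first exact: YZ.
split; last by rewrite subrr normr0 ltW.
pose q := e / 2 / (2 * M / delta + 1).
have D0 : 0 < 2 * M / delta + 1.
  by rewrite ltr_wpDl// divr_ge0 ?mulr_ge0// ltW.
have q0 : 0 < q by rewrite divr_gt0.
move/cvgrPdist_le : YY => /(_ _ q0) YY.
near=> n.
have hn : \int[P]_w `|Y' n w - Y n w| <= q.
  have : `|0 - \int[P]_w `|Y' n w - Y n w| | <= q by near: n.
  by rewrite sub0r normrN => h; apply: le_trans (ler_norm _) h.
have b1 : bmeas (fun w => f (clamp K (Y' n w))) by exact: bmeas_clamp.
have b2 : bmeas (fun w => f (clamp K (Y n w))) by exact: bmeas_clamp.
have b12 := bmeasB b1 b2.
have l12 := bmeas_integrable P b12.
rewrite -RintegralB//; [|exact: bmeas_integrable|exact: bmeas_integrable].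
apply: le_trans (le_normr_Rintegral _ l12) _ => //.
apply: (@le_trans _ _ (\int[P]_w (e / 2 + 2 * M / delta * `|Y' n w - Y n w|))).
  apply: le_Rintegral => //.
  - exact: L1_norm.
  - by apply: L1D; [exact: L1_cst|exact: L1Z].
  - move=> w _.
    have c1 := clamp_itv (Y' n w) (ltW K0); have c2 := clamp_itv (Y n w) (ltW K0).
    have cd := clamp_dist K (Y' n w) (Y n w).
    have [small|big] := lerP `|Y' n w - Y n w| delta.
      rewrite ler_wpDr//; first by rewrite mulr_ge0// divr_ge0 ?mulr_ge0// ltW.
      by apply: fd => //; exact: le_trans cd small.
    apply: ler_wpDl; first exact: ltW.
    apply: (@le_trans _ _ (2 * M)).
      apply: le_trans (ler_normB _ _) _.
      have := fM _ c1; have := fM _ c2; lra.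
    by rewrite -mulrA ler_peMr ?mulr_ge0// mulrC ler_pdivlMr// mul1r ltW.
rewrite RintegralD//; [|exact: L1_cst|exact: L1Z].
rewrite Exp_cst RintegralZl//.
have h : 2 * M / delta * \int[P]_w `|Y' n w - Y n w| <= e / 2.
  apply: (@le_trans _ _ (2 * M / delta * q)).
    by rewrite ler_wpM2l// divr_ge0 ?mulr_ge0// ltW.
  have qD : q * (2 * M / delta + 1) = e / 2 by rewrite /q divfK// gt_eqF.
  by rewrite -qD mulrDr mulr1 [leRHS]addrC mulrC ler_wpDl// ltW.
lra.
Unshelve. all: by end_near.
Qed.

Section tight.
Variables (Y : nat -> T -> R) (Z : T' -> R) (V : R).
Hypotheses (mY : forall n, measurable_fun setT (Y n)) (mZ : measurable_fun setT Z).
Hypotheses (Y2 : forall n, L1 P (fun w => Y n w ^+ 2))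
  (Z2 : L1 P' (fun w => Z w ^+ 2)).
Hypotheses (YV : forall n, (0 < n)%N -> \int[P]_w (Y n w ^+ 2) <= V)
  (ZV : \int[P']_w (Z w ^+ 2) <= V).
Hypothesis YZ : clamp_cvg Y Z.

(** Bounded second moments prevent the escape of mass: the probability that
    truncation at [K] acts is of order [K ^- 2]. *)
Lemma clamp_cvg_bounded (f : R -> R) : continuous f ->
  (exists M, forall x, `|f x| <= M) ->
  \int[P]_w f (Y n w) @[n --> \oo] --> \int[P']_w f (Z w).
Proof.
move=> cf [M' fM']; have [M M0 fM] : exists2 M, 0 <= M & forall x, `|f x| <= M.
  by exists `|M'| => // x; exact: le_trans (fM' x) (ler_norm _).
have V0 : 0 <= V.
  by apply: le_trans ZV; apply: Rintegral_ge0 => w _; exact: sqr_ge0.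
apply: cvg_approx => e e0.
pose K2 := 2 * M * V / e + 1.
have K20 : 0 < K2 by rewrite ltr_wpDl// divr_ge0 ?mulr_ge0// ltW.
pose K := Num.sqrt K2; have K0 : 0 < K by rewrite sqrtr_gt0.
have KK : K ^+ 2 = K2 by rewrite sqr_sqrtr// ltW.
exists (fun n => \int[P]_w f (clamp K (Y n w))), (\int[P']_w f (clamp K (Z w))).
split; first exact: YZ.
have key d0 (T0 : measurableType d0) (Q : probability T0 R) (y : T0 -> R) :
    measurable_fun setT y -> L1 Q (fun w => y w ^+ 2) -> \int[Q]_w (y w ^+ 2) <= V ->
    `|\int[Q]_w f (y w) - \int[Q]_w f (clamp K (y w))| <= e.
  move=> my ly yV.
  have b1 : bmeas (fun w => f (y w)).
    by split; [apply: measurableT_comp => //; exact: continuous_measurable_fun|exists M].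
  have b2 : bmeas (fun w => f (clamp K (y w))) by exact: bmeas_clamp.
  have l12 := bmeas_integrable Q (bmeasB b1 b2).
  rewrite -RintegralB//; [|exact: bmeas_integrable|exact: bmeas_integrable].
  apply: le_trans (le_normr_Rintegral _ l12) _ => //.
  apply: (@le_trans _ _ (\int[Q]_w (2 * M / K2 * y w ^+ 2))).
    apply: le_Rintegral => //; [exact: L1_norm|exact: L1Z|].
    move=> w _; have [/andP[h1 h2]|] := boolP (- K <= y w <= K).
      rewrite clamp_id ?h1// subrr normr0 mulr_ge0 ?sqr_ge0// divr_ge0 ?mulr_ge0// ltW//.
    move=> nK; have yK : K2 <= y w ^+ 2.
      rewrite -KK -[y w ^+ 2]real_normK ?num_real//.
      apply: lerXn2r; [by rewrite nnegrE ltW|by rewrite nnegrE|].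
      by apply: ltW; move: nK; rewrite -ler_norml -ltNge.
    apply: (@le_trans _ _ (2 * M)).
      apply: le_trans (ler_normB _ _) _.
      have := fM (y w); have := fM (clamp K (y w)); lra.
    by rewrite -mulrA ler_peMr ?mulr_ge0// mulrC ler_pdivlMr// mul1r.
  rewrite RintegralZl//; apply: (@le_trans _ _ (2 * M / K2 * V)).
    by rewrite ler_wpM2l// divr_ge0 ?mulr_ge0// ltW.
  have eK : e * K2 = 2 * M * V + e by rewrite /K2; field; rewrite gt_eqF.
  by rewrite mulrAC ler_pdivrMr// eK lerDl ltW.
split; last exact: key.
by near=> n; apply: key => //; apply: YV; near: n; exact: nbhs_infty_gt.
Unshelve. all: by end_near.
Qed.

(** Bounded second moments give uniform integrability: truncation at [K]
    changes the expectation by at most [V / K]. *)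
Lemma clamp_cvg_mean : \int[P]_w Y n w @[n --> \oo] --> \int[P']_w Z w.
Proof.
have V0 : 0 <= V.
  by apply: le_trans ZV; apply: Rintegral_ge0 => w _; exact: sqr_ge0.
apply: cvg_approx => e e0.
pose K := V / e + 1; have K0 : 0 < K by rewrite ltr_wpDl// divr_ge0// ltW.
exists (fun n => \int[P]_w id (clamp K (Y n w))), (\int[P']_w id (clamp K (Z w))).
have cid : continuous (id : R -> R) by move=> x; exact: cvg_id.
split; first exact: (YZ cid K0).
have key d0 (T0 : measurableType d0) (Q : probability T0 R) (y : T0 -> R) :
    measurable_fun setT y -> L1 Q (fun w => y w ^+ 2) -> \int[Q]_w (y w ^+ 2) <= V ->
    `|\int[Q]_w y w - \int[Q]_w (clamp K (y w))| <= e.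
  move=> my ly yV.
  have l1 : L1 Q y.
    apply: (@L1_le _ _ _ Q _ (fun w => 1 + y w ^+ 2)) => //.
      by apply: L1D => //; exact: L1_cst.
    by move=> w; rewrite -[y w ^+ 2]real_normK ?num_real//; nra.
  have l2 : L1 Q (fun w => clamp K (y w)).
    by apply: bmeas_integrable; exact: (bmeas_clamp cid).
  have l12 := L1B l1 l2.
  rewrite -RintegralB//.
  apply: le_trans (le_normr_Rintegral _ l12) _ => //.
  apply: (@le_trans _ _ (\int[Q]_w (K^-1 * y w ^+ 2))).
    apply: le_Rintegral => //; [exact: L1_norm|exact: L1Z|].
    move=> w _; have [/andP[h1 h2]|] := boolP (- K <= y w <= K).
      by rewrite clamp_id ?h1// subrr normr0 mulr_ge0 ?sqr_ge0// invr_ge0 ltW.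
    move=> nK; have yK : K <= `|y w|.
      by move: nK; rewrite -ler_norml -ltNge => /ltW.
    have -> : K^-1 * y w ^+ 2 = `|y w| * (`|y w| / K).
      by rewrite -[y w ^+ 2]real_normK ?num_real//; ring.
    apply: (@le_trans _ _ `|y w|); last first.
      by rewrite ler_peMr// ler_pdivlMr// mul1r.
    have := clamp_itv (y w) (ltW K0); rewrite /clamp maxEle minEle.
    by case: ifPn; case: ifPn; rewrite -?ltNge => *; case: (lerP 0 (y w)) => hy;
      rewrite ?(ger0_norm hy) ?(ltr0_norm hy) ler_norml; lra.
  rewrite RintegralZl//; apply: (@le_trans _ _ (K^-1 * V)).
    by rewrite ler_wpM2l// invr_ge0 ltW.
  have eK : e * K = V + e by rewrite /K; field; rewrite gt_eqF.
  by rewrite mulrC ler_pdivrMr// eK lerDl ltW.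
split; last exact: key.
by near=> n; apply: key => //; apply: YV; near: n; exact: nbhs_infty_gt.
Unshelve. all: by end_near.
Qed.

End tight.

Lemma cvg_in_distributionP (Y : nat -> T -> R) (Z : T' -> R) :
  (forall n, measurable_fun setT (Y n)) -> measurable_fun setT Z ->
  (forall f : R -> R, continuous f -> (exists M, forall x, `|f x| <= M) ->
    \int[P]_w f (Y n w) @[n --> \oo] --> \int[P']_w f (Z w)) ->
  cvg_in_distribution P Y P' Z.
Proof.
move=> mY mZ h f cf bf.
have EfE d0 (T0 : measurableType d0) (Q : probability T0 R) (y : T0 -> R) :
    measurable_fun setT y -> ('E_Q[f \o y] = (\int[Q]_w f (y w))%:E)%E.
  move=> my; rewrite unlock -Exp_EFin//; apply: bmeas_integrable; split.
    by apply: measurableT_comp => //; exact: continuous_measurable_fun.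
  by have [M fM] := bf; exists M => x; exact: fM.
rewrite EfE//; under eq_fun do rewrite EfE//.
by apply: cvg_EFin; [exact: nearW|exact: h].
Qed.

End convergence.

(** * The central limit theorem for a maximum of three sums *)

Section clt_max.
Context {R : realType} d (T : measurableType d) (P : probability T R).
Context dE (E : measurableType dE) (X : nat -> {RV P >-> E}).
Hypothesis X_indep : mutually_independent X.
Variables (U : 'I_3 -> E -> R) (C : 'I_3 -> 'I_3 -> R).
Hypotheses (bU : forall l, bmeas (U l))
  (U1 : forall k l, \int[P]_w U l (X k w) = 0)
  (U2 : forall k l m, \int[P]_w (U l (X k w) * U m (X k w)) = C l m).
Context d' (T' : measurableType d') (P' : probability T' R).
Variable (N : 'I_3 -> T' -> R).
Hypothesis gN : gauss_vec P' N C.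

Let W n l w := (\sum_(i < n) U l (X i w)) / Num.sqrt n%:R.

Lemma bmeas_normalized_sum (u : E -> R) n : bmeas u ->
  bmeas (fun w => (\sum_(i < n) u (X i w)) / Num.sqrt n%:R).
Proof.
move=> bu; apply: bmeasM; last exact: bmeas_cst.
by apply: bmeas_sum => i _; exact: (@bmeas_RV R d T P dE E X u i bu).
Qed.

Lemma cvg_inv_sqrt : (Num.sqrt (n%:R : R))^-1 @[n --> \oo] --> (0 : R).
Proof.
apply/cvgrPdist_le => e e0; near=> n.
have ne : e ^- 2 <= n%:R by near: n; exact: nbhs_infty_ger.
have n0 : 0 < n%:R :> R by apply: lt_le_trans ne; rewrite invr_gt0 exprn_gt0.
rewrite sub0r normrN ger0_norm ?invr_ge0//.
rewrite invf_ple ?posrE ?sqrtr_gt0//.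
rewrite -(ger0_norm (ltW _ : 0 <= e^-1)) ?invr_gt0// -sqrtr_sqr ler_sqrt; last exact: ltW.
by rewrite exprVn.
Unshelve. all: by end_near.
Qed.

Lemma clt_max_clamp_cvg :
  clamp_cvg P P' (fun n w => max3 (W n ^~ w)) (fun w => max3 (N ^~ w)).
Proof.
have [mN _ _ _ _] := gN.
apply: soft_step_clamp_cvg => //.
  by move=> n l; exact: (bmeas_normalized_sum n (bU l)).1.
move=> beta a beta0.
have [M UM] : exists M, forall l x, `|U l x| <= M.
  have [M0 _ h0] := bmeas_bound (bU ord0).
  have [M1 _ h1] := bmeas_bound (bU (lift ord0 ord0)).
  have [M2 _ h2] := bmeas_bound (bU (lift ord0 (lift ord0 ord0))).
  exists (max3 (fun l => nth 0 [:: M0; M1; M2] l)) => l x.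
  apply: le_trans (max3_ge _ l).
  by case: (unliftP ord0 l) => [i ->|->//]; case: (unliftP ord0 i) => [k ->|->//];
    case: (unliftP ord0 k) => [[]//|->].
have [K K0 hK] := clt_soft_step X_indep (fun l => (bU l).1) UM U1 U2 gN a beta0.
have c0 : (K / Num.sqrt n%:R) @[n --> \oo] --> (0 : R).
  by rewrite -(mulr0 K); apply: cvgM; [exact: cvg_cst|exact: cvg_inv_sqrt].
apply/cvgrPdist_le => e e0; near=> n.
rewrite distrC; apply: (@le_trans _ _ (K / Num.sqrt n%:R)).
  by apply: hK; near: n; exact: nbhs_infty_gt.
have : `|0 - K / Num.sqrt n%:R| <= e.
  by near: n; move/cvgrPdist_le : c0; exact.
by rewrite sub0r normrN; apply: le_trans; exact: ler_norm.
Unshelve. all: by end_near.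
Qed.

Lemma normalized_sum_second_moment (u : E -> R) (v : R) n : bmeas u ->
  (forall k, \int[P]_w u (X k w) = 0) -> (forall k, \int[P]_w u (X k w) ^+ 2 = v) ->
  (0 < n)%N -> \int[P]_w ((\sum_(i < n) u (X i w)) / Num.sqrt n%:R) ^+ 2 = v.
Proof.
move=> bu u1 u2 n0.
have bS : bmeas (fun w => (\sum_(i < n) u (X i w)) ^+ 2).
  by under eq_fun do rewrite expr2; apply: bmeasM; apply: bmeas_sum => i _; exact: (@bmeas_RV R d T P dE E X u i bu).
transitivity (\int[P]_w (n%:R^-1 * (\sum_(i < n) u (X i w)) ^+ 2)).
  by apply: eq_Rintegral => w _; rewrite exprMn exprVn sqr_sqrtr ?ler0n// mulrC.
rewrite RintegralZl//; last exact: bmeas_integrable.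
rewrite (sum_second_moment X_indep bu u1 u2) mulrA mulVf ?mul1r//.
by rewrite pnatr_eq0 -lt0n.
Qed.

Let V := \sum_(l < 3) C l l.

Lemma bmeas_max_sum n : bmeas (fun w => max3 (W n ^~ w)).
Proof. by apply: (@bmeas_max3 _ _ _ (W n)) => l; exact: bmeas_normalized_sum. Qed.

Lemma max_sum_second_moment n : (0 < n)%N ->
  \int[P]_w (max3 (W n ^~ w)) ^+ 2 <= V.
Proof.
move=> n0.
have bW2 l : bmeas (fun w => W n l w ^+ 2).
  by under eq_fun do rewrite expr2; apply: bmeasM; exact: bmeas_normalized_sum.
have -> : V = \int[P]_w \sum_(l < 3) W n l w ^+ 2.
  rewrite Exp_sum; last by move=> l; exact: bmeas_integrable.
  apply: eq_bigr => l _; rewrite (normalized_sum_second_moment (v := C l l))//.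
  by move=> k; under eq_Rintegral do rewrite expr2.
apply: le_Rintegral => //.
- apply: bmeas_integrable; under eq_fun do rewrite expr2.
  by apply: bmeasM; exact: bmeas_max_sum.
- by apply: bmeas_integrable; apply: bmeas_sum => l _; exact: bW2.
- by move=> w _; exact: max3_sqr_le.
Qed.

Lemma L1_gauss_max_sqr : L1 P' (fun w => (max3 (N ^~ w)) ^+ 2).
Proof.
have [mN _ N3 _ _] := gN.
apply: (@L1_le _ _ _ P' _ (fun w => \sum_(l < 3) N l w ^+ 2)).
- by apply: measurable_funX; exact: measurable_max3.
- apply: L1_sum => l.
  by under [X in EFin \o X]eq_fun do rewrite expr2; exact: L1_norm3_mul.
- by move=> w; rewrite ger0_norm ?sqr_ge0//; exact: max3_sqr_le.
Qed.

Lemma gauss_max_second_moment : \int[P']_w (max3 (N ^~ w)) ^+ 2 <= V.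
Proof.
have [mN _ N3 _ N2] := gN.
have l2 l : L1 P' (fun w => N l w ^+ 2).
  by under [X in EFin \o X]eq_fun do rewrite expr2; exact: L1_norm3_mul.
have -> : V = \int[P']_w \sum_(l < 3) N l w ^+ 2.
  rewrite Exp_sum//; apply: eq_bigr => l _; rewrite -N2.
  by apply: eq_Rintegral => w _; rewrite expr2.
apply: le_Rintegral => //.
- exact: L1_gauss_max_sqr.
- exact: L1_sum.
- by move=> w _; exact: max3_sqr_le.
Qed.

End clt_max.

(** * Height coordinates of the plane *)

Section coordinates.
Context {R : realType}.
Local Notation C := R[i].
Local Notation Re := complex.Re.
Local Notation Im := complex.Im.
Local Notation s3 := (Num.sqrt 3 : R).
Implicit Types x y z : C.

Lemma sqrt3_sqr : s3 ^+ 2 = 3.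
Proof. by rewrite sqr_sqrtr. Qed.

Lemma sqrt3_gt0 : 0 < s3.
Proof. by rewrite sqrtr_gt0. Qed.

Lemma sqrt3_gt1 : 1 < s3.
Proof.
have := sqrt3_sqr; have := sqrt3_gt0; move: s3 => s s0 ss.
rewrite ltNge; apply/negP => s1.
have : 0 <= (1 - s) * (1 + s) by apply: mulr_ge0; lra.
have -> : (1 - s) * (1 + s) = 1 - s ^+ 2 by ring.
by rewrite ss; lra.
Qed.

Lemma sqrt3_lt2 : s3 < 2.
Proof.
have := sqrt3_sqr; have := sqrt3_gt0; move: s3 => s s0 ss.
rewrite ltNge; apply/negP => s1.
have : 0 <= (s - 2) * (2 + s) by apply: mulr_ge0; lra.
have -> : (s - 2) * (2 + s) = s ^+ 2 - 4 by ring.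
by rewrite ss; lra.
Qed.

Lemma lambda_gt0 : 0 < lambda R.
Proof. by rewrite /lambda mulr_gt0// invr_gt0 sqrtr_gt0 mulr_gt0// sqrt3_gt0. Qed.

Lemma lambda_sqr : lambda R ^+ 2 * (3 * s3) = 4.
Proof.
rewrite /lambda exprMn exprVn sqr_sqrtr ?mulr_ge0 ?sqrtr_ge0//.
rewrite divfK; first by ring.
by rewrite mulf_neq0// gt_eqF// sqrt3_gt0.
Qed.

(** From the triple angle formula at pi / 2. *)
Lemma cos_pi6 : cos (pi / 6 : R) = s3 / 2.
Proof.
have p0 := pi_gt0 R; set a : R := pi / 6.
have a3 : a + a + a = pi / 2 by rewrite /a; field.
have c0 : 0 < cos a by apply: cos_gt0_pihalf; rewrite /a; apply/andP; split; lra.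
have h : cos (a + a + a) = cos a * (4 * cos a ^+ 2 - 3).
  have := cos2Dsin2 a; rewrite !cosD !sinD; move: (cos a) (sin a) => c s cs.
  have -> : (c * c - s * s) * c - (s * c + c * s) * s = c * (c ^+ 2 - 3 * s ^+ 2) by ring.
  by have -> : s ^+ 2 = 1 - c ^+ 2; [rewrite -cs; ring|ring].
move: h; rewrite a3 cos_pihalf => /esym/eqP; rewrite mulf_eq0 gt_eqF//= => /eqP h.
have h2 : cos a ^+ 2 = (s3 / 2) ^+ 2.
  by rewrite expr_div_n sqrt3_sqr; move: h; lra.
move/eqP : h2; rewrite eqf_sqr => /orP[/eqP//|/eqP e].
by move: c0; rewrite e oppr_gt0 ltNge divr_ge0// sqrtr_ge0.
Qed.

Lemma sin_pi6 : sin (pi / 6 : R) = 1 / 2.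
Proof.
have p0 := pi_gt0 R; have := cos2Dsin2 (pi / 6 : R); rewrite cos_pi6 expr_div_n sqrt3_sqr => h.
have s0 : 0 < sin (pi / 6 : R) by apply: sin_gt0_pi; apply/andP; split; lra.
have h2 : sin (pi / 6 : R) ^+ 2 = (1 / 2) ^+ 2 by move: h; move: (sin _) => u; lra.
move/eqP : h2; rewrite eqf_sqr => /orP[/eqP//|/eqP e].
by move: s0; rewrite e; lra.
Qed.

Lemma jrotE : jrot R = (- (1 / 2)) +i* (s3 / 2).
Proof.
rewrite /jrot /expi.
have -> : 2 * pi / 3 = pi / 6 + pi / 2 :> R by field.
by rewrite cosDpihalf sinDpihalf cos_pi6 sin_pi6.
Qed.

Lemma complex_ext x y : Re x = Re y -> Im x = Im y -> x = y.
Proof. by case: x y => [a b] [c d] /= -> ->. Qed.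

Lemma binE (l : 'I_3) : bin l = nth 0 [:: (s3 / 2 * lambda R) +i* (- (lambda R / 2));
   0 +i* lambda R; (- (s3 / 2 * lambda R)) +i* (- (lambda R / 2))] l.
Proof.
have s := sqrt3_sqr.
rewrite /bin jrotE; case: l => -[|[|[|//]]] i /=; apply: complex_ext => /=; rewrite ?expr2 /=.
- by field.
- transitivity ((1 / 4 - s3 ^+ 2 / 4) * lambda R); first by field.
  by rewrite s; field.
- by ring.
- by ring.
- by ring.
- by field.
Qed.

(** The component of [z] in the direction of bin [l]. *)
Definition height z (l : 'I_3) : R :=
  nth 0 [:: (s3 * Re z - Im z) / 2; Im z; (- s3 * Re z - Im z) / 2] l.

(** The rotation by which the costs are defined; it moves bin [l] to the
    first bin. *)
Definition rotl (l : 'I_3) z : C := nth 0 [:: z; jrot R ^+ 2 * z; jrot R * z] l.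

Lemma rotlE l z : rotl l z = nth 0 [:: z;
  (- (Re z) / 2 + s3 / 2 * Im z) +i* (- (s3 / 2) * Re z - Im z / 2);
  (- (Re z) / 2 - s3 / 2 * Im z) +i* ((s3 / 2) * Re z - Im z / 2)] l.
Proof.
have s := sqrt3_sqr.
rewrite /rotl jrotE; case: z => x y; case: l => -[|[|[|//]]] i //=; apply: complex_ext => /=; rewrite ?expr2 /=.
- transitivity ((1 / 4 - s3 ^+ 2 / 4) * x + s3 / 2 * y); first by field.
  by rewrite s; field.
- transitivity ((1 / 4 - s3 ^+ 2 / 4) * y - s3 / 2 * x); first by field.
  by rewrite s; field.
- by field.
- by field.
Qed.

Lemma height_rotl l m z : height (rotl l z) m = height z (l + m).
Proof.
have s := sqrt3_sqr.
have e : s3 * (s3 / 2 * Im z) = 3 / 2 * Im z.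
  by transitivity (s3 ^+ 2 / 2 * Im z); [field|rewrite s].
have e' : s3 * (s3 / 2 * Re z) = 3 / 2 * Re z.
  by transitivity (s3 ^+ 2 / 2 * Re z); [field|rewrite s].
rewrite rotlE /height; case: z e e' => x y /= e e'.
by case: l => -[|[|[|//]]] i; case: m => -[|[|[|//]]] k //=; rewrite ?mulrDr ?mulrBr ?e; lra.
Qed.

Lemma rotlD l m z : rotl m (rotl l z) = rotl (l + m) z.
Proof.
have j3 : jrot R ^+ 3 = 1.
  have s := sqrt3_sqr.
  rewrite jrotE; apply: complex_ext; rewrite !exprS expr0 mulr1 /=.
    transitivity (- (1 / 8) + 3 / 8 * s3 ^+ 2); first by field.
    by rewrite s; field.
  transitivity (s3 * (3 / 8 - s3 ^+ 2 / 8)); first by field.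
  by rewrite s; field.
have j4 : jrot R ^+ 4 = jrot R by rewrite exprS j3 mulr1.
rewrite /rotl; case: l => -[|[|[|//]]] i; case: m => -[|[|[|//]]] k //=.
- by rewrite mulrA -exprD j4.
- by rewrite mulrA -exprS j3 mul1r.
- by rewrite mulrA -exprSr j3 mul1r.
- by rewrite mulrA -expr2.
Qed.

Lemma height_sum z : height z 0 + height z 1 + height z 2 = 0.
Proof. by rewrite /height /=; lra. Qed.

Lemma height_inj x y : (forall l, height x l = height y l) -> x = y.
Proof.
move=> h; have h0 := h 0; have h1 := h 1.
move: h0 h1; rewrite /height /=; case: x {h} => [a b]; case: y => [c d] /= h0 h1.
rewrite h1 in h0 *; congr (_ +i* _).
apply: (@mulfI _ s3); first by rewrite gt_eqF// sqrt3_gt0.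
by move: (s3 * a) (s3 * c) h0 => u v; lra.
Qed.

(** All three squared distances share the term |z| ^ 2 + lambda ^ 2, so
    comparing distances amounts to comparing heights. *)
Lemma sqr_dist_bin z l : normc (z - bin l) ^+ 2 =
  Re z ^+ 2 + Im z ^+ 2 - 2 * lambda R * height z l + lambda R ^+ 2.
Proof.
have s := sqrt3_sqr; rewrite binE /height; case: z => x y.
case: l => -[|[|[|//]]] i /=; rewrite sqr_sqrtr ?addr_ge0 ?sqr_ge0//.
- transitivity (x ^+ 2 + y ^+ 2 - lambda R * (s3 * x - y) + lambda R ^+ 2 * (s3 ^+ 2 / 4 + 1 / 4)); first by field.
  by rewrite s; field.
- by ring.
- transitivity (x ^+ 2 + y ^+ 2 - lambda R * (- s3 * x - y) + lambda R ^+ 2 * (s3 ^+ 2 / 4 + 1 / 4)); first by field.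
  by rewrite s; field.
Qed.

Lemma dist_bin_le z l m : (normc (z - bin l) <= normc (z - bin m)) = (height z m <= height z l).
Proof.
have n0 w : 0 <= normc w by case: w => a b; exact: sqrtr_ge0.
rewrite -(ler_pXn2r (n := 2))// ?nnegrE// !sqr_dist_bin lerD2r lerD2l lerN2.
by rewrite ler_pM2l// mulr_gt0// lambda_gt0.
Qed.

Lemma dist_bin_lt z l m : (normc (z - bin l) < normc (z - bin m)) = (height z m < height z l).
Proof. by rewrite !ltNge dist_bin_le. Qed.

(** The heights are affine functions of the barycentric coordinates. *)
Lemma height_comb (w : 'I_3 -> R) l :
  \sum_(m < 3) w m = 1 ->
  height (\sum_(m < 3) (w m)%:C * bin m) l = lambda R / 2 * (3 * w l - 1).
Proof.
have s := sqrt3_sqr.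
rewrite !big_ord_recl !big_ord0 => w1.
have [p [q [r [pE [qE rE]]]]] : exists p q r, w 0 = p /\ w 1 = q /\ w 2 = r by do 3 eexists.
have w1' : p + (q + r) = 1.
  rewrite -pE -qE -rE -w1 addr0; congr (_ + (w _ + w _)); exact: val_inj.
have e : s3 * (s3 / 2 * lambda R) = 3 / 2 * lambda R.
  transitivity (s3 ^+ 2 / 2 * lambda R); first by field.
  by rewrite s.
have -> : (w ord0)%:C * bin ord0 + ((w (lift ord0 ord0))%:C * bin (lift ord0 ord0)
    + ((w (lift ord0 (lift ord0 ord0)))%:C * bin (lift ord0 (lift ord0 ord0)) + 0)) =
    (s3 / 2 * lambda R * (p - r)) +i* (lambda R * (q - (p + r) / 2)).
  have -> : lift ord0 (lift ord0 (@ord0 0)) = 2 :> 'I_3 by exact: val_inj.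
  have -> : lift ord0 (@ord0 1) = 1 :> 'I_3 by exact: val_inj.
  rewrite -[ord0]/(0 : 'I_3) pE qE rE !binE /=.
  by apply: complex_ext => /=; field.
case: l => -[|[|[|//]]] i; rewrite /height /=.
- have -> : w (Ordinal i) = p by rewrite -pE; congr w; exact: val_inj.
  transitivity ((s3 * (s3 / 2 * lambda R) * (p - r) - lambda R * (q - (p + r) / 2)) / 2); first by field.
  by rewrite e (_ : p = 1 - (q + r)); [field|lra].
- have -> : w (Ordinal i) = q by rewrite -qE; congr w; exact: val_inj.
  by rewrite (_ : p = 1 - (q + r)); [field|lra].
- have -> : w (Ordinal i) = r by rewrite -rE; congr w; exact: val_inj.
  transitivity ((- (s3 * (s3 / 2 * lambda R)) * (p - r) - lambda R * (q - (p + r) / 2)) / 2); first by field.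
  by rewrite e (_ : p = 1 - (q + r)); [field|lra].
Qed.

(** The inequalities are the positivity of the barycentric coordinates, by
    [height_comb]. *)
Lemma triangleP z : triangle z <-> forall l, - (lambda R / 2) <= height z l.
Proof.
have l0 := lambda_gt0; split=> [[w [w0 w1 ->]] l|h].
  rewrite height_comb//; have := mulr_ge0 (ltW l0) (w0 l); lra.
pose w (l : 'I_3) := 1 / 3 + 2 / (3 * lambda R) * height z l.
have w1 : \sum_(l < 3) w l = 1.
  rewrite !big_ord_recl big_ord0 /w; have := height_sum z.
  have -> : lift ord0 (lift ord0 (@ord0 0)) = 2 :> 'I_3 by exact: val_inj.
  have -> : lift ord0 (@ord0 1) = 1 :> 'I_3 by exact: val_inj.
  rewrite -[ord0]/(0 : 'I_3); move: (height z 0) (height z 1) (height z 2) => a b c abc.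
  have -> : a = - b - c by lra.
  by field; rewrite gt_eqF.
exists w; split=> [l||] //.
  rewrite /w; have -> : 1 / 3 + 2 / (3 * lambda R) * height z l =
      2 / (3 * lambda R) * (height z l - - (lambda R / 2)) by field; rewrite gt_eqF.
  by rewrite mulr_ge0 ?subr_ge0 ?h// divr_ge0// mulr_ge0// ltW.
apply: height_inj => l; rewrite height_comb// /w.
by field; rewrite gt_eqF.
Qed.

End coordinates.

(** * The cells *)

Section cells.
Context {R : realType}.
Local Notation C := R[i].
Local Notation Re := complex.Re.
Local Notation Im := complex.Im.
Local Notation s3 := (Num.sqrt 3 : R).
Implicit Types x y z : C.

Lemma ord3_cases (l : 'I_3) : [\/ l = 0, l = 1 | l = 2].
Proof.
by case: l => -[|[|[|//]]] i; [apply: Or31|apply: Or32|apply: Or33]; exact: val_inj.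
Qed.

Lemma add3_11 : 1 + 1 = 2 :> 'I_3. Proof. exact: val_inj. Qed.
Lemma add3_12 : 1 + 2 = 0 :> 'I_3. Proof. exact: val_inj. Qed.
Lemma add3_21 : 2 + 1 = 0 :> 'I_3. Proof. exact: val_inj. Qed.
Lemma add3_22 : 2 + 2 = 1 :> 'I_3. Proof. exact: val_inj. Qed.
Definition add3E := (@add0r 'I_3, @addr0 'I_3, add3_11, add3_12, add3_21, add3_22).

Lemma measurable_pair_of : measurable_fun setT (@pair_of R).
Proof. by move=> _ B mB; exists B. Qed.

Lemma measurable_Re : measurable_fun setT (fun z : C => Re z).
Proof. exact: (measurableT_comp measurable_fst measurable_pair_of). Qed.

Lemma measurable_Im : measurable_fun setT (fun z : C => Im z).
Proof. exact: (measurableT_comp measurable_snd measurable_pair_of). Qed.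

Lemma measurable_to_complex d (T : measurableType d) (f : T -> C) :
  measurable_fun setT (fun w => Re (f w)) -> measurable_fun setT (fun w => Im (f w)) ->
  measurable_fun setT f.
Proof.
move=> mr mi _ A [B mB <-]; rewrite !setTI.
have m : measurable_fun setT (fun w => (Re (f w), Im (f w))) by exact: measurable_fun_pair.
by rewrite -[X in measurable X]setTI; exact: (m measurableT B mB).
Qed.

Lemma measurable_height l : measurable_fun setT (fun z => height z l).
Proof.
have mr := measurable_Re; have mi := measurable_Im.
case: l => -[|[|[|//]]] i; rewrite /height /= => //.
- by apply: measurable_funM => //; apply: measurable_funB => //; exact: measurable_funM.
- by apply: measurable_funM => //; apply: measurable_funB => //; exact: measurable_funM.
Qed.

Lemma measurable_rotl l : measurable_fun setT (rotl l : C -> C).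
Proof.
have mr := measurable_Re; have mi := measurable_Im.
have -> : rotl l = (fun z => nth 0 [:: z;
  (- (Re z) / 2 + s3 / 2 * Im z) +i* (- (s3 / 2) * Re z - Im z / 2);
  (- (Re z) / 2 - s3 / 2 * Im z) +i* ((s3 / 2) * Re z - Im z / 2)] l).
  by apply/funext => z; rewrite rotlE.
have mN2 : measurable_fun setT (fun z => - Re z / 2).
  by apply: measurable_funM => //; exact: measurableT_comp.
case: l => -[|[|[|//]]] i /=; apply: measurable_to_complex => //=.
- by apply: measurable_funD => //; exact: measurable_funM.
- by apply: measurable_funB => //; exact: measurable_funM.
- by apply: measurable_funB => //; exact: measurable_funM.
- by apply: measurable_funB => //; exact: measurable_funM.
Qed.

Lemma measurable_height_le l m : measurable [set z : C | height z l <= height z m].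
Proof.
rewrite -[X in measurable X]setTI.
by apply: measurable_fun_ler => //; exact: measurable_height.
Qed.

Lemma measurable_height_ge l (r : R) : measurable [set z : C | r <= height z l].
Proof.
rewrite -[X in measurable X]setTI.
by apply: measurable_fun_ler => //; exact: measurable_height.
Qed.

Lemma measurable_triangle : measurable (@triangle R).
Proof.
have -> : @triangle R = \bigcap_(l in [set: 'I_3]) [set z : C | - (lambda R / 2) <= height z l].
  by apply/seteqP; split=> z /=; [move=> /triangleP h l _; exact: h|move=> h; apply/triangleP => l; exact: h].
by apply: fin_bigcap_measurable => // l _; exact: measurable_height_ge.
Qed.

Lemma height_ray (l m : 'I_3) (t : R) :
  height ('i%C * jrot R ^+ l.+1 * t%:C) m = if m == l + 2 then t else - t / 2.
Proof.
have s := sqrt3_sqr (R := R).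
have e : s3 * (s3 / 2 * t) = 3 / 2 * t by transitivity (s3 ^+ 2 / 2 * t); [field|rewrite s].
case: l => -[|[|[|//]]] i; rewrite jrotE /=.
- have -> : 'i%C * (- (1 / 2) +i* (s3 / 2)) ^+ 1 * t%:C = (- (s3 / 2 * t)) +i* (- t / 2).
    by rewrite expr1; apply: complex_ext => /=; field.
  by case: m => -[|[|[|//]]] k; rewrite /height /= ?mulrN ?mulNr ?e ?opprK; lra.
- have -> : 'i%C * (- (1 / 2) +i* (s3 / 2)) ^+ 2 * t%:C = (s3 / 2 * t) +i* (- t / 2).
    rewrite expr2; apply: complex_ext => /=; first by field.
    transitivity (- (s3 ^+ 2 - 1) / 4 * t); first by field.
    by rewrite s; field.
  by case: m => -[|[|[|//]]] k; rewrite /height /= ?mulrN ?mulNr ?e ?opprK; lra.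
- have -> : 'i%C * (- (1 / 2) +i* (s3 / 2)) ^+ 3 * t%:C = 0 +i* t.
    rewrite !exprS expr0 mulr1; apply: complex_ext => /=.
      transitivity (s3 * (s3 ^+ 2 - 3) / 8 * t); first by field.
      by rewrite s; field.
    transitivity ((3 * s3 ^+ 2 - 1) / 8 * t); first by field.
    by rewrite s; field.
  by case: m => -[|[|[|//]]] k; rewrite /height /=; lra.
Qed.

(** The ray with label [l] is the half of the line of equal distance to the
    bins [l] and [l + 1] that points away from the third bin. *)
Lemma rayP l z : ray l z <->
  height z l = height z (l + 1) /\ (if l == ord0 then height z (l + 2) < 0 else height z (l + 2) <= 0).
Proof.
have l02 : l == l + 2 = false by case: (ord3_cases l) => ->.
have l12 : l + 1 == l + 2 = false by case: (ord3_cases l) => ->.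
split.
  move=> [t ht ->]; rewrite !height_ray eqxx l02 l12; split => //.
move=> [h1 h2]; exists (height z (l + 2)) => //.
have sm : height z l + height z (l + 1) + height z (l + 2) = 0.
  have := height_sum z.
  by case: (ord3_cases l) => ->; rewrite ?add3E; move: (height z 0) (height z 1) (height z 2) => a b c; lra.
apply: height_inj => m; rewrite height_ray; case: eqP => [->//|ml].
have : m = l \/ m = l + 1.
  move: ml; case: (ord3_cases l) => ->; case: (ord3_cases m) => ->; rewrite ?add3E => ml;
  by [left|right|case: ml].
by move: h1 sm => h1 sm [->|->]; lra.
Qed.

(** A boolean form of the cells, in height coordinates. *)
Definition in_cell (l : 'I_3) z : bool :=
  [&& [forall m, - (lambda R / 2) <= height z m], [forall m, height z m <= height z l] &
      ~~ ((height z l == height z (l + 1)) &&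
          (if l == ord0 then height z (l + 2) < 0 else height z (l + 2) <= 0))].

Lemma cellE l z : cell l z <-> in_cell l z.
Proof.
rewrite /cell /in_cell; split.
  move=> [[/triangleP h1 h2] nr]; apply/and3P; split.
  - exact/forallP.
  - by apply/forallP => m; rewrite -dist_bin_le.
  - by apply/negP => /andP[/eqP e1 e2]; apply: nr; apply/rayP.
move=> /and3P[/forallP h1 /forallP h2 h3]; split; first split.
- exact/triangleP.
- by move=> m; rewrite dist_bin_le.
- by move=> /rayP[e1 e2]; move: h3; rewrite e1 eqxx e2.
Qed.

Lemma in_cellE z : [/\
  in_cell 0 z <-> triangle z /\ height z 1 <= height z 0 /\ height z 2 <= height z 0 /\ (height z 0 <> height z 1 \/ 0 <= height z 2),
  in_cell 1 z <-> triangle z /\ height z 0 <= height z 1 /\ height z 2 <= height z 1 /\ (height z 1 <> height z 2 \/ 0 < height z 0) &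
  in_cell 2 z <-> triangle z /\ height z 0 <= height z 2 /\ height z 1 <= height z 2 /\ (height z 2 <> height z 0 \/ 0 < height z 1)].
Proof.
have E l : in_cell l z <-> triangle z /\ (forall m, height z m <= height z l) /\
   ((height z l <> height z (l + 1)) \/ (if l == ord0 then 0 <= height z (l + 2) else 0 < height z (l + 2))).
  rewrite /in_cell; split.
    move=> /and3P[/forallP h1 /forallP h2]; rewrite negb_and => h3; split; first exact/triangleP.
    split=> //; case/orP : h3 => [/eqP|]; first by left.
    by case: ifP => _; rewrite -?leNgt -?ltNge; right.
  move=> [/triangleP h1 [h2 h3]]; apply/and3P; split; [exact/forallP|exact/forallP|].
  rewrite negb_and; apply/orP; case: h3 => [/eqP|]; first by left.
  by case: ifP => _; rewrite -?leNgt -?ltNge; right.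
have all3 (Q : 'I_3 -> Prop) : (forall m, Q m) <-> Q 0 /\ Q 1 /\ Q 2.
  split=> [h|[q0 [q1 q2]]]; first by split=> //; split.
  case=> -[|[|[|//]]] i.
  - by have -> : Ordinal i = 0 :> 'I_3 by exact: val_inj.
  - by have -> : Ordinal i = 1 :> 'I_3 by exact: val_inj.
  - by have -> : Ordinal i = 2 :> 'I_3 by exact: val_inj.
split; rewrite E all3 ?add3E /=; split.
- by move=> [h1 [[_ [h2 h3]] h4]].
- by move=> [h1 [h2 [h3 h4]]].
- by move=> [h1 [[h2 [_ h3]] h4]].
- by move=> [h1 [h2 [h3 h4]]].
- by move=> [h1 [[h2 [h3 _]] h4]].
- by move=> [h1 [h2 [h3 h4]]].
Qed.

(** Ties between the two nearest bins are broken by the rays, each of which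
    is removed from exactly one of the two cells that it separates; at the
    centre the asymmetric definition of the first ray leaves the point in
    the first cell. *)
Lemma in_cell_exists z : triangle z -> exists l, in_cell l z.
Proof.
move=> tz; have sm := height_sum z; have [c0 c1 c2] := in_cellE z.
have [h01|h01] := lerP (height z 0) (height z 1).
  have [h12|h12] := lerP (height z 1) (height z 2).
    have [e|/eqP ne] := eqVneq (height z 2) (height z 0).
      by exists 0; apply/c0; split => //; lra.
    by exists 2; apply/c2; split => //; split; [lra|split; [lra|left]].
  have [e|/eqP ne] := eqVneq (height z 0) (height z 1).
    by exists 1; apply/c1; split => //; split; [lra|split; [lra|left; lra]].
  by exists 1; apply/c1; split => //; split; [lra|split; [lra|left; lra]].
have [h02|h02] := lerP (height z 2) (height z 0).
  by exists 0; apply/c0; split => //; split; [lra|split; [lra|left; lra]].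
by exists 2; apply/c2; split => //; split; [lra|split; [lra|left; lra]].
Qed.

Lemma in_cell_uniq z l m : in_cell l z -> in_cell m z -> l = m.
Proof.
have sm := height_sum z; have [c0 c1 c2] := in_cellE z.
case: (ord3_cases l) => ->; case: (ord3_cases m) => -> //.
- move=> /c0 [_ [h1 [h2 h3]]] /c1 [_ [h4 [h5 h6]]].
  by exfalso; case: h3; case: h6; lra.
- move=> /c0 [_ [h1 [h2 h3]]] /c2 [_ [h4 [h5 h6]]].
  by exfalso; case: h3; case: h6; lra.
- move=> /c1 [_ [h1 [h2 h3]]] /c0 [_ [h4 [h5 h6]]].
  by exfalso; case: h3; case: h6; lra.
- move=> /c1 [_ [h1 [h2 h3]]] /c2 [_ [h4 [h5 h6]]].
  by exfalso; case: h3; case: h6; lra.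
- move=> /c2 [_ [h1 [h2 h3]]] /c0 [_ [h4 [h5 h6]]].
  by exfalso; case: h3; case: h6; lra.
- move=> /c2 [_ [h1 [h2 h3]]] /c1 [_ [h4 [h5 h6]]].
  by exfalso; case: h3; case: h6; lra.
Qed.

Lemma in_cell_triangle l z : in_cell l z -> triangle z.
Proof. by move=> /and3P[/forallP h _ _]; apply/triangleP. Qed.

Lemma in_cell_max l m z : in_cell l z -> height z m <= height z l.
Proof. by move=> /and3P[_ /forallP h _]. Qed.

Lemma in_cell_interior l z : triangle z -> (forall m, m != l -> height z m < height z l) -> in_cell l z.
Proof.
move=> /triangleP tz h; apply/and3P; split; first exact/forallP.
  by apply/forallP => m; have [->//|ml] := eqVneq m l; exact/ltW/h.
rewrite negb_and; apply/orP; left; rewrite gt_eqF//; apply: h.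
by case: (ord3_cases l) => ->.
Qed.

Lemma measurable_in_cell l : measurable [set z : C | in_cell l z].
Proof.
have mray : measurable [set z : C | (height z l == height z (l + 1)) &&
    (if l == ord0 then height z (l + 2) < 0 else height z (l + 2) <= 0)].
  have -> : [set z : C | (height z l == height z (l + 1)) &&
      (if l == ord0 then height z (l + 2) < 0 else height z (l + 2) <= 0)] =
    ([set z : C | height z l <= height z (l + 1)] `&` [set z : C | height z (l + 1) <= height z l]) `&`
    (if l == ord0 then ~` [set z : C | 0 <= height z (l + 2)] else ~` [set z : C | 0 < height z (l + 2)]).
    apply/seteqP; split=> z /=.
      move=> /andP[/eqP -> h]; split => //; case: ifP h => _ h /=; apply/negP.
        by rewrite -ltNge.
      by rewrite -leNgt.
    move=> [[h1 h2] h]; apply/andP; split; first by rewrite eq_le h1 h2.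
    by case: ifP h => _ /negP; rewrite -?ltNge -?leNgt.
  apply: measurableI; first by apply: measurableI; exact: measurable_height_le.
  case: ifP => _; apply: measurableC; first exact: measurable_height_ge.
  rewrite -[X in measurable X]setTI.
  by apply: measurable_fun_ltr => //; exact: measurable_height.
have -> : [set z : C | in_cell l z] = (@triangle R) `&`
    \bigcap_(m in [set: 'I_3]) [set z : C | height z m <= height z l] `\`
    [set z : C | (height z l == height z (l + 1)) &&
    (if l == ord0 then height z (l + 2) < 0 else height z (l + 2) <= 0)].
  apply/seteqP; split=> z /=.
    move=> /and3P[/forallP h1 /forallP h2 /negP h3]; split => //.
    by split; [exact/triangleP|move=> m _; exact: h2].
  move=> [[/triangleP h1 h2] h3]; apply/and3P; split; first exact/forallP.
    by apply/forallP => m; exact: h2.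
  exact/negP.
apply: measurableD => //; apply: measurableI; first exact: measurable_triangle.
by apply: fin_bigcap_measurable => // m _; exact: measurable_height_le.
Qed.

End cells.

(** * Rotations, areas and costs *)

Section rotation_area.
Context {R : realType}.
Local Notation C := R[i].
Local Notation Re := complex.Re.
Local Notation Im := complex.Im.
Local Notation s3 := (Num.sqrt 3 : R).
Local Notation mu := (@lebesgue_measure R).
Implicit Types x y z : C.

Lemma triangle_rotl l z : triangle (rotl l z) <-> triangle z.
Proof.
rewrite !triangleP; split=> h m; last by rewrite height_rotl.
by have := h (- l + m); rewrite height_rotl addrA subrr add0r.
Qed.

(** The rays, hence the cells, are rotated into each other except at the
    centre. *)
Lemma in_cell_rotl l z : z <> 0 -> in_cell l z = in_cell 0 (rotl l z).
Proof.
move=> z0; rewrite /in_cell.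
have E (Q : 'I_3 -> bool) : [forall m, Q (l + m)] = [forall m, Q m].
  apply/forallP/forallP => h m; last exact: h.
  by have := h (- l + m); rewrite addrA subrr add0r.
under [in RHS]eq_forallb do rewrite height_rotl.
rewrite (E (fun m => - (lambda R / 2) <= height z m)); congr andb.
under [in RHS]eq_forallb do rewrite !height_rotl addr0.
rewrite (E (fun m => height z m <= height z l)); congr andb.
congr negb; rewrite !height_rotl addr0 !add0r /=.
case: eqP => //= e; case: ifP => // _; rewrite lt_def.
case: eqP => //= e2; exfalso; apply: z0.
have sm := height_sum z; apply: height_inj => m.
have -> : height (0 : C) m = 0 by case: m => -[|[|[|//]]] i; rewrite /height /=; lra.
move: e e2; case: (ord3_cases l) => ->; case: (ord3_cases m) => ->; rewrite ?add3E; lra.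
Qed.

(** In real coordinates this is the rotation invariance of planar Lebesgue
    measure. *)
Lemma area_rot1 : same_law (@area R) (fun z : C => rotl 2 z) (@area R) id.
Proof.
move=> A mA; rewrite preimage_id /area.
have mA' := measurable_complex_of mA.
have cs : (- (1 / 2)) ^+ 2 + (- (s3 / 2)) ^+ 2 = 1 :> R.
  by rewrite !sqrrN !expr_div_n sqrt3_sqr; field.
have s0 : - (s3 / 2) != 0 :> R by rewrite oppr_eq0 mulf_neq0// gt_eqF// sqrt3_gt0.
rewrite -[RHS](lebesgue2_rot cs s0 mA').
congr ((mu \x mu)%E _); apply/seteqP; split=> -[a b] /=; rewrite rotlE /= /rot2 /=;
 by congr (A (_ +i* _)); field.
Qed.

Lemma area_rotl l : same_law (@area R) (fun z : C => rotl l z) (@area R) id.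
Proof.
have m2 := @measurable_rotl R 2.
case: (ord3_cases l) => ->.
- by move=> A mA; congr (area _).
- move=> A mA; rewrite preimage_id -[RHS](area_rot1 mA).
  have mA2 : measurable ((fun z : C => rotl 2 z) @^-1` A).
    by rewrite -[X in measurable X]setTI; exact: m2.
  rewrite -[RHS](area_rot1 mA2); congr (area _).
  by apply/seteqP; split=> z /=; rewrite rotlD add3E.
- exact: area_rot1.
Qed.

Lemma area_set0 : area [set 0 : C] = 0%E.
Proof.
rewrite /area (_ : [set p | _] = [set 0] `*` [set 0]).
  by rewrite product_measure1E//= lebesgue_measure_set1 mul0e.
apply/seteqP; split=> -[a b] /=; first by move=> [-> ->].
by move=> [-> ->].
Qed.

(** The square is a product of two intervals of length [2 * eta]. *)
Lemma area_gt0 (A : set C) (a b eta : R) : 0 < eta -> measurable A ->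
  (forall z, `|Re z - a| <= eta -> `|Im z - b| <= eta -> A z) -> (0 < area A)%E.
Proof.
move=> eta0 mA h.
apply: (@lt_le_trans _ _ ((mu \x mu)%E (`[a - eta, a + eta]%classic `*` `[b - eta, b + eta]%classic))).
  rewrite product_measure1E//= !lebesgue_measure_itv/= !lte_fin.
  rewrite ifT; last by lra.
  rewrite ifT; last by lra.
  by rewrite -!EFinB -EFinM lte_fin mulr_gt0//; lra.
apply: le_measure; rewrite ?inE.
- exact: measurableX.
- exact: measurable_complex_of.
- move=> [u v] /= []; rewrite !in_itv/= => h1 h2.
  by apply: h => /=; rewrite ler_norml; lra.
Qed.

(** The horizontal section at height [y] is the segment of half-length [q
    y], and the value of [lambda] makes the integral of the lengths equal to
    1. *)
Lemma area_triangle : area (@triangle R) = 1%E.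
Proof.
have l0 := @lambda_gt0 R; have s0 := @sqrt3_gt0 R; have s := @sqrt3_sqr R.
have ls := @lambda_sqr R.
set l := lambda R in l0 ls *.
have mA := measurable_complex_of (@measurable_triangle R).
pose q (y : R) : R := (l - y) / s3.
have qE (y : R) : q y * s3 = l - y by rewrite /q divfK// gt_eqF.
rewrite /area; set A := [set p | _] in mA *.
have -> : (mu \x mu)%E A = (\int[mu]_y mu (ysection A y))%E.
  transitivity (\int[(mu \x mu)%E]_z (\1_A z)%:E)%E; first by rewrite integral_indic// setIT.
  rewrite (indic_fubini_tonelli1 mu mu mA) (indic_fubini_tonelli mu mu mA).
  apply: eq_integral => y _.
  exact: (congr1 (fun g => g y) (indic_fubini_tonelli_GE mu mA)).
have sec (y : R) : ysection A y = if - (l / 2) <= y <= l then `[- q y, q y]%classic else set0.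
  have qy := qE y.
  have P (x : R) : (`[- q y, q y]%classic x <-> - (l - y) <= x * s3 <= l - y).
    by rewrite /= in_itv/= -[- q y <= x](ler_pM2r s0) -[x <= q y](ler_pM2r s0) mulNr qy.
  apply/seteqP; split=> x; rewrite /ysection /= inE /A /= => h.
    have {}h := (triangleP _).1 h; have h0 := h 0; have h1 := h 1; have h2 := h 2.
    move: h0 h1 h2; rewrite /height /= -/l => h0 h1 h2.
    rewrite ifT; last by apply/andP; split; lra.
    by apply/P; apply/andP; split; lra.
  move: h; case: ifP => [/andP[y1 y2] /P/andP[x1 x2]|//].
  apply/triangleP => m; rewrite -/l /height.
  by case: (ord3_cases m) => -> /=; lra.
have -> : (\int[mu]_y mu (ysection A y) = \int[mu]_(y in `[(- (l / 2))%R, l%R]) (2 * q y)%R%:E)%E.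
  rewrite [RHS]integral_mkcond; apply: eq_integral => t _; pose y : R := t; rewrite -/y.
  rewrite sec patchE mem_setE in_itv /=; case: ifP => [/andP[y1 y2]|_]; last by rewrite measure0.
  have q0 : 0 <= q y by rewrite -(pmulr_lge0 _ s0) qE; lra.
  rewrite lebesgue_measure_itv/= lte_fin; case: ltP => h.
    by rewrite -EFinB; congr EFin; lra.
  by congr EFin; lra.
pose F (y : R) : R := - (l - y) ^+ 2 / s3.
have dF (y : R) : is_derive y 1 F (2 * q y).
  rewrite /F; apply: is_derive_eq; rewrite /q /GRing.scale /=; field.
  by rewrite gt_eqF.
rewrite (@continuous_FTC2 _ _ F).
- rewrite -EFinB /F; congr EFin.
  transitivity (l ^+ 2 * (3 * s3) * (3 / 4) / s3 ^+ 2); first by field; rewrite gt_eqF.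
  by rewrite ls s; field.
- lra.
- apply: continuous_subspaceT => y.
  by apply: cvgM; [exact: cvg_cst|apply: cvgM; [apply: cvgB; [exact: cvg_cst|exact: cvg_id]|exact: cvg_cst]].
- have cF (y : R) : F z @[z --> y] --> F y.
    by apply: differentiable_continuous; apply/derivable1_diffP; exact: ex_derive.
  split; first by move=> y _; exact: ex_derive.
  + by apply: cvg_at_right_filter; exact: cF.
  + by apply: cvg_at_left_filter; exact: cF.
- by move=> y _; rewrite derive1E; exact: derive_val.
Qed.

End rotation_area.

Section costs.
Context {R : realType}.
Local Notation C := R[i].
Variable c : C -> R.
Hypothesis c_measurable : measurable_fun triangle c.
Hypothesis c_ge0 : forall x, triangle x -> 0 <= c x.
Hypothesis c_bounded : exists M : R, forall x, triangle x -> c x <= M.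
Implicit Types x z : C.

Lemma costE l x : cost c l x = (c \_ triangle) (rotl l x).
Proof. by []. Qed.

Lemma cost_rotl l m x : cost c m (rotl l x) = cost c (l + m) x.
Proof. by rewrite !costE rotlD. Qed.

Lemma cost_triangle l x : triangle x -> cost c l x = c (rotl l x).
Proof.
move=> tx; rewrite costE patchE ifT// inE; exact/triangle_rotl.
Qed.

Lemma cost_out l x : ~ triangle x -> cost c l x = 0.
Proof.
move=> tx; rewrite costE patchE ifF//; apply/negbTE; rewrite notin_setE.
by move=> /triangle_rotl.
Qed.

Lemma cost_ge0 l x : 0 <= cost c l x.
Proof.
have [tx|tx] := pselect (triangle x); last by rewrite cost_out.
by rewrite cost_triangle// c_ge0//; exact/triangle_rotl.
Qed.

Lemma cost_le_bound : exists2 M : R, 0 <= M & forall l x, cost c l x <= M.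
Proof.
have [M hM] := c_bounded; exists `|M| => // l x.
have [tx|tx] := pselect (triangle x); last by rewrite cost_out.
rewrite cost_triangle//; apply: le_trans (ler_norm M); apply: hM.
exact/triangle_rotl.
Qed.

Lemma measurable_cost l : measurable_fun setT (cost c l).
Proof.
apply: (measurableT_comp (f := c \_ triangle) _ (measurable_rotl l)).
by apply/(measurable_restrictT _ measurable_triangle).
Qed.

Lemma bmeas_cost l : bmeas (cost c l).
Proof.
split; first exact: measurable_cost.
by have [M _ hM] := cost_le_bound; exists M => x; rewrite ger0_norm ?cost_ge0.
Qed.

Hypothesis c_bin1 : forall (x : C) (l : 'I_3), triangle x -> l != ord0 ->
  normc (x - bin ord0) < normc (x - bin l) -> cost c ord0 x < cost c l x.
Hypothesis c_symmetric : forall theta t : R, 0 <= theta <= 2 * pi -> 0 < t ->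
  triangle (t%:C * expi theta) ->
  c (t%:C * expi theta) = c (t%:C * expi (- theta - pi / 3)).

(** Assumption (b) in height coordinates. A point equidistant from the bins
    0 and 1 has argument pi / 6 or 7 pi / 6, and the reflection of the
    assumption acts on it as the rotation that defines the cost at bin 1. *)
Lemma cost_tie01 x : triangle x -> height x 0 = height x 1 -> cost c 0 x = cost c 1 x.
Proof.
move=> tx h01; rewrite !cost_triangle//.
have p0 := pi_gt0 R.
have s := @sqrt3_sqr R.
have s0 := @sqrt3_gt0 R.
have [x0|x0] := eqVneq (height x 2) 0.
  have -> : x = 0.
    apply: height_inj => m; have sm := height_sum x.
    have -> : height (0 : C) m = 0 by case: m => -[|[|[|//]]] i; rewrite /height /=; lra.
    by case: (ord3_cases m) => ->; lra.
  by rewrite /rotl /= mulr0.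
have h2 : height x 0 = - height x 2 / 2 by have := height_sum x; lra.
have [neg|pos] := ltP (height x 2) 0.
  (* the direction pi / 6, symmetric to the direction - pi / 2 *)
  have E1 : expi (pi / 6 : R) = (Num.sqrt 3 / 2) +i* (1 / 2) by rewrite /expi cos_pi6 sin_pi6.
  have E2 : expi (- (pi / 6) - pi / 3 : R) = 0 +i* (- 1).
    rewrite /expi; have -> : - (pi / 6) - pi / 3 = - (pi / 2) :> R by field.
    by rewrite cosN sinN cos_pihalf sin_pihalf.
  have X1 : x = (- height x 2)%:C * expi (pi / 6).
    apply: height_inj => m; rewrite E1; have sm := height_sum x.
    have e : Num.sqrt 3 * (height x 2 * (Num.sqrt 3 / 2)) = 3 / 2 * height x 2.
      by transitivity ((Num.sqrt 3 : R) ^+ 2 / 2 * height x 2); [field|rewrite s].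
    case: (ord3_cases m) => ->; rewrite [RHS]/height /=; move: (height x 0) (height x 1) (height x 2) e sm h01 h2 => a b d e sm h01 h2.
    - by lra.
    - by lra.
    - by lra.
  have X2 : rotl 1 x = (- height x 2)%:C * expi (- (pi / 6) - pi / 3).
    apply: height_inj => m; rewrite E2 height_rotl; have sm := height_sum x.
    by case: (ord3_cases m) => ->; rewrite ?add3E [RHS]/height /=;
      move: (height x 0) (height x 1) (height x 2) sm h01 h2 => a b d sm h01 h2; lra.
  rewrite X2 -c_symmetric ?oppr_gt0 -?X1//; apply/andP; split; lra.
(* the direction 7 pi / 6, symmetric to the direction pi / 2 *)
have E1 : expi (7 * pi / 6 : R) = (- (Num.sqrt 3 / 2)) +i* (- (1 / 2)).
  rewrite /expi; have -> : 7 * pi / 6 = pi / 6 + pi :> R by field.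
  by rewrite cosDpi sinDpi cos_pi6 sin_pi6.
have E2 : expi (- (7 * pi / 6) - pi / 3 : R) = 0 +i* 1.
  rewrite /expi; have -> : - (7 * pi / 6) - pi / 3 = - (pi / 2 + pi) :> R by field.
  by rewrite cosN sinN cosDpi sinDpi cos_pihalf sin_pihalf oppr0 opprK.
have X1 : x = (height x 2)%:C * expi (7 * pi / 6).
  apply: height_inj => m; rewrite E1; have sm := height_sum x.
  have e : Num.sqrt 3 * (height x 2 * (Num.sqrt 3 / 2)) = 3 / 2 * height x 2.
    by transitivity ((Num.sqrt 3 : R) ^+ 2 / 2 * height x 2); [field|rewrite s].
  case: (ord3_cases m) => ->; rewrite [RHS]/height /=; move: (height x 0) (height x 1) (height x 2) e sm h01 h2 => a b d e sm h01 h2.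
  - by lra.
  - by lra.
  - by lra.
have X2 : rotl 1 x = (height x 2)%:C * expi (- (7 * pi / 6) - pi / 3).
  apply: height_inj => m; rewrite E2 height_rotl; have sm := height_sum x.
  by case: (ord3_cases m) => ->; rewrite ?add3E [RHS]/height /=;
    move: (height x 0) (height x 1) (height x 2) sm h01 h2 => a b d sm h01 h2; lra.
rewrite X2 -c_symmetric -?X1//; [apply/andP; split; lra|by rewrite lt0r x0].
Qed.

Lemma cost_tie l x : triangle x -> height x l = height x (l + 1) -> cost c l x = cost c (l + 1) x.
Proof.
move=> tx h; have := @cost_tie01 (rotl l x).
rewrite triangle_rotl !height_rotl !cost_rotl !addr0; exact.
Qed.

Lemma cost_lt l m x : triangle x -> height x m < height x l -> cost c l x < cost c m x.
Proof.
move=> tx h; have := @c_bin1 (rotl l x) (m - l).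
rewrite triangle_rotl dist_bin_lt !height_rotl !cost_rotl addr0 addrCA subrr addr0.
apply => //; rewrite subr_eq0; apply/eqP => ml; move: h; by rewrite ml ltxx.
Qed.

(** The cost of a point is monotone in the distance to the bin: strictly by
    assumption (a) transported by rotation, and with equality in case of
    ties by assumption (b). *)
Lemma cost_le l m x : height x m <= height x l -> cost c l x <= cost c m x.
Proof.
have [tx|tx] := pselect (triangle x); last by rewrite !cost_out.
rewrite le_eqVlt => /orP[/eqP e|/(cost_lt tx)/ltW//].
have [->//|ml] := eqVneq m l.
have : m = l + 1 \/ l = m + 1.
  by move: ml; case: (ord3_cases l) => ->; case: (ord3_cases m) => ->; rewrite ?add3E //= => _;
    [left|right|right|left|left|right].
case=> E; first by rewrite E (cost_tie tx)// -E.
by rewrite E -(cost_tie tx)// -E.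
Qed.

End costs.

(** * Moments of the contributions of a point *)

Section moments.
Context {R : realType}.
Local Notation C := R[i].
Variable c : C -> R.
Hypothesis c_measurable : measurable_fun triangle c.
Hypothesis c_ge0 : forall x, triangle x -> 0 <= c x.
Hypothesis c_bounded : exists M : R, forall x, triangle x -> c x <= M.
Implicit Types x z : C.

Lemma measurable_set0C : measurable [set 0 : C].
Proof.
exists [set (0, 0)]; last by rewrite setTI; apply/seteqP; split=> -[a b] /= [-> ->].
rewrite (_ : [set _] = [set 0] `*` [set 0]); first exact: measurableX.
by apply/seteqP; split=> -[a b] /= [-> ->].
Qed.

(** The load that [x] causes at bin [l] in the suboptimal assignment. *)
Definition contribution (l : 'I_3) x : R := (in_cell l x)%:R * cost c l x.

Lemma bmeas_contribution l : bmeas (contribution l).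
Proof.
apply: bmeasM; last exact: bmeas_cost.
split; last by exists 1 => x; rewrite ger0_norm// lern1 leq_b1.
have -> : (fun x => (in_cell l x)%:R) = \1_[set z : C | in_cell l z] :> (C -> R).
  by apply/funext => x; rewrite indicE; congr (_%:R); congr nat_of_bool; apply/idP/idP; rewrite inE.
exact/measurable_indicP/measurable_in_cell.
Qed.

Lemma contribution_rotl l x : x <> 0 -> contribution l x = contribution 0 (rotl l x).
Proof. by move=> x0; rewrite /contribution in_cell_rotl// cost_rotl addr0. Qed.

Lemma contribution_cell0 x : contribution 0 x = (c \_ (cell ord0)) x.
Proof.
rewrite /contribution patchE; have [h|h] := boolP (in_cell 0 x).
  by rewrite mul1r ifT ?inE; [rewrite cost_triangle//; exact: in_cell_triangle h|exact/cellE].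
rewrite mul0r ifF//; apply/negbTE; rewrite notin_setE => /cellE h'.
by move: h; rewrite h'.
Qed.

Lemma contribution_out l x : ~ triangle x -> contribution l x = 0.
Proof. by move=> tx; rewrite /contribution cost_out// mulr0. Qed.

(** By rotation the contributions have the same distribution for all bins.
    The centre is an exception to the symmetry of the cells, but has area 0. *)
Lemma area_contribution (g : R -> R) l : measurable_fun setT g -> g 0 = 0 ->
  \int[area]_x g (contribution l x) = \int[area]_(x in cell ord0) g (c x).
Proof.
move=> mg g0.
have mh m : measurable_fun setT (fun x => g (contribution m x)).
  by apply: measurableT_comp => //; exact: (bmeas_contribution m).1.
transitivity (\int[area]_x g (contribution 0 (rotl l x))).
  congr fine; apply: ae_eq_integral => //.
  - exact/measurable_EFinP.
  - apply/measurable_EFinP; apply: (measurableT_comp (mh 0)); exact: measurable_rotl.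
  - exists [set 0]; split; [exact: measurable_set0C|exact: area_set0|].
    move=> x /= h; apply: contrapT => x0; apply: h => _.
    by rewrite contribution_rotl.
rewrite (same_law_Exp (@measurable_rotl R l) (@measurable_id _ C setT) (area_rotl l) (mh 0)).
rewrite [RHS]Rintegral_mkcond; apply: eq_Rintegral => x _.
by rewrite contribution_cell0 !patchE; case: ifP.
Qed.

Context d (Omega : measurableType d) (P : probability Omega R).
Variable X : {RV P >-> C}.
Hypothesis X_uniform : uniform_on triangle X.

Lemma uniform_law A : measurable A -> P (X @^-1` A) = area (triangle `&` A).
Proof.
move=> mA; have := X_uniform mA; rewrite area_triangle /distribution /pushforward => ->.
by rewrite inve1 mule1.
Qed.

(** Functions vanishing off the triangle have the same integral for the
    uniform law and for the area, since the triangle has area 1. *)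
Lemma uniform_Exp (f : C -> R) : measurable_fun setT f -> (forall x, ~ triangle x -> f x = 0) ->
  \int[P]_w f (X w) = \int[area]_x f x.
Proof.
move=> mf f0; have lw : same_law P X (distribution P X) (@id C) by [].
rewrite (same_law_Exp _ (@measurable_id _ C setT) lw mf)//.
have fT : EFin \o f = (EFin \o f) \_ triangle.
  apply/funext => x; rewrite patchE; case: ifPn => //=.
  by rewrite notin_setE => /f0 ->.
congr fine; transitivity (\int[distribution P X]_(x in triangle) (f x)%:E)%E.
  by rewrite [RHS]integral_mkcond -fT.
transitivity (\int[area]_(x in triangle) (f x)%:E)%E; last first.
  by rewrite [LHS]integral_mkcond -fT.
apply: eq_measure_integral => A mA AT.
by transitivity (area (triangle `&` A)); [exact: uniform_law|rewrite setIidr].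
Qed.

Lemma contribution_mean l : \int[P]_w contribution l (X w) = \int[area]_(x in cell ord0) c x.
Proof.
rewrite uniform_Exp; [|exact: (bmeas_contribution l).1|exact: contribution_out].
exact: (area_contribution (g := id)).
Qed.

(** The cells are disjoint, so products of different contributions vanish. *)
Lemma contribution_cov l m : \int[P]_w (contribution l (X w) * contribution m (X w)) =
  (l == m)%:R * \int[area]_(x in cell ord0) c x ^+ 2.
Proof.
have [<-|lm] := eqVneq l m; rewrite ?mul1r ?mul0r; last first.
  rewrite -[RHS](Exp_cst P); apply: eq_Rintegral => w _.
  rewrite /contribution; case: (boolP (in_cell l (X w))) => h; last by rewrite !mul0r.
  case: (boolP (in_cell m (X w))) => h'; last by rewrite mul0r mulr0.
  by move: lm; rewrite (in_cell_uniq h h') eqxx.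
have mg : measurable_fun setT (fun r : R => r ^+ 2) by apply: measurable_funX; exact: measurable_id.
rewrite -(area_contribution l mg (expr0n R 2)).
rewrite -(uniform_Exp (f := fun x => contribution l x ^+ 2)); last 2 first.
- by apply: measurable_funX; exact: (bmeas_contribution l).1.
- by move=> x tx; rewrite contribution_out// expr0n.
by apply: eq_Rintegral => w _; rewrite expr2.
Qed.

End moments.

(** * Rebalancing an assignment *)

Section rebalancing.
Context {R : realType}.

(** The points of [M l m] are moved from [l] to [m]. Each point is moved at
    most once, because the sets are disjoint. *)
Lemma rebalance n (w : 'I_n -> 'I_3 -> R) (a0 : 'I_n -> 'I_3) (M : 'I_3 -> 'I_3 -> {set 'I_n}) :
  (forall l m k, k \in M l m -> a0 k = l) ->
  (forall l m m' k, k \in M l m -> k \in M l m' -> m = m') ->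
  exists a : 'I_n -> 'I_3, forall l,
    \sum_(k < n) (a k == l)%:R * w k l = \sum_(k < n) (a0 k == l)%:R * w k l
      - \sum_(m < 3) \sum_(k in M l m) w k l + \sum_(m < 3) \sum_(k in M m l) w k l.
Proof.
move=> Ma0 Mu.
exists (fun k => odflt (a0 k) [pick m | k \in M (a0 k) m]) => l.
rewrite (exchange_big_dep predT)//= [X in _ + X](exchange_big_dep predT)//=.
rewrite -sumrB -big_split /=; apply: eq_bigr => k _.
rewrite big_mkcond [X in _ + X]big_mkcond /=.
case: pickP => /= [m km|km].
  rewrite (bigD1 m)//= big1 ?addr0; last first.
    move=> m' m'm; case: ifP => // h; have e := Ma0 _ _ _ h.
    by move: m'm; rewrite e in km; rewrite (Mu _ _ _ _ h km) eqxx.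
  rewrite (bigD1 (a0 k))//= big1 ?addr0; last first.
    by move=> m' m'k; case: ifP => // h; move: m'k; rewrite -(Ma0 _ _ _ h) eqxx.
  have -> : k \in M l m = (a0 k == l).
    by apply/idP/eqP => [/Ma0//|<-].
  have -> : k \in M (a0 k) l = (m == l).
    by apply/idP/eqP => [h|<-//]; exact: Mu km h.
  by case: eqP; case: eqP; rewrite ?mul1r ?mul0r => *; lra.
rewrite big1; last first.
  by move=> m _; case: ifP => // h; have := km m; rewrite (Ma0 _ _ _ h) h.
rewrite big1 ?subr0 ?addr0// => m _; case: ifP => // h.
by have := km l; rewrite (Ma0 _ _ _ h) h.
Qed.

Lemma subset_of_card (T : finType) (B : {set T}) t : (t <= #|B|)%N ->
  exists2 M : {set T}, M \subset B & #|M| = t.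
Proof.
move=> tB; exists [set k in take t (enum B)]%SET.
  by apply/fintype.subsetP => k; rewrite inE => /mem_take; rewrite mem_enum.
rewrite cardsE; have /card_uniqP -> : uniq (take t (enum B)) by rewrite take_uniq// enum_uniq.
by rewrite size_takel// -cardE.
Qed.

(** Moving (S l - S m) / (3 c0) points from [l] to [m] whenever this number
    is positive corrects the load of [l] by its distance to the mean, as the
    sum over [m] of (S l - S m) / 3 is S l - s. Rounding costs at most [c0]
    for each of the two other bins, and each moved point an error [eps]. *)
Lemma rebalance_load n (w : 'I_n -> 'I_3 -> R) (a0 : 'I_n -> 'I_3)
    (B : 'I_3 -> 'I_3 -> {set 'I_n}) (c0 eps : R) :
  0 < c0 -> 0 <= eps ->
  (forall l m k, l != m -> k \in B l m ->
     [/\ a0 k = l, `|w k l - c0| <= eps & `|w k m - c0| <= eps]) ->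
  (forall l m m' k, l != m -> l != m' -> k \in B l m -> k \in B l m' -> m = m') ->
  let S l := \sum_(k < n) (a0 k == l)%:R * w k l in
  let s := (\sum_(l < 3) S l) / 3 in
  let D := \sum_(l < 3) `|S l - s| in
  (forall l m, l != m -> D / (3 * c0) <= #|B l m|%:R) ->
  exists a : 'I_n -> 'I_3, forall l,
    \sum_(k < n) (a k == l)%:R * w k l <= s + 2 * c0 + eps / c0 * D.
Proof.
move=> c00 eps0 hB uB S s D hD.
pose dlt l m := (S l - S m) / (3 * c0).
pose t l m : nat := if l == m then 0 else Num.truncn (dlt l m).
have dD l m : `|dlt l m| <= D / (3 * c0).
  rewrite normrM normfV (gtr0_norm (_ : 0 < 3 * c0)) ?mulr_gt0// ler_pM2r ?invr_gt0 ?mulr_gt0//.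
  have [->|lm] := eqVneq l m; first by rewrite subrr normr0 sumr_ge0.
  rewrite /D (bigD1 l)//= (bigD1 m) 1?eq_sym//= addrA.
  have -> : S l - S m = (S l - s) - (S m - s) by ring.
  by apply: le_trans (ler_normB _ _) _; rewrite lerDl sumr_ge0.
have truncn_lt0 (x : R) : x < 0 -> Num.truncn x = 0%N by move=> x0; apply/truncn0Pn; rewrite -ltNge; lra.
have tle l m : (t l m)%:R <= `|dlt l m|.
  rewrite /t; case: ifP => // _.
  have [h|h] := leP 0 (dlt l m); first by rewrite ger0_norm// truncn_le.
  by rewrite truncn_lt0.
have /boolp.choice[M hM] : forall p : 'I_3 * 'I_3, exists A : {set 'I_n},
    A \subset (if p.1 == p.2 then finset.set0 else B p.1 p.2) /\ #|A| = t p.1 p.2.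
  move=> [l m] /=; have [] := @subset_of_card _ (if l == m then finset.set0 else B l m) (t l m).
    case: eqVneq => [->|lm]; first by rewrite /t eqxx.
    rewrite -(ler_nat R); apply: le_trans (hD _ _ lm); apply: le_trans (dD l m).
    exact: tle.
  by move=> A A1 A2; exists A.
have MB l m k : k \in M (l, m) -> l != m /\ k \in B l m.
  have [/fintype.subsetP h _] := hM (l, m); move=> /h /=.
  by case: eqVneq => [_|lm]; rewrite ?inE.
have [a ha] := @rebalance n w a0 (fun l m => M (l, m))
  (fun l m k h => let: conj lm kB := MB l m k h in let: And3 e _ _ := hB l m k lm kB in e)
  (fun l m m' k h h' => let: conj lm kB := MB l m k h in let: conj lm' kB' := MB l m' k h' in
     uB l m m' k lm lm' kB kB').
exists a => l; rewrite ha -/(S l) -addrA -sumrN -big_split /=.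
have key m : - \sum_(k in M (l, m)) w k l + \sum_(k in M (m, l)) w k l <=
    - ((S l - S m) / 3) + (l != m)%:R * c0 + eps / c0 * D / 3.
  have h1 : (t l m)%:R * (c0 - eps) <= \sum_(k in M (l, m)) w k l.
    have [_ <-] := hM (l, m); rewrite mulr_natl -sumr_const; apply: ler_sum => k /MB[lm kB].
    by have [_ + _] := hB _ _ _ lm kB; rewrite ler_norml => /andP[? _]; lra.
  have h2 : \sum_(k in M (m, l)) w k l <= (t m l)%:R * (c0 + eps).
    have [_ <-] := hM (m, l); rewrite mulr_natl -sumr_const; apply: ler_sum => k /MB[lm kB].
    by have [_ _ +] := hB _ _ _ lm kB; rewrite ler_norml => /andP[_ ?]; lra.
  have h3 : (t l m)%:R + (t m l)%:R <= D / (3 * c0).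
    have := dD l m; have := tle l m; have := tle m l.
    have dN : dlt m l = - dlt l m by rewrite /dlt; field; rewrite gt_eqF.
    rewrite dN normrN; have [->|lm] := eqVneq l m; first by rewrite /t eqxx addr0; lra.
    rewrite /t [m == l]eq_sym (negbTE lm) dN => h4 h5 h6.
    have [h|h|h] := ltgtP (dlt l m) 0.
    - by rewrite truncn_lt0// add0r; exact: le_trans h6.
    - by rewrite [X in _ + X%:R]truncn_lt0 ?addr0 ?oppr_lt0//; exact: le_trans h6.
    - by move: h6; rewrite h oppr0 truncn0 addr0 normr0.
  have h4 : dlt l m - (l != m)%:R <= (t l m)%:R - (t m l)%:R.
    have [->|lm] := eqVneq l m; first by rewrite /t eqxx /dlt subrr mul0r /= !mulr0n subrr.
    rewrite /t [m == l]eq_sym (negbTE lm) /=.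
    have -> : dlt m l = - dlt l m by rewrite /dlt; field; rewrite gt_eqF.
    have [h|h] := leP 0 (dlt l m).
      have := truncnS_gt (dlt l m); rewrite -natr1.
      have [->|ne] := eqVneq (dlt l m) 0; first by rewrite oppr0 truncn0; lra.
      by rewrite (truncn_lt0 (- dlt l m)) ?oppr_lt0 ?lt_def ?ne//; lra.
    rewrite truncn_lt0//.
    have : (Num.truncn (- dlt l m))%:R <= - dlt l m by rewrite truncn_le; lra.
    lra.
  have h5 : eps * ((t l m)%:R + (t m l)%:R) <= eps * (D / (3 * c0)) by exact: ler_wpM2l.
  have h6 : c0 * (dlt l m - (l != m)%:R) <= c0 * ((t l m)%:R - (t m l)%:R) by rewrite ler_pM2l.
  have e1 : c0 * dlt l m = (S l - S m) / 3 by rewrite /dlt; field; rewrite gt_eqF.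
  have e2 : eps * (D / (3 * c0)) = eps / c0 * D / 3 by field; rewrite gt_eqF.
  rewrite e2 in h5; rewrite mulrBr e1 in h6.
  move: h1 h2 h5 h6; clear; lra.
apply: le_trans (lerD (lexx _) (ler_sum _ (fun m _ => key m))) _.
rewrite !big_split /= sumrN !sumr_const card_ord -mulr_suml sumrB sumr_const card_ord.
have -> : \sum_(m < 3) (l != m)%:R * c0 = 2 * c0.
  by rewrite !big_ord_recl big_ord0; case: (ord3_cases l) => -> /=; ring.
have sE : \sum_(m < 3) S m = 3 * s by rewrite /s; field.
rewrite sE; lra.
Qed.

End rebalancing.

Section loads.
Context {R : realType}.
Local Notation C := R[i].
Variable c : C -> R.
Hypothesis c_ge0 : forall x, triangle x -> 0 <= c x.
Implicit Types (x : nat -> C) (n : nat).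

Definition total_load x n (l : 'I_3) : R := \sum_(k < n) contribution c l (x k).
Definition mean_load x n : R := (\sum_(l < 3) total_load x n l) / 3.

Lemma suboptimal_loadE x n : suboptimal_load c x n = max3 (total_load x n).
Proof.
rewrite /suboptimal_load /load; congr max3; apply/funext => l.
apply: eq_bigr => k _; rewrite mxE /contribution; congr (_%:R * _); congr nat_of_bool.
by apply/asboolP/idP => /cellE.
Qed.

Lemma contribution_ge0 l y : 0 <= contribution c l y.
Proof. by rewrite mulr_ge0// cost_ge0. Qed.

Definition assignment_mx n (a : 'I_n -> 'I_3) : 'M[bool]_(n, 3) := \matrix_(k, l) (a k == l).

Lemma assignment_mxP n (a : 'I_n -> 'I_3) : assignment_mx a \in assignments n.
Proof.
apply/forallP => k; rewrite (bigD1 (a k))//= mxE eqxx big1// => l la.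
by rewrite mxE eq_sym (negbTE la).
Qed.

Lemma load_assignment x n (a : 'I_n -> 'I_3) :
  load c x (assignment_mx a) = max3 (fun l => \sum_(k < n) (a k == l)%:R * cost c l (x k)).
Proof. by congr max3; apply/funext => l; apply: eq_bigr => k _; rewrite mxE. Qed.

Lemma optimal_load_le x n (a : 'I_n -> 'I_3) :
  optimal_load c x n <= max3 (fun l => \sum_(k < n) (a k == l)%:R * cost c l (x k)).
Proof.
by rewrite -load_assignment; apply: bigmin_le_cond; exact: assignment_mxP.
Qed.

(** The default value matters only off the triangle, where all costs vanish. *)
Definition nearest (y : C) : 'I_3 := odflt ord0 [pick l | in_cell l y].

Lemma nearestE l y : (nearest y == l)%:R * cost c l y = contribution c l y.
Proof.
rewrite /contribution; have [ty|ty] := pselect (triangle y); last by rewrite cost_out// !mulr0.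
congr (_%:R * _); congr nat_of_bool; rewrite /nearest; case: pickP => /= [m h|h].
  by apply/eqP/idP => [<-//|h']; exact: in_cell_uniq h h'.
by have [m hm] := in_cell_exists ty; move: (h m); rewrite hm.
Qed.

Lemma nearest_in_cell l y : in_cell l y -> nearest y = l.
Proof.
move=> h; rewrite /nearest; case: pickP => /= [m h'|h']; first exact: in_cell_uniq h' h.
by move: (h' l); rewrite h.
Qed.

Lemma optimal_load_le_suboptimal x n : optimal_load c x n <= suboptimal_load c x n.
Proof.
apply: le_trans (optimal_load_le x (fun k : 'I_n => nearest (x k))) _.
rewrite suboptimal_loadE; under [X in max3 X]eq_fun do under eq_bigr do rewrite nearestE.
exact: lexx.
Qed.

Hypothesis c_bin1 : forall (x : C) (l : 'I_3), triangle x -> l != ord0 ->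
  normc (x - bin ord0) < normc (x - bin l) -> cost c ord0 x < cost c l x.
Hypothesis c_symmetric : forall theta t : R, 0 <= theta <= 2 * pi -> 0 < t ->
  triangle (t%:C * expi theta) ->
  c (t%:C * expi theta) = c (t%:C * expi (- theta - pi / 3)).

(** The maximum load is at least the average load, and a point pays at least
    its cost at the nearest bin, whatever the assignment. *)
Lemma mean_load_le_load x n (A : 'M[bool]_(n, 3)) : A \in assignments n ->
  mean_load x n <= load c x A.
Proof.
move=> /forallP hA; rewrite /mean_load ler_pdivrMr//.
apply: (@le_trans _ _ (\sum_(l < 3) \sum_(k < n) (A k l)%:R * cost c l (x k))); last first.
  rewrite mulr_natr -[in leRHS](card_ord 3) -sumr_const; apply: ler_sum => l _.
  exact: (max3_ge (fun l => \sum_(k < n) (A k l)%:R * cost c l (x k))).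
rewrite exchange_big [leRHS]exchange_big; apply: ler_sum => k _ /=.
have [m hm] : exists m, A k m.
  apply: contrapT => h; have := hA k; rewrite big1// => m _.
  by case: (A k m) (contra_not (ex_intro (fun m => A k m) m) h) => // /(_ isT).
apply: (@le_trans _ _ (cost c m (x k))); last first.
  rewrite (bigD1 m)//= hm mul1r lerDl; apply: sumr_ge0 => l _.
  by rewrite mulr_ge0// cost_ge0.
have -> : \sum_(l < 3) contribution c l (x k) = cost c (nearest (x k)) (x k).
  under eq_bigr do rewrite -nearestE.
  rewrite (bigD1 (nearest (x k)))//= eqxx mul1r big1 ?addr0// => l lx.
  by rewrite eq_sym (negbTE lx) mul0r.
have [ty|ty] := pselect (triangle (x k)); last by rewrite !cost_out.
apply: cost_le => //; rewrite /nearest; case: pickP => /= [l h|h]; first exact: in_cell_max.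
by have [l hl] := in_cell_exists ty; move: (h l); rewrite hl.
Qed.

Lemma mean_load_le_optimal x n : mean_load x n <= optimal_load c x n.
Proof.
apply: le_bigmin => [|A]; last exact: mean_load_le_load.
apply: mean_load_le_load.
have -> : \matrix_(k < n, l < 3) (l == ord0) = assignment_mx (fun _ : 'I_n => ord0).
  by apply/matrixP => k l; rewrite !mxE eq_sym.
exact: assignment_mxP.
Qed.

End loads.

Section swapping.
Context {R : realType}.
Local Notation C := R[i].
Variable c : C -> R.
Hypothesis c_ge0 : forall x, triangle x -> 0 <= c x.
Implicit Types (x : nat -> C) (n : nat).

(** On such a region a point can be moved from [l] to [m] at a price known
    up to [eps]. The last clause keeps the regions of one cell disjoint, so
    that each point is moved at most once. *)
Definition swap_sets (c0 eps : R) (D : 'I_3 -> 'I_3 -> set C) : Prop :=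
  [/\ forall l m, measurable (D l m),
      forall l m y, l != m -> D l m y ->
        [/\ in_cell l y, `|cost c l y - c0| <= eps & `|cost c m y - c0| <= eps] &
      forall l m m' y, l != m -> l != m' -> D l m y -> D l m' y -> m = m'].

Definition load_dev x n (l : 'I_3) : R := total_load c x n l - mean_load c x n.

Definition count_dev (D : set C) (r : R) x n : R := \sum_(k < n) (\1_D (x k) - r).

Lemma sqr_sum3 (u : 'I_3 -> R) :
  (\sum_(l < 3) `|u l|) ^+ 2 <= 3 * \sum_(l < 3) u l ^+ 2.
Proof.
have h l : u l ^+ 2 = `|u l| ^+ 2 by rewrite real_normK ?num_real.
under [X in _ <= _ * X]eq_bigr do rewrite h.
rewrite !big_ord_recl !big_ord0 !addr0.
move: `|u _| `|u _| `|u _| => a b d.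
have := sqr_ge0 (a - b); have := sqr_ge0 (a - d); have := sqr_ge0 (b - d).
lra.
Qed.

Lemma suboptimal_load_le x n :
  suboptimal_load c x n <= mean_load c x n + \sum_(l < 3) `|load_dev x n l|.
Proof.
rewrite suboptimal_loadE; apply/max3_leP => l.
rewrite -lerBlDl; apply: le_trans (ler_norm _) _.
by rewrite (bigD1 l)//= lerDl sumr_ge0.
Qed.

Lemma total_load_le (M : R) x n l : (forall m y, cost c m y <= M) -> 0 <= total_load c x n l <= M * n%:R.
Proof.
move=> cM; apply/andP; split; first by apply: sumr_ge0 => k _; exact: contribution_ge0.
rewrite mulr_natr -[in leRHS](card_ord n) -sumr_const; apply: ler_sum => k _.
apply: le_trans (cM l (x k)); rewrite /contribution; case: (in_cell _ _); rewrite ?mul1r// mul0r.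
exact: cost_ge0.
Qed.

Lemma load_dev_le (M : R) x n : (forall m y, cost c m y <= M) ->
  \sum_(l < 3) `|load_dev x n l| <= 3 * M * n%:R.
Proof.
move=> cM; have h l := total_load_le x n l cM.
have -> : 3 * M * n%:R = \sum_(l < 3) M * n%:R by rewrite sumr_const card_ord; ring.
apply: ler_sum => l _; rewrite /load_dev /mean_load !big_ord_recl big_ord0.
have /andP[a1 a2] := h l; have /andP[b1 b2] := h ord0.
have /andP[d1 d2] := h (lift ord0 ord0); have /andP[e1 e2] := h (lift ord0 (lift ord0 ord0)).
by rewrite ler_norml; apply/andP; split; lra.
Qed.

(** If every region contains enough points, the loads are evened out by
    [rebalance_load]. Otherwise the optimal load is bounded by the
    suboptimal one, hence by the imbalance; this case requires that a count
    deviates from its mean by the order of [n], or that the imbalance is of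
    order [n], and the last two terms are Chebyshev bounds for these events. *)
Lemma optimal_load_upper (M c0 eps p : R) (D : 'I_3 -> 'I_3 -> set C) (r : 'I_3 -> 'I_3 -> R) x n :
  (forall m y, cost c m y <= M) -> 0 < c0 -> 0 <= eps -> 0 < p -> swap_sets c0 eps D ->
  (forall l m, l != m -> p <= r l m) -> (0 < n)%N ->
  optimal_load c x n - mean_load c x n <= 2 * c0
    + eps / c0 * (Num.sqrt n%:R + 3 * (\sum_(l < 3) load_dev x n l ^+ 2) / Num.sqrt n%:R)
    + 12 * M / p ^+ 2 * (\sum_(l < 3) \sum_(m < 3) count_dev (D l m) (r l m) x n ^+ 2) / n%:R
    + 2 / (c0 * p) * (\sum_(l < 3) load_dev x n l ^+ 2) / n%:R.
Proof.
move=> cM c00 eps0 p0 [_ D1 D2] rp n0.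
have N0 : 0 < n%:R :> R by rewrite ltr0n.
have M0 : 0 <= M by apply: le_trans (cM ord0 0); exact: cost_ge0.
set Q := \sum_(l < 3) load_dev x n l ^+ 2.
set Q2 := \sum_(l < 3) \sum_(m < 3) _.
set s := mean_load c x n.
have q0 : 0 < Num.sqrt n%:R :> R by rewrite sqrtr_gt0.
have qq : Num.sqrt n%:R ^+ 2 = n%:R :> R by rewrite sqr_sqrtr// ltW.
have Q0 : 0 <= Q by apply: sumr_ge0 => l _; exact: sqr_ge0.
have Q20 : 0 <= Q2 by apply: sumr_ge0 => l _; apply: sumr_ge0 => m _; exact: sqr_ge0.
pose spread := \sum_(l < 3) `|load_dev x n l|.
have sQ : spread ^+ 2 <= 3 * Q := sqr_sum3 _.
have s0 : 0 <= spread by exact: sumr_ge0.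
have sM : spread <= 3 * M * n%:R := load_dev_le x n cM.
have t1 : 0 <= eps / c0 * (Num.sqrt n%:R + 3 * Q / Num.sqrt n%:R).
  by rewrite mulr_ge0 ?addr_ge0 ?divr_ge0 ?mulr_ge0// ltW.
have t2 : 0 <= 12 * M / p ^+ 2 * Q2 / n%:R.
  apply: divr_ge0; last exact: ltW.
  by apply: mulr_ge0 => //; apply: divr_ge0; [exact: mulr_ge0|exact/ltW/exprn_gt0].
have t3 : 0 <= 2 / (c0 * p) * Q / n%:R.
  apply: divr_ge0; last exact: ltW.
  by apply: mulr_ge0 => //; apply: divr_ge0 => //; apply: mulr_ge0; exact: ltW.
have SE l : \sum_(k < n) (nearest (x k) == l)%:R * cost c l (x k) = total_load c x n l.
  by apply: eq_bigr => k _; exact: nearestE.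
pose B l m : {set 'I_n} := [set k : 'I_n | `[< D l m (x k) >]]%SET.
have [ok|] := pselect (forall l m, l != m -> spread / (3 * c0) <= #|B l m|%:R).
  have [|||a ha] := @rebalance_load R n (fun k l => cost c l (x k)) (fun k => nearest (x k)) B c0 eps c00 eps0.
  - move=> l m k lm; rewrite inE => /asboolP /(D1 _ _ _ lm)[h1 h2 h3]; split=> //=.
    exact: nearest_in_cell.
  - move=> l m m' k lm lm'; rewrite !inE => /asboolP h /asboolP h'.
    exact: (D2 l m m' (x k) lm lm' (asboolW h) (asboolW h')).
  - have E : \sum_(l < 3) `|load_dev x n l| = \sum_(l < 3) `|\sum_(k < n) (nearest (x k) == l)%:R * cost c l (x k) -
        (\sum_(l < 3) \sum_(k < n) (nearest (x k) == l)%:R * cost c l (x k)) / 3|.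
      by apply: eq_bigr => l _; rewrite SE; under [X in _ - X / 3]eq_bigr do rewrite SE.
    by move=> l m lm; rewrite -E; exact: ok.
  have sE : (\sum_(l < 3) \sum_(k < n) (nearest (x k) == l)%:R * cost c l (x k)) / 3 = s.
    by under eq_bigr do rewrite SE.
  have E : \sum_(l < 3) `|\sum_(k < n) (nearest (x k) == l)%:R * cost c l (x k) -
        (\sum_(l < 3) \sum_(k < n) (nearest (x k) == l)%:R * cost c l (x k)) / 3| = spread.
    by rewrite sE; apply: eq_bigr => l _; rewrite SE.
  have h : optimal_load c x n <= s + 2 * c0 + eps / c0 * spread.
    apply: le_trans (optimal_load_le c x a) _; apply/max3_leP => l.
    by apply: le_trans (ha l) _; rewrite E sE.
  have h2 : eps / c0 * spread <= eps / c0 * (Num.sqrt n%:R + 3 * Q / Num.sqrt n%:R).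
    apply: ler_wpM2l; first by rewrite divr_ge0// ltW.
    rewrite -(ler_pM2r q0) mulrDl divfK ?gt_eqF//.
    move: (sqr_ge0 (spread - Num.sqrt n%:R)) (sqr_ge0 (Num.sqrt n%:R : R)) sQ Q0; lra.
  by move: h h2 t2 t3; lra.
move=> /existsNP[l /existsNP[m /not_implyP[lm /negP]]]; rewrite -ltNge => fail.
have opt : optimal_load c x n - s <= spread.
  rewrite lerBlDl; apply: le_trans (optimal_load_le_suboptimal c x n) _.
  exact: suboptimal_load_le.
suff : spread <= 12 * M / p ^+ 2 * Q2 / n%:R + 2 / (c0 * p) * Q / n%:R by lra.
have dev : count_dev (D l m) (r l m) x n = #|B l m|%:R - n%:R * r l m.
  rewrite /count_dev sumrB sumr_const card_ord mulr_natl; congr (_ - _).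
  rewrite -sum1_card natr_sum [RHS]big_mkcond /=; apply: eq_bigr => k _.
  by rewrite indicE inE; case: asboolP => h; [rewrite mem_set|rewrite memNset].
have [lt|ge] := ltP (#|B l m|%:R : R) (n%:R * p / 2).
  suff : spread <= 12 * M / p ^+ 2 * Q2 / n%:R by lra.
  apply: (le_trans sM).
  have : (n%:R * p / 2) ^+ 2 <= Q2.
    rewrite /Q2 (bigD1 l)//= (bigD1 m)//= dev.
    have h1 : 0 <= \sum_(i < 3 | i != m) count_dev (D l i) (r l i) x n ^+ 2.
      by apply: sumr_ge0 => i _; exact: sqr_ge0.
    have h2 : 0 <= \sum_(i < 3 | i != l) \sum_(m < 3) count_dev (D i m) (r i m) x n ^+ 2.
      by apply: sumr_ge0 => i _; apply: sumr_ge0 => j _; exact: sqr_ge0.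
    have h3 : n%:R * p <= n%:R * r l m by rewrite ler_pM2l// rp.
    have h4 : 0 < n%:R * p by exact: mulr_gt0.
    have : (n%:R * p / 2) ^+ 2 <= (#|B l m|%:R - n%:R * r l m) ^+ 2.
      move: lt h3 h4; move: (n%:R * p) (n%:R * r l m) (#|B l m|%:R : R) => u v w; clear; nra.
    lra.
  move=> h; have e : 3 * M * n%:R = 12 * M / p ^+ 2 * (n%:R * p / 2) ^+ 2 / n%:R.
    by field; rewrite !gt_eqF.
  rewrite e ler_pM2r ?invr_gt0//; apply: ler_wpM2l => //.
  by apply: divr_ge0; [exact: mulr_ge0|exact/ltW/exprn_gt0].
suff : spread <= 2 / (c0 * p) * Q / n%:R by lra.
have e : 2 / (c0 * p) * Q / n%:R = (3 * Q) / (3 * c0 * (n%:R * p / 2)).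
  by field; rewrite !gt_eqF.
have pos : 0 < 3 * c0 * (n%:R * p / 2) by rewrite !mulr_gt0.
rewrite e ler_pdivlMr//; apply: le_trans sQ; rewrite expr2; apply: ler_wpM2l => //.
rewrite mulrC -ler_pdivlMr ?mulr_gt0//; exact/ltW/(le_lt_trans ge).
Qed.

End swapping.

(** * The optimal load is close to the mean load *)

Section rebalanced_expectation.
Context {R : realType}.
Local Notation C := R[i].
Variable c : C -> R.
Hypothesis c_measurable : measurable_fun triangle c.
Hypothesis c_ge0 : forall x, triangle x -> 0 <= c x.
Hypothesis c_bounded : exists M : R, forall x, triangle x -> c x <= M.
Context d (Omega : measurableType d) (P : probability Omega R).
Variable X : nat -> {RV P >-> C}.

Let x_ w k := X k w.

Lemma bmeas_total_load n l : bmeas (fun w => total_load c (x_ w) n l).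
Proof. by apply: bmeas_sum => k _; apply: bmeas_RV; exact: bmeas_contribution. Qed.

Lemma bmeas_mean_load n : bmeas (fun w => mean_load c (x_ w) n).
Proof.
apply: bmeasM; last exact: bmeas_cst.
by apply: bmeas_sum => l _; exact: bmeas_total_load.
Qed.

Lemma bmeas_load n A : bmeas (fun w => @load R c (x_ w) n A).
Proof.
apply: (@bmeas_max3 R d Omega (fun l w => \sum_(k < n) (A k l)%:R * cost c l (X k w))) => l.
apply: bmeas_sum => k _; apply: bmeasM; first exact: bmeas_cst.
by apply: bmeas_RV; exact: bmeas_cost.
Qed.

Lemma bmeas_optimal_load n : bmeas (fun w => optimal_load c (x_ w) n).
Proof. by apply: bmeas_bigmin => [|A _]; exact: bmeas_load. Qed.

Lemma bmeas_suboptimal_load n : bmeas (fun w => suboptimal_load c (x_ w) n).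
Proof.
under eq_fun do rewrite suboptimal_loadE.
by apply: (@bmeas_max3 R d Omega (fun l w => total_load c (x_ w) n l)) => l; exact: bmeas_total_load.
Qed.

Hypothesis X_independent : mutually_independent X.
Hypothesis X_uniform : forall k, uniform_on triangle (X k).

Lemma uniform_same_law k : same_law P (X k) P (X 0%N).
Proof.
move=> A mA; transitivity (area (triangle `&` A)); last exact/esym/(uniform_law (X_uniform 0) mA).
exact: (uniform_law (X_uniform k) mA).
Qed.

Lemma uniform_Exp0 k (u : C -> R) : measurable_fun setT u ->
  \int[P]_w u (X k w) = \int[P]_w u (X 0%N w).
Proof. by move=> mu; apply: same_law_Exp => //; exact: uniform_same_law. Qed.

Lemma sum_sqr_Exp (u : C -> R) n : bmeas u -> \int[P]_w u (X 0%N w) = 0 ->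
  \int[P]_w (\sum_(k < n) u (X k w)) ^+ 2 = n%:R * \int[P]_w u (X 0%N w) ^+ 2.
Proof.
move=> bu u0; apply: (sum_second_moment X_independent bu).
  by move=> k; rewrite uniform_Exp0//; exact: bu.1.
by move=> k; rewrite (uniform_Exp0 k (u := fun y => u y ^+ 2))//; apply: measurable_funX; exact: bu.1.
Qed.

Definition unbalance l y : R := contribution c l y - (\sum_(m < 3) contribution c m y) / 3.

Lemma bmeas_unbalance l : bmeas (unbalance l).
Proof.
apply: bmeasB; first exact: bmeas_contribution.
by apply: bmeasM; [apply: bmeas_sum => m _; exact: bmeas_contribution|exact: bmeas_cst].
Qed.

Lemma load_devE (x : nat -> C) n l : load_dev c x n l = \sum_(k < n) unbalance l (x k).
Proof. by rewrite /load_dev /mean_load /unbalance sumrB -mulr_suml exchange_big. Qed.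

Lemma L1_contribution l k : L1 P (fun w => contribution c l (X k w)).
Proof. by apply: bmeas_integrable; apply: bmeas_RV; exact: bmeas_contribution. Qed.

Lemma mean_contribution k : \int[P]_w ((\sum_(l < 3) contribution c l (X k w)) / 3) =
  \int[area]_(x in cell ord0) c x.
Proof.
under eq_Rintegral do rewrite mulrC.
rewrite RintegralZl//; last by apply: L1_sum => l; exact: L1_contribution.
rewrite Exp_sum; last by move=> l; exact: L1_contribution.
under eq_bigr do rewrite contribution_mean//.
by rewrite sumr_const card_ord; field.
Qed.

Lemma unbalance_mean l k : \int[P]_w unbalance l (X k w) = 0.
Proof.
rewrite RintegralB//; first by rewrite contribution_mean// mean_contribution subrr.
  exact: L1_contribution.
by apply: bmeas_integrable; apply: bmeasM; [apply: bmeas_sum => m _; apply: bmeas_RV; exact: bmeas_contribution|exact: bmeas_cst].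
Qed.

End rebalanced_expectation.

Section swapping_expectation.
Context {R : realType}.
Local Notation C := R[i].
Variable c : C -> R.
Hypothesis c_measurable : measurable_fun triangle c.
Hypothesis c_ge0 : forall x, triangle x -> 0 <= c x.
Hypothesis c_bounded : exists M : R, forall x, triangle x -> c x <= M.
Hypothesis c_bin1 : forall (x : C) (l : 'I_3), triangle x -> l != ord0 ->
  normc (x - bin ord0) < normc (x - bin l) -> cost c ord0 x < cost c l x.
Hypothesis c_symmetric : forall theta t : R, 0 <= theta <= 2 * pi -> 0 < t ->
  triangle (t%:C * expi theta) ->
  c (t%:C * expi theta) = c (t%:C * expi (- theta - pi / 3)).
Context d (Omega : measurableType d) (P : probability Omega R).
Variable X : nat -> {RV P >-> C}.
Hypothesis X_independent : mutually_independent X.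
Hypothesis X_uniform : forall k, uniform_on triangle (X k).

(** What the positivity and the continuity of the cost near the rays are
    used for. *)
Definition swappable : Prop := exists2 c0 : R, 0 < c0 & forall eps, 0 < eps ->
  exists (D : 'I_3 -> 'I_3 -> set C) (p : R), [/\ swap_sets c c0 eps D, 0 < p &
    forall l m, l != m -> (p%:E <= area (D l m))%E].

Let x_ w k := X k w.

Lemma load_dev_Exp n : \int[P]_w (\sum_(l < 3) load_dev c (x_ w) n l ^+ 2) =
  n%:R * \sum_(l < 3) \int[P]_w unbalance c l (X 0%N w) ^+ 2.
Proof.
have bu := bmeas_unbalance c_measurable c_ge0 c_bounded.
have E l w : load_dev c (x_ w) n l = \sum_(k < n) unbalance c l (X k w) by exact: load_devE.
rewrite Exp_sum; last first.
  move=> l; under [X in EFin \o X]eq_fun do rewrite E expr2.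
  by apply: bmeas_integrable; apply: bmeasM; apply: bmeas_sum => k _; exact: (bmeas_RV X k (bu l)).
rewrite mulr_sumr; apply: eq_bigr => l _; under eq_Rintegral do rewrite E.
apply: (sum_sqr_Exp X_independent X_uniform) => //.
exact: unbalance_mean.
Qed.

Lemma bmeas_indic (D : set C) (r : R) : measurable D -> bmeas (fun y => \1_D y - r).
Proof.
move=> mD; apply: bmeasB; last exact: bmeas_cst.
split; first exact: measurable_indic.
by exists 1 => y; rewrite indicE; case: (_ \in _); rewrite ?normr1 ?normr0.
Qed.

Lemma indic_Exp (D : set C) : measurable D ->
  \int[P]_w \1_D (X 0%N w) = fine (P (X 0%N @^-1` D)).
Proof.
move=> mD; congr fine.
have mX : measurable (X 0%N @^-1` D) by rewrite -[X in measurable X]setTI; exact: measurable_funPT.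
by transitivity (\int[P]_w (\1_(X 0%N @^-1` D) w)%:E)%E; [exact: eq_integral|rewrite integral_indic// setIT].
Qed.

Lemma count_dev_Exp (D : set C) n : measurable D ->
  let r := \int[P]_w \1_D (X 0%N w) in
  \int[P]_w count_dev D r (x_ w) n ^+ 2 = n%:R * \int[P]_w (\1_D (X 0%N w) - r) ^+ 2.
Proof.
move=> mD r; have bD := bmeas_indic r mD.
apply: (sum_sqr_Exp X_independent X_uniform _ bD).
have b1 : bmeas (fun w => \1_D (X 0%N w) : R).
  have := bmeas_RV X 0 (bmeas_indic 0 mD).
  by under [X in bmeas X]eq_fun do rewrite subr0.
rewrite RintegralB//; [|exact: bmeas_integrable|exact: L1_cst].
by rewrite Exp_cst subrr.
Qed.

(** In the bound of [optimal_load_upper], all sums have second moment of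
    order [n], so that after division by the square root of [n] only the
    term with [eps] persists, and [eps] is arbitrary. *)
Lemma optimal_near_mean : swappable ->
  \int[P]_w ((optimal_load c (x_ w) n - mean_load c (x_ w) n) / Num.sqrt n%:R)
    @[n --> \oo] --> 0.
Proof.
move=> [c0 c00 sw]; apply/cvgrPdist_le => e e0.
have bu := bmeas_unbalance c_measurable c_ge0 c_bounded.
pose q1 := \sum_(l < 3) \int[P]_w unbalance c l (X 0%N w) ^+ 2.
have q10 : 0 <= q1 by apply: sumr_ge0 => l _; apply: Rintegral_ge0 => w _; exact: sqr_ge0.
(* the contribution of [eps] to the final bound is then [e / 2] *)
pose eps := e * c0 / (2 * (1 + 3 * q1)).
have eps0 : 0 < eps by rewrite divr_gt0 ?mulr_gt0// ltr_wpDr// mulr_ge0.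
have [D [p [sD p0 pD]]] := sw eps eps0.
have [mD D1 _] := sD.
pose r l m := \int[P]_w \1_(D l m) (X 0%N w).
have rp l m : l != m -> p <= r l m.
  move=> lm; rewrite /r indic_Exp// -lee_fin fineK; last first.
    by apply: fin_num_measure; rewrite -[X in measurable X]setTI; exact: measurable_funPT.
  have -> : P (X 0%N @^-1` D l m) = area (D l m); last exact: pD.
  transitivity (area (triangle `&` D l m)); first exact: (uniform_law (X_uniform 0)).
  by rewrite setIidr// => y /(D1 _ _ _ lm)[/in_cell_triangle].
have [M M0 cM] := cost_le_bound c_bounded.
pose q2 := \sum_(l < 3) \sum_(m < 3) \int[P]_w (\1_(D l m) (X 0%N w) - r l m) ^+ 2.
pose K := 2 * c0 + 12 * M / p ^+ 2 * q2 + 2 / (c0 * p) * q1.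
have bound n : (0 < n)%N ->
    \int[P]_w ((optimal_load c (x_ w) n - mean_load c (x_ w) n) / Num.sqrt n%:R) <= e / 2 + K * (Num.sqrt n%:R)^-1.
  move=> n0; have N0 : 0 < n%:R :> R by rewrite ltr0n.
  have q0 : 0 < Num.sqrt n%:R :> R by rewrite sqrtr_gt0.
  have qq : Num.sqrt n%:R ^+ 2 = n%:R :> R by rewrite sqr_sqrtr// ltW.
  pose Q1 w := \sum_(l < 3) load_dev c (x_ w) n l ^+ 2.
  pose Q2 w := \sum_(l < 3) \sum_(m < 3) count_dev (D l m) (r l m) (x_ w) n ^+ 2.
  have bsqr (f : Omega -> R) : bmeas f -> bmeas (fun w => f w ^+ 2).
    by move=> bf; under eq_fun do rewrite expr2; exact: bmeasM.
  have bQ1 : bmeas Q1.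
    apply: bmeas_sum => l _; apply: bsqr; apply: bmeasB; [exact: bmeas_total_load|exact: bmeas_mean_load].
  have bdev l m : bmeas (fun w => count_dev (D l m) (r l m) (x_ w) n ^+ 2).
    by apply: bsqr; apply: bmeas_sum => k _; apply: (bmeas_RV X k (bmeas_indic _ (mD l m))).
  have bQ2 : bmeas Q2.
    by apply: bmeas_sum => l _; apply: bmeas_sum => m _; exact: bdev.
  have IQ1 : \int[P]_w Q1 w = n%:R * q1 by exact: load_dev_Exp.
  have IQ2 : \int[P]_w Q2 w = n%:R * q2.
    rewrite /Q2 Exp_sum; last by move=> l; apply: bmeas_integrable; apply: bmeas_sum => m _; exact: bdev.
    rewrite mulr_sumr; apply: eq_bigr => l _.
    rewrite Exp_sum; last by move=> m; exact: bmeas_integrable.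
    by rewrite mulr_sumr; apply: eq_bigr => m _; exact: count_dev_Exp.
  have bZ (a : R) (f : Omega -> R) : bmeas f -> bmeas (fun w => a * f w) by move=> bf; apply: bmeasM => //; exact: bmeas_cst.
  pose A1 := (2 * c0 + eps / c0 * Num.sqrt n%:R) / Num.sqrt n%:R.
  pose A2 := (eps / c0 * 3 / Num.sqrt n%:R + 2 / (c0 * p) / n%:R) / Num.sqrt n%:R.
  pose A3 := (12 * M / p ^+ 2 / n%:R) / Num.sqrt n%:R.
  apply: (@le_trans _ _ (\int[P]_w (A1 + A2 * Q1 w + A3 * Q2 w))).
    apply: le_Rintegral => //.
    - apply: bmeas_integrable; apply: bmeasM; last exact: bmeas_cst.
      by apply: bmeasB; [exact: bmeas_optimal_load|exact: bmeas_mean_load].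
    - apply: bmeas_integrable; apply: bmeasD; last exact: bZ.
      by apply: bmeasD; [exact: bmeas_cst|exact: bZ].
    - move=> w _; have := optimal_load_upper c_ge0 (x_ w) cM c00 (ltW eps0) p0 sD rp n0.
      rewrite -/(Q1 w) -/(Q2 w) => h.
      rewrite ler_pdivrMr//; apply: (le_trans h).
      rewrite le_eqVlt; apply/orP; left; apply/eqP; rewrite /A1 /A2 /A3.
      by field; rewrite !gt_eqF.
  have -> : \int[P]_w (A1 + A2 * Q1 w + A3 * Q2 w) = A1 + A2 * (n%:R * q1) + A3 * (n%:R * q2).
    rewrite RintegralD//; last 2 first.
    - by apply: bmeas_integrable; apply: bmeasD; [exact: bmeas_cst|exact: bZ].
    - by apply: bmeas_integrable; exact: bZ.
    rewrite RintegralD//; [|exact: L1_cst|by apply: bmeas_integrable; exact: bZ].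
    by rewrite Exp_cst !RintegralZl ?IQ1 ?IQ2//; exact: bmeas_integrable.
  rewrite le_eqVlt; apply/orP; left; apply/eqP; rewrite /A1 /A2 /A3 /K /eps.
  move: qq q0; set t := Num.sqrt n%:R => qq q0; rewrite -qq.
  by field; rewrite !gt_eqF// ltr_wpDr// mulr_ge0.
have e20 : 0 < e / 2 by lra.
have : K * (Num.sqrt (n%:R : R))^-1 @[n --> \oo] --> K * 0 by apply: cvgMr; exact: cvg_inv_sqrt.
rewrite mulr0 => /cvgrPdist_le /(_ _ e20) h.
near=> n; rewrite sub0r normrN ger0_norm; last first.
  apply: Rintegral_ge0 => w _; rewrite divr_ge0// subr_ge0.
  exact: mean_load_le_optimal.
apply: le_trans (bound n _) _; first by near: n; exact: nbhs_infty_gt.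
suff : K * (Num.sqrt n%:R)^-1 <= e / 2 by lra.
apply: le_trans (ler_norm _) _; rewrite -normrN -sub0r; near: n; exact: h.
Unshelve. all: by end_near.
Qed.

End swapping_expectation.

(** * Regions where points can be swapped between two bins *)

Section wedges.
Context {R : realType}.
Local Notation C := R[i].
Local Notation Re := complex.Re.
Local Notation Im := complex.Im.
Local Notation s3 := (Num.sqrt 3 : R).
Implicit Types y z p q : C.

Lemma normc_height_le (delta : R) y p : (forall k, `|height y k - height p k| <= delta) ->
  normc (y - p) <= 3 * delta.
Proof.
move=> h; have := h 0; have := h 1; have := h 2; rewrite /height /=.
have s0 := @sqrt3_gt1 R.
case: y h => a b h; case: p h => a' b' h /=; rewrite !ler_norml => /andP[h1 h2] /andP[h3 h4] /andP[h5 h6].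
have d0 : 0 <= delta by lra.
have r1 : `|a - a'| <= 2 * delta.
  have e : `|s3 * (a - a')| <= 2 * delta by rewrite ler_norml; apply/andP; split; lra.
  apply: le_trans e; rewrite normrM (gtr0_norm (_ : 0 < s3)); last lra.
  by rewrite ler_peMl// ltW.
have r2 : `|b - b'| <= delta by rewrite ler_norml; lra.
have d3 : 0 <= 3 * delta by lra.
rewrite -[leRHS]ger0_norm// -sqrtr_sqr; apply: ler_wsqrtr.
rewrite -(real_normK (num_real (a - a'))) -(real_normK (num_real (b - b'))).
move: r1 r2 (normr_ge0 (a - a')) (normr_ge0 (b - b')) d0.
move: `|a - a'| `|b - b'| => u v; clear; nra.
Qed.

Lemma height_lip (eta : R) y p k : `|Re y - Re p| <= eta -> `|Im y - Im p| <= eta ->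
  `|height y k - height p k| <= 2 * eta.
Proof.
have s1 := @sqrt3_gt1 R; have s2 := @sqrt3_lt2 R.
case: y => a b; case: p => a' b' /= h1 h2.
have e : `|s3 * (a - a')| <= 2 * eta.
  rewrite normrM (gtr0_norm (_ : 0 < s3)); last lra.
  by apply: ler_pM => //; lra.
move: e h1 h2; rewrite !ler_norml => /andP[? ?] /andP[? ?] /andP[? ?].
by rewrite /height; case: (ord3_cases k) => -> /=; apply/andP; split; lra.
Qed.

(** The part of the triangle close to [p] where bin [a] is nearest, then bin
    [b], then bin 2. *)
Definition wedge (p : C) (delta : R) (a b : 'I_3) : set C :=
  [set y | [/\ triangle y, height y 2 < height y b, height y b < height y a &
               forall k, `|height y k - height p k| <= delta]].

Lemma measurable_height_lt l m : measurable [set z : C | height z l < height z m].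
Proof.
have -> : [set z : C | height z l < height z m] = ~` [set z : C | height z m <= height z l].
  by apply/seteqP; split=> z /=; rewrite ltNge => /negP.
exact/measurableC/measurable_height_le.
Qed.

Lemma measurable_wedge p delta a b : measurable (wedge p delta a b).
Proof.
have -> : wedge p delta a b = triangle `&` [set y | height y 2 < height y b] `&` [set y | height y b < height y a]
    `&` \bigcap_(k in [set: 'I_3]) [set y | `|height y k - height p k| <= delta].
  by apply/seteqP; split=> y /=; [move=> [? ? ? h]; split=> // k _; exact: h|move=> [[[? ?] ?] h]; split=> // k; exact: h].
apply: measurableI; [apply: measurableI; [apply: measurableI; [exact: measurable_triangle|]|]|]; [exact: measurable_height_lt..|].
apply: fin_bigcap_measurable => // k _; rewrite -[X in measurable X]setTI.
apply: measurable_fun_ler => //; apply: measurableT_comp => //.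
by apply: measurable_funB => //; exact: measurable_height.
Qed.

(** The inequalities between heights near the point [q] of the next proof:
    [g] is the height of [p] towards the two nearest bins, and [sg] and [u]
    are the multiples by [s] of [g] and of [l]. *)
Lemma wedge_arith (l delta g sg u za zb z2 : R) :
  0 < u -> u <= delta / 4 -> 0 <= sg -> sg <= u / 4 -> 0 <= g - sg ->
  0 <= - 2 * g + 2 * sg + l / 2 - u / 2 ->
  `|za - (g - sg + u / 4)| <= u / 16 -> `|zb - (g - sg)| <= u / 16 ->
  `|z2 - (- 2 * g + 2 * sg - u / 4)| <= u / 16 ->
  [/\ z2 < zb, zb < za, - (l / 2) <= z2 &
      [/\ `|za - g| <= delta, `|zb - g| <= delta & `|z2 - - 2 * g| <= delta]].
Proof.
rewrite !ler_norml => h1 h2 h3 h4 h5 h6 /andP[h7 h8] /andP[h9 h10] /andP[h11 h12].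
by split; [lra|lra|lra|split; apply/andP; split; lra].
Qed.

(** Moving from [p] towards an interior point at which all inequalities are
    strict makes them strict, and they persist in a small square. *)
Lemma wedge_area_gt0 p (delta : R) (a b : 'I_3) :
  0 < delta -> triangle p -> height p 0 = height p 1 -> height p 2 <= 0 ->
  a = 0 /\ b = 1 \/ a = 1 /\ b = 0 -> (0 < area (wedge p delta a b))%E.
Proof.
move=> d0 /triangleP tp h01 h2 ab; have l0 := @lambda_gt0 R; have sp := height_sum p.
set l := lambda R in l0 tp.
have b1 : 0 < Num.min 1 (delta / (4 * l)) by rewrite lt_min ltr01 divr_gt0// mulr_gt0.
pose s := Num.min 1 (delta / (4 * l)).
have s1 : s <= 1 by rewrite ge_min lexx.
have sl : s * l <= delta / 4.
  have : s <= delta / (4 * l) by rewrite ge_min lexx orbT.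
  by rewrite ler_pdivlMr ?mulr_gt0// => ?; lra.
have s0 : 0 < s by [].
have sl0 : 0 < s * l by exact: mulr_gt0.
(* [q] divides the segment from [p] to the point of heights [l / 4], [0] and
   [- l / 4] towards [a], [b] and bin 2 in the ratio [s] to [1 - s] *)
have [q [qa qb q2]] : exists q, [/\ height q a = (1 - s) * height p 0 + s * l / 4,
   height q b = (1 - s) * height p 0 & height q 2 = (1 - s) * height p 2 - s * l / 4].
  pose g := (1 - s) * height p 0.
  pose g1 := if a == 0 then g else g + s * l / 4.
  pose g0 := if a == 0 then g + s * l / 4 else g.
  have e (u : R) : s3 * (u / s3) = u by field; rewrite gt_eqF// sqrt3_gt0.
  have ss : (1 - s) * height p 2 = - 2 * g.
    have e2 : height p 2 = - 2 * height p 0 by move: sp h01; clear; lra.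
    by rewrite e2 /g; ring.
  exists (((2 * g0 + g1) / s3) +i* g1); rewrite ss -/g /g0 /g1 /height.
  by case: ab => -[ea eb]; rewrite ea eb /= ?mulNr !e; split; lra.
move: b1 => _.
apply: (@area_gt0 _ _ (Re q) (Im q) (s * l / 32)).
- by rewrite divr_gt0.
- exact: measurable_wedge.
move=> z z1 z2; have zq k := height_lip k z1 z2.
have p2 : height p 2 = - 2 * height p 0 by lra.
have tp2 := tp 2; rewrite p2 in tp2 q2.
have s_ge0 := ltW s0.
have m1 : 0 <= s * height p 0 by apply: mulr_ge0 => //; lra.
have m2 : s * height p 0 <= s * l / 4 by rewrite -mulrA; apply: ler_wpM2l => //; lra.
have m3 : 0 <= height p 0 - s * height p 0.
  by rewrite -{1}[height p 0]mul1r -mulrBl; apply: mulr_ge0; lra.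
have m4 : 0 <= - 2 * height p 0 + 2 * (s * height p 0) + l / 2 - s * l / 2.
  have -> : - 2 * height p 0 + 2 * (s * height p 0) + l / 2 - s * l / 2 =
    (1 - s) * (- 2 * height p 0 + l / 2) by field.
  by apply: mulr_ge0; lra.
have ez : 2 * (s * l / 32) = s * l / 16 by field.
have ea : `|height z a - (height p 0 - s * height p 0 + s * l / 4)| <= s * l / 16.
  by have := zq a; rewrite ez qa mulrBl mul1r.
have eb : `|height z b - (height p 0 - s * height p 0)| <= s * l / 16.
  by have := zq b; rewrite ez qb mulrBl mul1r.
have e2 : `|height z 2 - (- 2 * height p 0 + 2 * (s * height p 0) - s * l / 4)| <= s * l / 16.
  have := zq 2; rewrite ez q2.
  by have -> : (1 - s) * (- 2 * height p 0) = - 2 * height p 0 + 2 * (s * height p 0) by ring.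
have [z2b ba lo2 [da db d2]] := wedge_arith sl0 sl m1 m2 m3 m4 ea eb e2.
have abk k : [\/ k = a, k = b | k = 2].
  by case: ab => -[-> ->]; case: (ord3_cases k) => ->; [apply: Or31|apply: Or32|apply: Or33|apply: Or32|apply: Or31|apply: Or33].
have [pa pb] : height p a = height p 0 /\ height p b = height p 0.
  by case: ab => -[-> ->]; rewrite h01.
split => //.
  by apply/triangleP => k; have /ltW z2b' := z2b; have /ltW ba' := ba; case: (abk k) => -> //;
    [exact: le_trans (le_trans lo2 z2b') ba'|exact: le_trans lo2 z2b'].
by move=> k; case: (abk k) => ->; rewrite ?pa ?pb ?p2.
Qed.

End wedges.

Section swappability.
Context {R : realType}.
Local Notation C := R[i].
Variable c : C -> R.
Hypothesis c_measurable : measurable_fun triangle c.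
Hypothesis c_ge0 : forall x, triangle x -> 0 <= c x.
Hypothesis c_bounded : exists M : R, forall x, triangle x -> c x <= M.
Hypothesis c_bin1 : forall (x : C) (l : 'I_3), triangle x -> l != ord0 ->
  normc (x - bin ord0) < normc (x - bin l) -> cost c ord0 x < cost c l x.
Hypothesis c_symmetric : forall theta t : R, 0 <= theta <= 2 * pi -> 0 < t ->
  triangle (t%:C * expi theta) ->
  c (t%:C * expi theta) = c (t%:C * expi (- theta - pi / 3)).
Hypothesis c_lipschitz : exists U : set R[i],
  [/\ open (U : set (R[i])^o),
      (ray ord0 `|` ray ord_max) `&` triangle `<=` U &
      exists L : R, forall x y, (U `&` triangle) x ->
        (U `&` triangle) y -> `|c x - c y| <= L * normc (x - y)].

Lemma normc_ge0 (z : C) : 0 <= normc z.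
Proof. by case: z => a b; exact: sqrtr_ge0. Qed.

Lemma open_normc (U : set C) (p : C) : open (U : set (R[i])^o) -> U p ->
  exists2 r : R, 0 < r & forall y, normc (y - p) < r -> U y.
Proof.
move=> oU Up; have /nbhs_ballP[/= e e0 he] : nbhs (p : (R[i])^o) U by exact: open_nbhs_nbhs.
move: e0; rewrite ltcE => /andP[/eqP /= Ie Re0].
exists (complex.Re e) => // y py; apply: he; rewrite -ball_normE /ball_ /= distrC.
by rewrite normc_def ltcE /= Ie eqxx /=; case: (y - p) py.
Qed.

Lemma cost_continuous_at (p : C) (eps : R) : ((ray ord0 `|` ray ord_max) `&` triangle) p ->
  0 < eps -> exists2 r : R, 0 < r &
    forall y, triangle y -> normc (y - p) < r -> `|c y - c p| <= eps.
Proof.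
move=> pT eps0; have [U [oU sU [L hL]]] := c_lipschitz.
have Up := sU _ pT; have [r r0 hr] := open_normc oU Up.
have L1 : 0 < `|L| + 1 by rewrite ltr_wpDl.
exists (Num.min r (eps / (`|L| + 1))); first by rewrite lt_min r0 divr_gt0.
move=> y ty; rewrite lt_min => /andP[/hr Uy].
rewrite ltr_pdivlMr// => h; apply: le_trans (hL y p (conj Uy ty) (conj Up pT.2)) _.
apply: (@le_trans _ _ (normc (y - p) * (`|L| + 1))); last exact: ltW.
rewrite mulrC; apply: ler_wpM2l; first exact: normc_ge0.
by apply: le_trans (ler_norm L) _; rewrite lerDl.
Qed.

(** The rays 0 and 2 are rotated into each other, so it can be assumed that
    the point is equidistant from the bins 0 and 1. Its image under the
    rotation that defines the cost at bin 1 then lies on the ray 2, where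
    continuity is assumed as well. *)
Lemma base_point : (exists2 x, ((ray ord0 `|` ray ord_max) `&` triangle) x & 0 < c x) ->
  exists p, [/\ triangle p, height p 0 = height p 1, height p 2 <= 0, 0 < c p &
    ((ray ord0 `|` ray ord_max) `&` triangle) p /\
    ((ray ord0 `|` ray ord_max) `&` triangle) (rotl 1 p)].
Proof.
have max2 : ord_max = 2 :> 'I_3 by exact: val_inj.
have key p : triangle p -> height p 0 = height p 1 -> height p 2 <= 0 ->
    ((ray ord0 `|` ray ord_max) `&` triangle) p /\
    ((ray ord0 `|` ray ord_max) `&` triangle) (rotl 1 p).
  move=> tp h01 h2; have sp := height_sum p; split; split => //; last exact/triangle_rotl.
    have [e|ne] := eqVneq (height p 2) 0.
      right; rewrite max2; apply/rayP; rewrite /= ?add3E; split; lra.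
    by left; apply/rayP; rewrite /= ?add3E; split => //; rewrite lt_neqAle ne.
  by right; rewrite max2; apply/rayP; rewrite /= !height_rotl ?add3E; split.
move=> [x [[rx|rx] tx] cx].
  have [h1 h2] := (rayP _ _).1 rx; rewrite ?add3E /= in h1 h2.
  have h3 : height x 2 <= 0 by exact: ltW.
  by exists x; split => //; exact: key.
rewrite max2 in rx; have [h1 h2] := (rayP _ _).1 rx; rewrite ?add3E /= in h1 h2.
have tp : triangle (rotl 2 x) by exact/triangle_rotl.
have h01 : height (rotl 2 x) 0 = height (rotl 2 x) 1 by rewrite !height_rotl ?add3E.
have h3 : height (rotl 2 x) 2 <= 0 by rewrite !height_rotl ?add3E.
exists (rotl 2 x); split => //; last exact: key.
have := cost_tie01 c_symmetric tp h01; rewrite !cost_triangle// !rotlD ?add3E /= => ->.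
exact: cx.
Qed.

(** The wedge near the base point at the border of cells 0 and 1, or its
    mirror image, rotated to the border of cells [l] and [m]. *)
Definition swap_set (p : C) (delta : R) (l m : 'I_3) : set C :=
  if m == l + 1 then rotl l @^-1` wedge p delta 0 1 else rotl m @^-1` wedge p delta 1 0.

Lemma swap_setP p delta l m y : l != m -> swap_set p delta l m y ->
  [/\ triangle y, height y m < height y l, forall k, k != l -> k != m -> height y k < height y m &
    exists s, [/\ l = s \/ l = s + 1, m = s \/ m = s + 1 & forall k, `|height (rotl s y) k - height p k| <= delta]].
Proof.
move=> lm; rewrite /swap_set; case: eqP => [mE|mE] /= [].
  move=> /triangle_rotl ty; rewrite !height_rotl addr0 -mE => h1 h2 h3; split=> //.
    move=> k kl km; suff -> : k = l + 2 by [].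
    by move: mE kl km {h1 h2 h3 lm}; case: (ord3_cases l) => ->; case: (ord3_cases m) => ->; case: (ord3_cases k) => ->; rewrite ?add3E.
  by exists l; split; [left|right|].
have lE : l = m + 1.
  by move: mE lm; case: (ord3_cases l) => ->; case: (ord3_cases m) => ->; rewrite ?add3E.
move=> /triangle_rotl ty; rewrite !height_rotl addr0 -lE => h1 h2 h3; split=> //.
  move=> k kl km; suff -> : k = m + 2 by [].
  by move: lE kl km {h1 h2 h3 lm mE}; case: (ord3_cases l) => ->; case: (ord3_cases m) => ->; case: (ord3_cases k) => ->; rewrite ?add3E.
by exists m; split; [right|left|].
Qed.

Lemma normc_rotl l (x y : C) : normc (rotl l x - rotl l y) = normc (x - y).
Proof.
have s := @sqrt3_sqr R.
case: (ord3_cases l) => -> //; rewrite !rotlE; case: x => a b; case: y => a' b' /=; congr Num.sqrt.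
  transitivity ((1 / 4 + (Num.sqrt 3 : R) ^+ 2 / 4) * ((a - a') ^+ 2 + (b - b') ^+ 2)); first by field.
  by rewrite s; field.
transitivity ((1 / 4 + (Num.sqrt 3 : R) ^+ 2 / 4) * ((a - a') ^+ 2 + (b - b') ^+ 2)); first by field.
by rewrite s; field.
Qed.

(** By continuity at the base point and at its image, both costs are close
    to the cost of the base point on a small wedge; rotation transports this
    to the other borders. *)
Lemma positive_swappable :
  (exists2 x, ((ray ord0 `|` ray ord_max) `&` triangle) x & 0 < c x) -> swappable c.
Proof.
move=> /base_point[p [tp h01 h2 cp [rp rp1]]].
exists (c p) => // eps eps0.
have [r r0 hr] := cost_continuous_at rp eps0.
have [r' r'0 hr'] := cost_continuous_at rp1 eps0.
have cp1 : c (rotl 1 p) = c p.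
  by have := cost_tie01 c_symmetric tp h01; rewrite !cost_triangle.
pose delta := Num.min r r' / 4.
have d0 : 0 < delta by rewrite divr_gt0// lt_min r0.
have near y : triangle y -> (forall k, `|height y k - height p k| <= delta) ->
    `|cost c 0 y - c p| <= eps /\ `|cost c 1 y - c p| <= eps.
  move=> ty /normc_height_le h; have lt : normc (y - p) < Num.min r r'.
    by apply: le_lt_trans h _; move: d0; rewrite /delta; move: (Num.min r r') => u; lra.
  move: lt; rewrite lt_min => /andP[lt1 lt2]; split; rewrite cost_triangle//.
    exact: hr.
  by rewrite -cp1; apply: hr'; [exact/triangle_rotl|rewrite normc_rotl].
have [a01 a10] : (0 < area (wedge p delta 0%R 1%R))%E /\ (0 < area (wedge p delta 1%R 0%R))%E.
  by split; apply: wedge_area_gt0 => //; [left|right].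
have real_below (u : \bar R) : (0 < u)%E -> exists2 v : R, 0 < v & (v%:E <= u)%E.
  by case: u => [u u0| _|//]; [exists u|exists 1 => //; rewrite leey].
have [v1 v10 hv1] := real_below _ a01; have [v2 v20 hv2] := real_below _ a10.
exists (swap_set p delta), (Num.min v1 v2).
have mW a b : measurable (wedge p delta a b) := measurable_wedge p delta a b.
split; last 2 first.
- by rewrite lt_min v10.
- move=> l m lm; rewrite /swap_set; case: ifP => _; rewrite (area_rotl _ (mW _ _)).
    by apply: le_trans hv1; rewrite lee_fin ge_min lexx.
  by apply: le_trans hv2; rewrite lee_fin ge_min lexx orbT.
split.
- move=> l m; rewrite /swap_set; case: ifP => _; rewrite -[X in measurable X]setTI;
  exact: (measurable_rotl _ measurableT).
- move=> l m y lm /(swap_setP lm)[ty hlm hk [s [ls ms sd]]].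
  have [n0 n1] := near (rotl s y) ((triangle_rotl s y).2 ty) sd.
  rewrite !cost_rotl addr0 in n0 n1.
  split.
  + apply: in_cell_interior => // k kl; have [->//|km] := eqVneq k m.
    exact: lt_trans (hk k kl km) hlm.
  + by case: ls => ->.
  + by case: ms => ->.
- move=> l m m' y lm lm' /(swap_setP lm)[_ _ h _] /(swap_setP lm')[_ _ h' _].
  apply/eqP; apply: contraT => mm'.
  have := h m' _ _; have := h' m _ _.
  rewrite ![_ == l]eq_sym ![m' == m]eq_sym lm lm' mm' => /(_ isT isT) a /(_ isT isT) b.
  by have := lt_trans a b; rewrite ltxx.
Qed.

Context d (Omega : measurableType d) (P : probability Omega R).
Variable X : nat -> {RV P >-> C}.
Hypothesis X_uniform : forall k, uniform_on triangle (X k).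

(** On a region of positive area in cell 0 the cost is at least [c0 / 2]. *)
Lemma swappable_second_moment_gt0 : swappable c -> 0 < \int[area]_(x in cell ord0) c x ^+ 2.
Proof.
move=> [c0 c00 sw]; have c2 : 0 < c0 / 2 by rewrite divr_gt0.
have [D [p [[mD D1 _] p0 pD]]] := sw _ c2.
have mDX : measurable (X 0%N @^-1` D 0 1).
  by rewrite -[X in measurable X]setTI; exact: measurable_funPT.
have bV := bmeas_contribution c_measurable c_ge0 c_bounded 0.
have bI := bmeas_indic 0 (mD 0 1).
have -> : \int[area]_(x in cell ord0) c x ^+ 2 =
    \int[P]_w (contribution c 0 (X 0%N w) * contribution c 0 (X 0%N w)).
  by rewrite contribution_cov// eqxx mul1r.
apply: (@lt_le_trans _ _ (\int[P]_w ((c0 / 2) ^+ 2 * (\1_(D 0 1) (X 0%N w) - 0)))).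
  rewrite RintegralZl//; last by apply: bmeas_integrable; exact: (bmeas_RV X 0 bI).
  apply: mulr_gt0; first exact: exprn_gt0.
  under eq_Rintegral do rewrite subr0.
  rewrite indic_Exp//; apply: fine_gt0; apply/andP; split.
    apply: (@lt_le_trans _ _ p%:E); first by rewrite lte_fin.
    have -> : P (X 0%N @^-1` D 0 1) = area (D 0 1); last exact: pD.
    transitivity (area (triangle `&` D 0 1)); first exact: (uniform_law (X_uniform 0)).
    by rewrite setIidr// => y /(D1 0 1 y isT)[/in_cell_triangle].
  by apply: (@le_lt_trans _ _ 1%E); [exact: probability_le1|rewrite ltry].
apply: le_Rintegral => //.
- apply: bmeas_integrable; apply: bmeasM; first exact: bmeas_cst.
  exact: (bmeas_RV X 0 bI).
- by apply: bmeas_integrable; apply: bmeasM; exact: (bmeas_RV X 0 bV).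
move=> w _; rewrite subr0 indicE; case: (boolP (X 0%N w \in D 0 1)); last first.
  by rewrite mulr0 -expr2 sqr_ge0.
rewrite inE => /(D1 0 1 _ isT)[h1 h2 _].
rewrite mulr1 -expr2 /contribution h1 mul1r.
move: h2; rewrite ler_norml => /andP[h2 _].
have h3 : c0 / 2 <= cost c 0 (X 0%N w) by lra.
by apply: lerXn2r => //; rewrite nnegrE; [exact: ltW|exact: le_trans (ltW c2) h3].
Qed.

End swappability.

(** * Convergence with bounded second moments *)

Section tight_convergence.
Context {R : realType} d (T : measurableType d) (P : probability T R).
Context d' (T' : measurableType d') (P' : probability T' R).

(** Convergence of truncated variables, together with the bounds that
    exclude an escape of mass. *)
Definition tight_cvg (Y : nat -> T -> R) (Z : T' -> R) : Prop :=
  [/\ forall n, bmeas (Y n), measurable_fun setT Z, L1 P' (fun w => Z w ^+ 2),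
      exists2 V, forall n, (0 < n)%N -> \int[P]_w (Y n w ^+ 2) <= V &
                 \int[P']_w (Z w ^+ 2) <= V &
      clamp_cvg P P' Y Z].

Lemma bmeas_sqr d0 (T0 : measurableType d0) (f : T0 -> R) : bmeas f -> bmeas (fun w => f w ^+ 2).
Proof. by move=> bf; under eq_fun do rewrite expr2; exact: bmeasM. Qed.

Lemma tight_cvg_distribution (Y : nat -> T -> R) (Z : T' -> R) :
  tight_cvg Y Z -> cvg_in_distribution P Y P' Z.
Proof.
move=> [bY mZ Z2 [V YV ZV] YZ].
apply: cvg_in_distributionP => //; first by move=> n; exact: (bY n).1.
move=> f cf bf; apply: (clamp_cvg_bounded (V := V)) => //.
  by move=> n; exact: (bY n).1.
by move=> n; apply: bmeas_integrable; exact: bmeas_sqr.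
Qed.

Lemma tight_cvg_mean (Y : nat -> T -> R) (Z : T' -> R) :
  tight_cvg Y Z -> \int[P]_w Y n w @[n --> \oo] --> \int[P']_w Z w.
Proof.
move=> [bY mZ Z2 [V YV ZV] YZ].
apply: (clamp_cvg_mean (V := V)) => //; first by move=> n; exact: (bY n).1.
by move=> n; apply: bmeas_integrable; exact: bmeas_sqr.
Qed.

Lemma tight_cvg_perturb (Y Y' : nat -> T -> R) (Z : T' -> R) :
  tight_cvg Y Z -> (forall n, bmeas (Y' n)) ->
  (exists V, forall n, (0 < n)%N -> \int[P]_w (Y' n w ^+ 2) <= V) ->
  \int[P]_w `|Y' n w - Y n w| @[n --> \oo] --> 0 ->
  tight_cvg Y' Z.
Proof.
move=> [bY mZ Z2 [V YV ZV] YZ] bY' [V' YV'] YY; split => //.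
  exists (Num.max V V') => [n n0|]; rewrite le_max; first by rewrite YV'// orbT.
  by rewrite ZV.
apply: (clamp_cvg_perturb (Y := Y)) => //.
- by move=> n; exact: (bY n).1.
- by move=> n; exact: (bY' n).1.
- by move=> n; apply: L1_norm; apply: bmeas_integrable; exact: bmeasB.
Qed.

Context dE (E : measurableType dE) (X : nat -> {RV P >-> E}).
Hypothesis X_indep : mutually_independent X.

Lemma clt_max (U : 'I_3 -> E -> R) (C : 'I_3 -> 'I_3 -> R) (N : 'I_3 -> T' -> R) :
  (forall l, bmeas (U l)) -> (forall k l, \int[P]_w U l (X k w) = 0) ->
  (forall k l m, \int[P]_w (U l (X k w) * U m (X k w)) = C l m) ->
  gauss_vec P' N C ->
  tight_cvg (fun n w => max3 (fun l => (\sum_(i < n) U l (X i w)) / Num.sqrt n%:R))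
            (fun w => max3 (N ^~ w)).
Proof.
move=> bU U1 U2 gN; have [mN _ _ _ _] := gN.
split.
- by move=> n; exact: (@bmeas_max_sum R d T P dE E X U bU n).
- exact: measurable_max3.
- exact: (L1_gauss_max_sqr gN).
- exists (\sum_(l < 3) C l l); last exact: (gauss_max_second_moment gN).
  by move=> n n0; exact: (max_sum_second_moment X_indep bU U1 U2 n0).
- exact: (clt_max_clamp_cvg X_indep bU U1 U2 gN).
Qed.

End tight_convergence.

(** * The expected maximum of three normal variables *)

Section gaussian_max.
Context {R : realType}.
Local Notation RR := (measurableTypeR R).
Local Notation N01 := (@normal_prob R 0 1).

(** On rectangles, both laws agree with the product of the marginal laws. *)
Lemma indep2_same_law d1 d2 d3 d4 (T : measurableType d1) (T' : measurableType d2)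
    (T1 : measurableType d3) (T2 : measurableType d4)
    (P : probability T R) (P' : probability T' R)
    (A : T -> T1) (B : T -> T2) (A' : T' -> T1) (B' : T' -> T2) :
  measurable_fun setT A -> measurable_fun setT B ->
  measurable_fun setT A' -> measurable_fun setT B' ->
  indep2 P A B -> indep2 P' A' B' -> same_law P A P' A' -> same_law P B P' B' ->
  same_law P (fun w => (A w, B w)) P' (fun w => (A' w, B' w)).
Proof.
move=> mA mB mA' mB' AB AB' lA lB C mC.
pose fA : {mfun _ >-> _} := HB.pack A (isMeasurableFun.Build _ _ _ _ _ mA).
pose fB : {mfun _ >-> _} := HB.pack B (isMeasurableFun.Build _ _ _ _ _ mB).
have mp : measurable_fun setT (fun w => (A w, B w)) by exact: measurable_fun_pair.
have mp' : measurable_fun setT (fun w => (A' w, B' w)) by exact: measurable_fun_pair.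
pose f : {mfun _ >-> _} := HB.pack (fun w => (A w, B w)) (isMeasurableFun.Build _ _ _ _ _ mp).
pose f' : {mfun _ >-> _} := HB.pack (fun w => (A' w, B' w)) (isMeasurableFun.Build _ _ _ _ _ mp').
transitivity ((distribution P fA \x distribution P fB)%E C).
  apply/esym; apply: (@product_measure_unique _ _ _ _ _ _ _ (pushforward P f)).
    by move=> a b ma mb; exact: AB.
  exact: mC.
apply: (@product_measure_unique _ _ _ _ _ _ _ (pushforward P' f')); last exact: mC.
move=> a b ma mb; transitivity (P' (A' @^-1` a) * P' (B' @^-1` b))%E; first exact: AB'.
by rewrite -lA// -lB.
Qed.

Lemma indep2_prod d1 d2 (T1 : measurableType d1) (T2 : measurableType d2)
    (P1 : probability T1 R) (P2 : probability T2 R) d3 d4 (S1 : measurableType d3) (S2 : measurableType d4)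
    (f : T1 -> S1) (g : T2 -> S2) : measurable_fun setT f -> measurable_fun setT g ->
  [/\ indep2 (P1 \x P2)%E (fun z => f z.1) (fun z => g z.2),
      same_law (P1 \x P2)%E (fun z : T1 * T2 => f z.1) P1 f &
      same_law (P1 \x P2)%E (fun z : T1 * T2 => g z.2) P2 g].
Proof.
move=> mf mg.
have pf a : measurable a -> measurable (f @^-1` a).
  by move=> ma; rewrite -[X in measurable X]setTI; exact: mf.
have pg a : measurable a -> measurable (g @^-1` a).
  by move=> ma; rewrite -[X in measurable X]setTI; exact: mg.
have l1 : same_law (P1 \x P2)%E (fun z : T1 * T2 => f z.1) P1 f.
  move=> a ma; transitivity ((P1 \x P2)%E (f @^-1` a `*` setT)).
    by congr ((P1 \x P2)%E _); apply/seteqP; split=> z //= [].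
  transitivity (P1 (f @^-1` a) * P2 setT)%E; first by apply: product_measure1E => //; exact: pf.
  by rewrite probability_setT mule1.
have l2 : same_law (P1 \x P2)%E (fun z : T1 * T2 => g z.2) P2 g.
  move=> a ma; transitivity ((P1 \x P2)%E (setT `*` (g @^-1` a))).
    by congr ((P1 \x P2)%E _); apply/seteqP; split=> z //= [].
  transitivity (P1 setT * P2 (g @^-1` a))%E; first by apply: product_measure1E => //; exact: pg.
  by rewrite probability_setT mul1e.
split=> // a b ma mb; rewrite l1// l2//.
transitivity ((P1 \x P2)%E ((f @^-1` a) `*` (g @^-1` b))); last first.
  by apply: product_measure1E; [exact: pf|exact: pg].
by congr ((P1 \x P2)%E _); apply/seteqP.
Qed.

Definition triple (x y z : R) (l : 'I_3) : R := nth 0 [:: x; y; z] l.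

Definition gaussian_max_mean : R :=
  \int[(N01 \x N01 \x N01)%E]_z max3 (triple z.1.1 z.1.2 z.2).

Local Notation N3 := (N01 \x N01 \x N01)%E.

Lemma gaussian_coords :
  [/\ same_law N3 (fun z : RR * RR * RR => z.1.1 : RR) N01 (fun z : RR => 1 * z : RR),
      same_law N3 (fun z : RR * RR * RR => z.1.2 : RR) N01 (fun z : RR => 1 * z : RR),
      same_law N3 (fun z : RR * RR * RR => z.2 : RR) N01 (fun z : RR => 1 * z : RR) &
      indep2 N3 (fun z : RR * RR * RR => z.1.1 : RR) (fun z : RR * RR * RR => z.1.2 : RR)].
Proof.
have mid : measurable_fun setT (@id RR) by exact: measurable_id.
have mid2 : measurable_fun setT (@id (RR * RR)) by exact: measurable_id.
have [i12 l1 l2] := @indep2_prod _ _ _ _ N01 N01 _ _ _ _ _ _ mid mid.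
have [_ l12 l3] := @indep2_prod _ _ _ _ (N01 \x N01)%E N01 _ _ _ _ _ _ mid2 mid.
have id1 : (fun z : RR => 1 * z : RR) = id by apply/funext => z; rewrite mul1r.
rewrite id1; have s1 : same_law N3 (fun z : RR * RR * RR => z.1.1 : RR) N01 id.
  move=> C mC; rewrite -(l1 C mC); apply: (l12 [set z | C z.1]).
  by rewrite -[X in measurable X]setTI; exact: measurable_fst.
have s2 : same_law N3 (fun z : RR * RR * RR => z.1.2 : RR) N01 id.
  move=> C mC; rewrite -(l2 C mC); apply: (l12 [set z | C z.2]).
  by rewrite -[X in measurable X]setTI; exact: measurable_snd.
split=> // a b ma mb.
transitivity ((N01 \x N01)%E (fst @^-1` a `&` snd @^-1` b)).
  apply: (l12 (fst @^-1` a `&` snd @^-1` b)); apply: measurableI.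
    by rewrite -[X in measurable X]setTI; exact: measurable_fst.
  by rewrite -[X in measurable X]setTI; exact: measurable_snd.
transitivity (N01 a * N01 b)%E.
  by transitivity ((N01 \x N01)%E (fst @^-1` a) * (N01 \x N01)%E (snd @^-1` b))%E;
    [exact: i12|congr (_ * _)%E; [exact: l1|exact: l2]].
by congr (_ * _)%E; apply/esym; [exact: s1|exact: s2].
Qed.

Lemma measurable_coords : [/\ measurable_fun setT (fun z : RR * RR * RR => z.1.1 : RR),
  measurable_fun setT (fun z : RR * RR * RR => z.1.2 : RR) &
  measurable_fun setT (fun z : RR * RR * RR => z.2 : RR)].
Proof.
split; [exact: (measurableT_comp (f := fst) measurable_fst measurable_fst)|
  exact: (measurableT_comp (f := snd) measurable_snd measurable_fst)|exact: measurable_snd].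
Qed.

Lemma L1_coords : [/\ L1 N3 (fun z : RR * RR * RR => `|z.1.1| ^+ 3),
  L1 N3 (fun z : RR * RR * RR => `|z.1.2| ^+ 3) & L1 N3 (fun z : RR * RR * RR => `|z.2| ^+ 3)].
Proof.
have [m1 m2 m3] := measurable_coords; have [s1 s2 s3 _] := gaussian_coords.
by split; [exact: normal_law_L1_norm3 s1|exact: normal_law_L1_norm3 s2|exact: normal_law_L1_norm3 s3].
Qed.

Lemma measurable_triple_max : measurable_fun setT
  (fun z : RR * RR * RR => max3 (triple z.1.1 z.1.2 z.2)).
Proof.
have [m1 m2 m3] := measurable_coords.
by apply: (@measurable_max3 R _ _ (fun l z => triple z.1.1 z.1.2 z.2 l)) => -[[|[|[|//]]] i].
Qed.

Lemma L1_triple_max : L1 N3 (fun z : RR * RR * RR => max3 (triple z.1.1 z.1.2 z.2)).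
Proof.
have [m1 m2 m3] := measurable_coords; have [l1 l2 l3] := L1_coords.
apply: (@L1_le _ _ _ N3 _ (fun z : RR * RR * RR => `|z.1.1| + `|z.1.2| + `|z.2|)).
- exact: measurable_triple_max.
- by apply: L1D; [apply: L1D|]; apply: L1_norm; exact: L1_norm3_id.
- move=> z; apply: le_trans (max3_norm_le _) _.
  by rewrite !big_ord_recl big_ord0 addr0 addrA.
Qed.

(** The triple has the law of a scaled triple of independent standard normal
    variables, and the maximum is homogeneous. *)
Lemma gaussian_max_meanE d (T : measurableType d) (P : probability T R) (I : choiceType)
    (Z : I -> {RV P >-> R}) (iota : 'I_3 -> I) (s : R) : 0 <= s -> injective iota ->
  (forall l, same_law P (Z (iota l)) N01 (fun z : RR => s * z : RR)) ->
  mutually_independent Z ->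
  \int[P]_w max3 (fun l => Z (iota l) w) = gaussian_max_mean * s.
Proof.
move=> s0 iota_inj; set G := fun l => Z (iota l) => law ind.
have ms : measurable_fun setT (fun z : RR => s * z : RR) by exact: measurable_funM.
have i01 : indep2 P (G 0) (G 1).
  have ne : iota 0 != iota 1 by rewrite (inj_eq iota_inj).
  have h := @mutually_independent_tuple _ _ _ P _ _ _ Z 1 (fun _ => iota 0) (iota 1) ind
    (fun i j _ => etrans (ord1 i) (esym (ord1 j))) (fun _ => ne).
  have := indep2_comp (measurable_tnth ord0) (@measurable_id _ _ setT) h.
  by congr indep2; apply/funext => w /=; rewrite tnth_mktuple.
have i012 : indep2 P (fun w => (G 0 w, G 1 w)) (G 2).
  have w2i : injective (iota \o widen_ord (leqnSn 2)).
    by apply: inj_comp => // i j /(congr1 val)/= e; exact: val_inj.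
  have w2 (k : 'I_2) : iota (widen_ord (leqnSn 2) k) != iota 2.
    by rewrite (inj_eq iota_inj); case: k => -[|[]].
  have h := @mutually_independent_tuple _ _ _ P _ _ _ Z 2 (iota \o widen_ord (leqnSn 2)) (iota 2) ind
    w2i w2.
  have mg : measurable_fun setT (fun t : 2.-tuple RR => (tnth t 0, tnth t 1)).
    by apply: measurable_fun_pair; exact: measurable_tnth.
  have := indep2_comp mg (@measurable_id _ _ setT) h.
  congr indep2; apply/funext => w /=; rewrite !tnth_mktuple.
  by congr (G _ w, G _ w); exact: val_inj.
have [ind0 la lb] := @indep2_prod _ _ _ _ N01 N01 _ _ _ _ _ _ ms ms.
have mab : measurable_fun setT (fun z : RR * RR => (s * z.1 : RR, s * z.2 : RR)).
  by apply: measurable_fun_pair; exact: measurableT_comp.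
have [ind1 lab lc] := @indep2_prod _ _ _ _ (N01 \x N01)%E N01 _ _ _ _ _ _ mab ms.
have mG l : measurable_fun setT (G l) by [].
have mG2 : measurable_fun setT (fun w => (G 0 w, G 1 w)) by exact: measurable_fun_pair.
have ms1 : measurable_fun setT (fun z : RR * RR => s * z.1 : RR) by exact: measurableT_comp.
have ms2 : measurable_fun setT (fun z : RR * RR => s * z.2 : RR) by exact: measurableT_comp.
have ms3 : measurable_fun setT (fun z : RR * RR * RR => s * z.2 : RR) by exact: measurableT_comp.
have law2 : same_law P (fun w => (G 0 w, G 1 w)) (N01 \x N01)%E (fun z : RR * RR => (s * z.1 : RR, s * z.2 : RR)).
  apply: indep2_same_law => //.
    by move=> C mC; rewrite (law 0 C mC) -(la C mC).
  by move=> C mC; rewrite (law 1 C mC) -(lb C mC).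
have mab1 : measurable_fun setT (fun z : RR * RR * RR => (s * z.1.1 : RR, s * z.1.2 : RR)).
  exact: (measurableT_comp mab).
have law3 : same_law P (fun w => ((G 0 w, G 1 w), G 2 w)) (N01 \x N01 \x N01)%E
    (fun z : RR * RR * RR => ((s * z.1.1 : RR, s * z.1.2 : RR), s * z.2 : RR)).
  apply: indep2_same_law => //.
    by move=> C mC; rewrite (law2 C mC) -(lab C mC).
  by move=> C mC; rewrite (law 2 C mC) -(lc C mC).
pose F (q : RR * RR * RR) := max3 (triple q.1.1 q.1.2 q.2).
have mF : measurable_fun setT F.
  apply: (@measurable_max3 R _ _ (fun l q => triple q.1.1 q.1.2 q.2 l)) => -[[|[|[|//]]] i] /=.
  - exact: (measurableT_comp (f := fst) measurable_fst measurable_fst).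
  - exact: (measurableT_comp (f := snd) measurable_snd measurable_fst).
  - exact: measurable_snd.
transitivity (\int[P]_w F ((G 0 w, G 1 w), G 2 w)).
  apply: eq_Rintegral => w _; congr max3; apply/funext => -[[|[|[|//]]] i] /=;
  by congr (G _ w); exact: val_inj.
rewrite (same_law_Exp _ _ law3 mF); [|exact: measurable_fun_pair|exact: measurable_fun_pair].
rewrite /gaussian_max_mean mulrC -RintegralZl//; last exact: L1_triple_max.
apply: eq_Rintegral => z _; rewrite -max3Z//; congr max3.
by apply/funext => -[[|[|[|//]]] i].
Qed.

(** The difference is [u * delta] times a sum of squares, where [u] is the
    absolute value of [y]. *)
Lemma sqr_le_interpolation (delta y : R) : 0 < delta ->
  y ^+ 2 <= `|y| / delta + delta * `|y| ^+ 3.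
Proof.
move=> d0; rewrite -(real_normK (num_real y)).
have y0 := normr_ge0 y; move: `|y| y0 => u u0.
have e : u / delta + delta * u ^+ 3 - u ^+ 2 = u * delta * ((u - (2 * delta)^-1) ^+ 2 + 3 / 4 * delta^-1 ^+ 2).
  by field; rewrite gt_eqF.
rewrite -subr_ge0 e; apply: mulr_ge0; first by apply: mulr_ge0 => //; exact: ltW.
apply: addr_ge0; first exact: sqr_ge0.
by apply: mulr_ge0; [rewrite divr_ge0|exact: sqr_ge0].
Qed.

Lemma half_sum_max_le (a b M : R) : a <= M -> b <= M ->
  2^-1 * `|a - b| + 2^-1 * (a + b) <= M.
Proof.
by move=> aM bM; case: (lerP 0 (a - b)) => h; rewrite ?(ger0_norm h) ?(ltr0_norm h); lra.
Qed.

(** The maximum of [a] and [b] is the half sum of [a + b] and of the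
    absolute value of [a - b]. The latter has positive expectation, since
    the second moment of [a - b] is 2 and its third absolute moment is
    finite. *)
Lemma gaussian_max_mean_gt0 : 0 < gaussian_max_mean.
Proof.
have [m1 m2 m3] := measurable_coords; have [l1 l2 l3] := L1_coords.
have [s1 s2 _ i12] := gaussian_coords.
pose a (z : RR * RR * RR) : R := z.1.1; pose b (z : RR * RR * RR) : R := z.1.2.
have la : L1 N3 a by exact: L1_norm3_id.
have lb : L1 N3 b by exact: L1_norm3_id.
have mab : measurable_fun setT (fun z => a z - b z) by exact: measurable_funB.
have l_ab : L1 N3 (fun z => `|a z - b z|) by apply: L1_norm; exact: L1B.
have lab3 : L1 N3 (fun z => `|a z - b z| ^+ 3).
  apply: (@L1_le _ _ _ N3 _ (fun z => 4 * (`|a z| ^+ 3 + `|b z| ^+ 3))).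
  - by apply: measurable_funX; exact: measurableT_comp.
  - by apply: L1Z; exact: L1D.
  - move=> z; rewrite ger0_norm ?exprn_ge0//.
    by have := cube_normD (a z) (- b z); rewrite normrN.
have sqr_ab : \int[N3]_z (a z - b z) ^+ 2 = 2.
  have [lm Em] := indep2_ExpM i12 la lb.
  have la2 : L1 N3 (fun z => a z ^+ 2).
    by under [X in EFin \o X]eq_fun do rewrite expr2; exact: L1_norm3_mul.
  have lb2 : L1 N3 (fun z => b z ^+ 2).
    by under [X in EFin \o X]eq_fun do rewrite expr2; exact: L1_norm3_mul.
  transitivity (\int[N3]_z ((a z ^+ 2 + b z ^+ 2) + (-2) * (a z * b z))).
    by apply: eq_Rintegral => z _; ring.
  rewrite RintegralD//; [|exact: L1D|exact: L1Z].
  rewrite RintegralD// RintegralZl// Em.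
  rewrite (normal_law_sqr m1 s1) (normal_law_sqr m2 s2) (normal_law_mean m1 s1).
  by rewrite mul0r mulr0 expr1n; lra.
pose K := 1 + \int[N3]_z `|a z - b z| ^+ 3.
have K1 : 1 <= K by rewrite lerDl; apply: Rintegral_ge0 => z _; rewrite exprn_ge0.
have K0 : 0 < K by apply: lt_le_trans K1.
have h1 : 2 <= K * \int[N3]_z `|a z - b z| + 1.
  rewrite -sqr_ab.
  apply: (@le_trans _ _ (\int[N3]_z (K * `|a z - b z| + K^-1 * `|a z - b z| ^+ 3))).
    apply: le_Rintegral => //.
    - by under [X in EFin \o X]eq_fun do rewrite expr2; apply: L1_norm3_mul.
    - by apply: L1D; exact: L1Z.
    - move=> z _; have := @sqr_le_interpolation K^-1 (a z - b z).
      by rewrite invrK invr_gt0 mulrC; exact.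
  rewrite RintegralD//; [|exact: L1Z..]; rewrite !RintegralZl// lerD2l.
  by rewrite mulrC ler_pdivrMr// mul1r /K lerDr.
have h2 : 0 < \int[N3]_z `|a z - b z|.
  by rewrite -(pmulr_rgt0 _ K0); lra.
apply: (@lt_le_trans _ _ (\int[N3]_z (2^-1 * `|a z - b z| + 2^-1 * (a z + b z)))).
  rewrite RintegralD//; [|exact: L1Z|by apply: L1Z; exact: L1D].
  rewrite !RintegralZl//; last exact: L1D.
  rewrite RintegralD//.
  rewrite (normal_law_mean m1 s1) (normal_law_mean m2 s2) addr0 mulr0 addr0.
  by rewrite mulr_gt0// invr_gt0.
apply: le_Rintegral => //.
- by apply: L1D; [exact: L1Z|apply: L1Z; exact: L1D].
- exact: L1_triple_max.
move=> z _.
have ha := max3_ge (triple z.1.1 z.1.2 z.2) 0; have hb := max3_ge (triple z.1.1 z.1.2 z.2) 1.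
rewrite /triple /= -/(triple z.1.1 z.1.2 z.2) in ha hb.
exact: half_sum_max_le.
Qed.

End gaussian_max.

(** * Limits of the loads *)

Section load_limits.
Context {R : realType}.
Local Notation C := R[i].
Local Notation RR := (measurableTypeR R).
Local Notation N01 := (@normal_prob R 0 1).
Variable c : C -> R.
Hypothesis c_measurable : measurable_fun triangle c.
Hypothesis c_ge0 : forall x, triangle x -> 0 <= c x.
Hypothesis c_bounded : exists M : R, forall x, triangle x -> c x <= M.
Context d (Omega : measurableType d) (P : probability Omega R).
Variable X : nat -> {RV P >-> C}.
Hypothesis X_independent : mutually_independent X.
Hypothesis X_uniform : forall k, uniform_on triangle (X k).

Let x_ w k := X k w.
Let gamma := \int[area]_(x in cell ord0) c x.
Let sigma2 := \int[area]_(x in cell ord0) c x ^+ 2.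

Definition centred (y : C) (j : 'I_3) : R := contribution c j y - gamma.

Let bV j : bmeas (contribution c j) := bmeas_contribution c_measurable c_ge0 c_bounded j.

Lemma bmeas_centred j : bmeas (fun y => centred y j).
Proof. by apply: bmeasB => //; exact: bmeas_cst. Qed.

Let L1V k j : L1 P (fun w => contribution c j (X k w)).
Proof. by apply: bmeas_integrable; exact: (bmeas_RV X k (bV j)). Qed.

Let L1VV k j m : L1 P (fun w => contribution c j (X k w) * contribution c m (X k w)).
Proof. by apply: bmeas_integrable; apply: bmeasM; apply: (bmeas_RV X k (bV _)). Qed.

Lemma centred_mean k j : \int[P]_w centred (X k w) j = 0.
Proof.
by rewrite RintegralB//; [rewrite contribution_mean// Exp_cst subrr|exact: L1_cst].
Qed.

Lemma centred_cov k j m : \int[P]_w (centred (X k w) j * centred (X k w) m) =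
  (j == m)%:R * sigma2 - gamma ^+ 2.
Proof.
transitivity (\int[P]_w (contribution c j (X k w) * contribution c m (X k w)
    + (- gamma * (contribution c j (X k w) + contribution c m (X k w)) + gamma ^+ 2))).
  by apply: eq_Rintegral => w _; rewrite /centred; ring.
have L1s : L1 P (fun w => - gamma * (contribution c j (X k w) + contribution c m (X k w))).
  by apply: L1Z; exact: L1D.
rewrite RintegralD//; last by apply: L1D => //; exact: L1_cst.
rewrite RintegralD//; last exact: L1_cst.
rewrite RintegralZl//; last exact: L1D.
rewrite RintegralD// !contribution_mean// contribution_cov// Exp_cst.
by rewrite -/gamma -/sigma2; ring.
Qed.

Definition combination (A : 'I_3 -> 'I_3 -> R) (l : 'I_3) (y : C) : R :=
  \sum_(j < 3) A l j * centred y j.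

Lemma bmeas_combination A l : bmeas (combination A l).
Proof. by apply: bmeas_sum => j _; apply: bmeasM; [exact: bmeas_cst|exact: bmeas_centred]. Qed.

Definition combination_cov (A : 'I_3 -> 'I_3 -> R) (l m : 'I_3) : R :=
  \sum_(j < 3) \sum_(k < 3) A l j * A m k * ((j == k)%:R * sigma2 - gamma ^+ 2).

Let L1c k j (a : R) : L1 P (fun w => a * centred (X k w) j).
Proof. by apply: L1Z; apply: bmeas_integrable; exact: (bmeas_RV X k (bmeas_centred j)). Qed.

Lemma combination_mean A k l : \int[P]_w combination A l (X k w) = 0.
Proof.
rewrite Exp_sum// big1// => j _.
rewrite RintegralZl//; first by rewrite centred_mean mulr0.
by apply: bmeas_integrable; exact: (bmeas_RV X k (bmeas_centred j)).
Qed.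

Lemma combination_covE A k l m :
  \int[P]_w (combination A l (X k w) * combination A m (X k w)) = combination_cov A l m.
Proof.
have bcc i j : bmeas (fun w => centred (X k w) i * centred (X k w) j).
  by apply: bmeasM; apply: (bmeas_RV X k (bmeas_centred _)).
transitivity (\int[P]_w \sum_(i < 3) \sum_(j < 3) (A l i * A m j) * (centred (X k w) i * centred (X k w) j)).
  apply: eq_Rintegral => w _; rewrite /combination mulr_suml; apply: eq_bigr => i _.
  by rewrite mulr_sumr; apply: eq_bigr => j _; ring.
rewrite Exp_sum; last first.
  by move=> i; apply: L1_sum => j; apply: L1Z; exact: bmeas_integrable.
apply: eq_bigr => i _; rewrite Exp_sum; last by move=> j; apply: L1Z; exact: bmeas_integrable.
apply: eq_bigr => j _; rewrite RintegralZl//; last exact: bmeas_integrable.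
by rewrite centred_cov.
Qed.

Lemma sigma2_ge0 : 0 <= sigma2.
Proof.
have -> : sigma2 = \int[P]_w (contribution c 0 (X 0%N w) * contribution c 0 (X 0%N w)).
  by rewrite contribution_cov// eqxx mul1r.
by apply: Rintegral_ge0 => w _; rewrite -expr2 sqr_ge0.
Qed.

Lemma mean_variance_ge0 : 0 <= sigma2 / 3 - gamma ^+ 2.
Proof.
have e : combination_cov (fun _ _ => 1 / 3) 0 0 = sigma2 / 3 - gamma ^+ 2.
  by rewrite /combination_cov !big_ord_recl !big_ord0 /=; field.
rewrite -e -(combination_covE _ 0); apply: Rintegral_ge0 => w _.
by rewrite -expr2 sqr_ge0.
Qed.

Context d' (Omega' : measurableType d') (P' : probability Omega' R).
Variables (G : {RV P' >-> R}) (Gs : 'I_3 -> {RV P' >-> R}).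
Hypothesis G_gaussian : gaussian 0 (sigma2 / 3 - gamma ^+ 2) G.
Hypothesis Gs_gaussian : forall l, gaussian 0 sigma2 (Gs l).
Hypothesis G_Gs_independent : mutually_independent (oapp Gs G).

(* the four independent variables, listed as G_1, G_2, G_3, G *)
Let idx (j : nat) : option 'I_3 := if (j < 3)%N then Some (inord j) else None.
Let GG j : {RV P' >-> R} := oapp Gs G (idx j).
Let sd (j : nat) : R := Num.sqrt (if (j < 3)%N then sigma2 else sigma2 / 3 - gamma ^+ 2).

Lemma gauss_vec_combination (B : 'I_3 -> nat -> R) :
  gauss_vec P' (fun l w => \sum_(j < 4) B l j * GG j w)
               (fun l m => \sum_(j < 4) B l j * B m j * sd j ^+ 2).
Proof.
apply: (@gauss_vec_sum R d' Omega' P' 3 (fun j w => GG j w) sd B 4).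
- by move=> j _.
- have law l := gaussian_law sigma2_ge0 (Gs_gaussian l).
  have lawG := gaussian_law mean_variance_ge0 G_gaussian.
  by move=> j _; rewrite /GG /sd /idx; case: ltnP => _; [exact: law|exact: lawG].
- move=> j j4.
  have inj (a b : nat) : (a < 4)%N -> (b < 4)%N -> idx a = idx b -> a = b.
    move=> a4 b4; rewrite /idx; case: (ltnP a 3) => a3; case: (ltnP b 3) => b3 //.
      by move=> [] e; move: (congr1 (@nat_of_ord 3) e); rewrite !inordK.
    move=> _; apply/eqP; rewrite eqn_leq; apply/andP; split.
      exact: leq_trans _ b3.
    exact: leq_trans _ a3.
  have h := @mutually_independent_tuple _ _ _ P' _ _ _ (oapp Gs G) j (fun i : 'I_j => idx i) (idx j)
    G_Gs_independent _ _.
  apply: h.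
    by move=> a b /inj e; apply: val_inj; apply: e; apply: ltn_trans (ltn_ord _) j4.
  move=> k; apply/eqP => /inj e; have := ltn_ord k.
  by rewrite e ?ltnn//; exact: ltn_trans (ltn_ord _) j4.
Qed.

(** A linear combination of the contributions is asymptotically Gaussian,
    and any combination of the given Gaussian variables that has the same
    covariance can serve as its limit. *)
Lemma combination_cvg (A : 'I_3 -> 'I_3 -> R) (B : 'I_3 -> nat -> R) :
  (forall l m, combination_cov A l m = \sum_(j < 4) B l j * B m j * sd j ^+ 2) ->
  tight_cvg P P'
    (fun n w => max3 (fun l => (\sum_(i < n) combination A l (X i w)) / Num.sqrt n%:R))
    (fun w => max3 (fun l => \sum_(j < 4) B l j * GG j w)).
Proof.
move=> AB; apply: (@clt_max _ _ _ P _ _ P' _ _ X X_independent (combination A) (combination_cov A)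
  (fun l w => \sum_(j < 4) B l j * GG j w)).
- exact: bmeas_combination.
- by move=> k l; exact: combination_mean.
- by move=> k l m; exact: combination_covE.
- have := gauss_vec_combination B; congr gauss_vec.
  by apply/funext => l; apply/funext => m; rewrite AB.
Qed.

Lemma sum4_GG (b : nat -> R) w :
  \sum_(j < 4) b j * GG j w = \sum_(j < 3) b j * Gs j w + b 3%N * G w.
Proof.
rewrite big_ord_recr /=; congr (_ + _); apply: eq_bigr => j _ /=.
by rewrite /GG /idx ltn_ord /= inord_val.
Qed.

Lemma sum4_sd (b e : nat -> R) : \sum_(j < 4) b j * e j * sd j ^+ 2 =
  (\sum_(j < 3) b j * e j) * sigma2 + b 3%N * e 3%N * (sigma2 / 3 - gamma ^+ 2).
Proof.
rewrite big_ord_recr /= /sd ltnn sqr_sqrtr ?mean_variance_ge0//; congr (_ + _).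
rewrite mulr_suml; apply: eq_bigr => j _ /=.
by rewrite ltn_ord sqr_sqrtr// sigma2_ge0.
Qed.

Let Gmean w := (\sum_(l < 3) Gs l w) / 3.
Let Gmax w := max3 (fun l => Gs l w).

Lemma sum_indic (u : 'I_3 -> R) l : \sum_(j < 3) (l == j)%:R * u j = u l.
Proof.
rewrite (bigD1 l)//= eqxx mul1r big1 ?addr0// => j jl.
by rewrite eq_sym (negbTE jl) mul0r.
Qed.

Lemma sum_deviation (u : 'I_3 -> R) (e : R) (l : 'I_3) :
  \sum_(j < 3) (if (j < 3)%N then (l == j :> nat)%:R - 1 / 3 else e) * u j =
  u l - (\sum_(j < 3) u j) / 3.
Proof.
transitivity (\sum_(j < 3) ((l == j)%:R * u j - 1 / 3 * u j)).
  by apply: eq_bigr => j _; rewrite ltn_ord mulrBl.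
by rewrite sumrB sum_indic -mulr_sumr; field.
Qed.

Lemma suboptimal_cvg : tight_cvg P P'
  (fun n w => (suboptimal_load c (x_ w) n - gamma * n%:R) / Num.sqrt n%:R)
  (fun w => Gmax w - Gmean w + G w).
Proof.
pose A (l j : 'I_3) : R := (l == j)%:R.
pose B (l : 'I_3) (j : nat) : R := if (j < 3)%N then (l == j :> nat)%:R - 1 / 3 else 1.
have -> : (fun w => Gmax w - Gmean w + G w) = (fun w => max3 (fun l => \sum_(j < 4) B l j * GG j w)).
  apply/funext => w; rewrite /Gmax -addrA -max3D; congr max3; apply/funext => l.
  by rewrite sum4_GG sum_deviation /B /Gmean /= mul1r addrA.
have -> : (fun n w => (suboptimal_load c (x_ w) n - gamma * n%:R) / Num.sqrt n%:R) =
    (fun n w => max3 (fun l => (\sum_(i < n) combination A l (X i w)) / Num.sqrt n%:R)).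
  apply/funext => n; apply/funext => w; rewrite suboptimal_loadE -max3D mulrC -max3Z; last first.
    by rewrite invr_ge0 sqrtr_ge0.
  congr max3; apply/funext => l; rewrite mulrC; congr (_ * _).
  under [RHS]eq_bigr do rewrite /combination sum_indic.
  by rewrite sumrB sumr_const card_ord mulr_natr.
apply: combination_cvg => l m; rewrite sum4_sd /combination_cov /A /B.
by case: (ord3_cases l) => ->; case: (ord3_cases m) => ->; rewrite !big_ord_recl !big_ord0 /=; field.
Qed.

Lemma mean_load_cvg : tight_cvg P P'
  (fun n w => (mean_load c (x_ w) n - gamma * n%:R) / Num.sqrt n%:R) G.
Proof.
pose A (l j : 'I_3) : R := 1 / 3.
pose B (l : 'I_3) (j : nat) : R := if (j < 3)%N then 0 else 1.
have max3_cst (r : R) : max3 (fun _ => r) = r by have [l ->] := max3_attained (fun _ : 'I_3 => r).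
have -> : (G : Omega' -> R) = (fun w => max3 (fun l => \sum_(j < 4) B l j * GG j w)).
  apply/funext => w; rewrite -[LHS]max3_cst; congr max3; apply/funext => l.
  by rewrite sum4_GG /B /= mul1r big1 ?add0r// => j _; rewrite ltn_ord mul0r.
have -> : (fun n w => (mean_load c (x_ w) n - gamma * n%:R) / Num.sqrt n%:R) =
    (fun n w => max3 (fun l => (\sum_(i < n) combination A l (X i w)) / Num.sqrt n%:R)).
  apply/funext => n; apply/funext => w; rewrite -[LHS]max3_cst.
  congr max3; apply/funext => l; congr (_ * _).
  transitivity (\sum_(i < n) ((\sum_(m < 3) contribution c m (X i w)) / 3 - gamma)).
    by rewrite sumrB sumr_const card_ord mulr_natr -mulr_suml exchange_big.
  apply: eq_bigr => i _; rewrite /combination /A /centred -mulr_sumr sumrB sumr_const card_ord.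
  by field.
apply: combination_cvg => l m; rewrite sum4_sd /combination_cov /A /B.
by rewrite !big_ord_recl !big_ord0 /=; field.
Qed.

Lemma load_dev_cvg : tight_cvg P P'
  (fun n w => (suboptimal_load c (x_ w) n - mean_load c (x_ w) n) / Num.sqrt n%:R)
  (fun w => Gmax w - Gmean w).
Proof.
pose A (l j : 'I_3) : R := (l == j)%:R - 1 / 3.
pose B (l : 'I_3) (j : nat) : R := if (j < 3)%N then (l == j :> nat)%:R - 1 / 3 else 0.
have -> : (fun w => Gmax w - Gmean w) = (fun w => max3 (fun l => \sum_(j < 4) B l j * GG j w)).
  apply/funext => w; rewrite /Gmax -max3D; congr max3; apply/funext => l.
  by rewrite sum4_GG sum_deviation /B /Gmean /= mul0r addr0.
have -> : (fun n w => (suboptimal_load c (x_ w) n - mean_load c (x_ w) n) / Num.sqrt n%:R) =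
    (fun n w => max3 (fun l => (\sum_(i < n) combination A l (X i w)) / Num.sqrt n%:R)).
  apply/funext => n; apply/funext => w; rewrite suboptimal_loadE -max3D mulrC -max3Z; last first.
    by rewrite invr_ge0 sqrtr_ge0.
  congr max3; apply/funext => l; rewrite mulrC; congr (_ * _).
  rewrite -/(load_dev c (x_ w) n l) load_devE; apply: eq_bigr => i _.
  rewrite /combination /A /unbalance /x_.
  under [RHS]eq_bigr do rewrite mulrBl.
  rewrite sumrB sum_indic -mulr_sumr /centred sumrB sumr_const card_ord.
  by field.
apply: combination_cvg => l m; rewrite sum4_sd /combination_cov /A /B.
by case: (ord3_cases l) => ->; case: (ord3_cases m) => ->; rewrite !big_ord_recl !big_ord0 /=; field.
Qed.

End load_limits.

(** The square is largest at an end of the interval. *)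
Lemma sqr_between (R : realFieldType) (u v x y : R) : u <= v -> v <= x ->
  (v - y) ^+ 2 <= (u - y) ^+ 2 + (x - y) ^+ 2.
Proof.
move=> uv vx; have hu := sqr_ge0 (u - y); have hx := sqr_ge0 (x - y).
have [yv|vy] := leP y v.
  have : 0 <= (x - v) * (x + v - 2 * y) by apply: mulr_ge0; lra.
  lra.
have : 0 <= (v - u) * (2 * y - u - v) by apply: mulr_ge0; lra.
lra.
Qed.

Lemma mean_asymptotics (R : realType) d (T : measurableType d) (P : probability T R)
    (f : nat -> T -> R) (gamma mu : R) : (forall n, bmeas (f n)) ->
  \int[P]_w ((f n w - gamma * n%:R) / Num.sqrt n%:R) @[n --> \oo] --> mu ->
  (fun n => fine 'E_P[f n]) =
    (fun n => n%:R * gamma + mu * Num.sqrt n%:R) +o_\oo (fun n => Num.sqrt n%:R : R).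
Proof.
move=> bf /cvgrPdist_le h; apply/eqaddoP => eps eps0; near=> n.
have n0 : 0 < n%:R :> R by rewrite ltr0n; near: n; exact: nbhs_infty_gt.
have q0 : 0 < Num.sqrt n%:R :> R by rewrite sqrtr_gt0.
suff : `|fine 'E_P[f n] - (n%:R * gamma + mu * Num.sqrt n%:R)| <= eps * `|Num.sqrt n%:R : R| by [].
have -> : fine 'E_P[f n] = n%:R * gamma + Num.sqrt n%:R * \int[P]_w ((f n w - gamma * n%:R) / Num.sqrt n%:R).
  rewrite unlock -RintegralZl//; last first.
    apply: bmeas_integrable; apply: bmeasM; last exact: bmeas_cst.
    by apply: bmeasB => //; exact: bmeas_cst.
  under [in RHS]eq_Rintegral do rewrite mulrC divfK ?gt_eqF//.
  rewrite RintegralB//; [|exact: bmeas_integrable|exact: L1_cst].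
  by rewrite Exp_cst mulrC subrKC.
set I := \int[P]_w _.
have -> : n%:R * gamma + Num.sqrt n%:R * I - (n%:R * gamma + mu * Num.sqrt n%:R) = Num.sqrt n%:R * (I - mu) by ring.
rewrite normrM mulrC; apply: ler_wpM2r => //.
by rewrite distrC /I; near: n; exact: (h _ eps0).
Unshelve. all: by end_near.
Qed.

Section swapped_limits.
Context {R : realType}.
Local Notation C := R[i].
Local Notation RR := (measurableTypeR R).
Local Notation N01 := (@normal_prob R 0 1).
Variable c : C -> R.
Hypothesis c_measurable : measurable_fun triangle c.
Hypothesis c_ge0 : forall x, triangle x -> 0 <= c x.
Hypothesis c_bounded : exists M : R, forall x, triangle x -> c x <= M.
Hypothesis c_bin1 : forall (x : C) (l : 'I_3), triangle x -> l != ord0 ->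
  normc (x - bin ord0) < normc (x - bin l) -> cost c ord0 x < cost c l x.
Hypothesis c_symmetric : forall theta t : R, 0 <= theta <= 2 * pi -> 0 < t ->
  triangle (t%:C * expi theta) ->
  c (t%:C * expi theta) = c (t%:C * expi (- theta - pi / 3)).
Context d (Omega : measurableType d) (P : probability Omega R).
Variable X : nat -> {RV P >-> C}.
Hypothesis X_independent : mutually_independent X.
Hypothesis X_uniform : forall k, uniform_on triangle (X k).
Hypothesis sw : swappable c.

Let x_ w k := X k w.
Let rho n w := optimal_load c (x_ w) n.
Let rhobar n w := suboptimal_load c (x_ w) n.
Let rhomean n w := mean_load c (x_ w) n.

Let bo n : bmeas (rho n) := bmeas_optimal_load c_measurable c_ge0 c_bounded X n.
Let bs n : bmeas (rhobar n) := bmeas_suboptimal_load c_measurable c_ge0 c_bounded X n.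
Let bm n : bmeas (rhomean n) := bmeas_mean_load c_measurable c_ge0 c_bounded X n.

Let le1 n w : rhomean n w <= rho n w.
Proof. exact: mean_load_le_optimal. Qed.

Let le2 n w : rho n w <= rhobar n w.
Proof. exact: optimal_load_le_suboptimal. Qed.

Let bscaled (f : Omega -> R) (a b : R) : bmeas f -> bmeas (fun w => (f w - a) / b).
Proof. by move=> bf; apply: bmeasM; [apply: bmeasB => //|]; exact: bmeas_cst. Qed.

Context d' (Omega' : measurableType d') (P' : probability Omega' R).

(** The optimal load differs from the mean load by o(sqrt n), and lies
    between the mean load and the suboptimal load, which bounds its second
    moment. *)
Lemma optimal_tight_cvg (a : nat -> R) (Z Z' : Omega' -> R) :
  tight_cvg P P' (fun n w => (rhomean n w - a n) / Num.sqrt n%:R) Z ->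
  tight_cvg P P' (fun n w => (rhobar n w - a n) / Num.sqrt n%:R) Z' ->
  tight_cvg P P' (fun n w => (rho n w - a n) / Num.sqrt n%:R) Z.
Proof.
move=> cm [_ _ _ [V' V'P _] _]; have [_ _ _ [V VP _] _] := cm.
apply: (tight_cvg_perturb cm).
- by move=> n; exact: bscaled.
- exists (V + V') => n n0.
  apply: (@le_trans _ _ (\int[P]_w (((rhomean n w - a n) / Num.sqrt n%:R) ^+ 2
      + ((rhobar n w - a n) / Num.sqrt n%:R) ^+ 2))).
    apply: le_Rintegral => //.
    + by apply: bmeas_integrable; apply: bmeas_sqr; exact: bscaled.
    + by apply: L1D; apply: bmeas_integrable; apply: bmeas_sqr; exact: bscaled.
    + move=> w _; rewrite !exprMn -mulrDl; apply: ler_wpM2r; first by rewrite sqr_ge0.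
      exact: sqr_between.
  rewrite RintegralD//; first by rewrite lerD// ?VP// V'P.
    by apply: bmeas_integrable; apply: bmeas_sqr; exact: bscaled.
  by apply: bmeas_integrable; apply: bmeas_sqr; exact: bscaled.
- have := @optimal_near_mean _ _ c_measurable c_ge0 c_bounded c_bin1 c_symmetric _ _ _ _ X_independent X_uniform sw.
  apply: cvg_trans; apply: near_eq_cvg; apply: nearW => n; apply: eq_Rintegral => w _.
  rewrite -mulrBl -/(x_ w) -/(rho n w) -/(rhomean n w).
  have -> : rho n w - a n - (rhomean n w - a n) = rho n w - rhomean n w by ring.
  by rewrite ger0_norm// divr_ge0// subr_ge0.
Qed.

Lemma gap_tight_cvg (Z : Omega' -> R) :
  tight_cvg P P' (fun n w => (rhobar n w - rhomean n w) / Num.sqrt n%:R) Z ->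
  tight_cvg P P' (fun n w => (rhobar n w - rho n w) / Num.sqrt n%:R) Z.
Proof.
move=> cm; have [_ _ _ [V VP _] _] := cm.
have bB (f g : Omega -> R) (b : R) : bmeas f -> bmeas g -> bmeas (fun w => (f w - g w) / b).
  by move=> bf bg; apply: bmeasM; [exact: bmeasB|exact: bmeas_cst].
apply: (tight_cvg_perturb cm).
- by move=> n; exact: bB.
- exists V => n n0; apply: le_trans (VP n n0); apply: le_Rintegral => //.
  + by apply: bmeas_integrable; apply: bmeas_sqr; exact: bB.
  + by apply: bmeas_integrable; apply: bmeas_sqr; exact: bB.
  + move=> w _; have h1 := le1 n w; have h2 := le2 n w.
    apply: lerXn2r; rewrite ?nnegrE ?divr_ge0 ?subr_ge0//; first exact: le_trans h1 h2.
    by apply: ler_wpM2r; [rewrite invr_ge0|lra].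
- have := @optimal_near_mean _ _ c_measurable c_ge0 c_bounded c_bin1 c_symmetric _ _ _ _ X_independent X_uniform sw.
  apply: cvg_trans; apply: near_eq_cvg; apply: nearW => n; apply: eq_Rintegral => w _.
  rewrite -mulrBl -/(x_ w) -/(rho n w) -/(rhomean n w).
  have -> : rhobar n w - rho n w - (rhobar n w - rhomean n w) = - (rho n w - rhomean n w) by ring.
  by rewrite mulNr normrN ger0_norm// divr_ge0// subr_ge0.
Qed.

End swapped_limits.

Theorem theorem1p2 (R : realType) :
  exists2 kappa : R, 0 < kappa &
  forall (c : R[i] -> R)
    (c_measurable : measurable_fun triangle c)
    (c_ge0 : forall x, triangle x -> 0 <= c x)
    (c_bounded : exists M : R, forall x, triangle x -> c x <= M)
    (c_bin1 : forall (x : R[i]) (l : 'I_3), triangle x -> l != ord0 ->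
       normc (x - bin ord0) < normc (x - bin l) ->
       cost c ord0 x < cost c l x)
    (c_symmetric : forall theta t : R, 0 <= theta <= 2 * pi -> 0 < t ->
       triangle (t%:C * expi theta) ->
       c (t%:C * expi theta) = c (t%:C * expi (- theta - pi / 3)))
    (c_lipschitz : exists U : set R[i],
       [/\ open (U : set (R[i])^o),
           (ray ord0 `|` ray ord_max) `&` triangle `<=` U &
           exists L : R, forall x y, (U `&` triangle) x ->
             (U `&` triangle) y -> `|c x - c y| <= L * normc (x - y)])
    (d : measure_display) (Omega : measurableType d) (P : probability Omega R)
    (X : nat -> {RV P >-> R[i]})
    (X_independent : mutually_independent X)
    (X_uniform : forall k, uniform_on triangle (X k)),
  let gamma := \int[area]_(x in cell ord0) c x in
  let sigma2 := \int[area]_(x in cell ord0) c x ^+ 2 in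
  let sigma := Num.sqrt sigma2 in
  let rho n w := optimal_load c (fun k => X k w) n in
  let rhobar n w := suboptimal_load c (fun k => X k w) n in
  forall (d' : measure_display) (Omega' : measurableType d')
    (P' : probability Omega' R)
    (G : {RV P' >-> R}) (Gs : 'I_3 -> {RV P' >-> R})
    (G_gaussian : gaussian 0 (sigma2 / 3 - gamma ^+ 2) G)
    (Gs_gaussian : forall l, gaussian 0 sigma2 (Gs l))
    (G_Gs_independent : mutually_independent (oapp Gs G)),
  let Gmax w := max3 (fun l => Gs l w) in
  let Gmean w := (\sum_(l < 3) Gs l w) / 3 in
  let m := fine 'E_P'[Gmax] in
  [/\ cvg_in_distribution P
        (fun n w => (rhobar n w - gamma * n%:R) / Num.sqrt n%:R)
        P' (fun w => Gmax w - Gmean w + G w),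
      (fun n => fine 'E_P[rhobar n]) =
        (fun n => n%:R * gamma + m * Num.sqrt n%:R) +o_\oo
        (fun n => Num.sqrt n%:R),
      m = kappa * sigma &
      (exists2 x, ((ray ord0 `|` ray ord_max) `&` triangle) x & 0 < c x) ->
      [/\ cvg_in_distribution P
            (fun n w => (rho n w - gamma * n%:R) / Num.sqrt n%:R) P' G,
          cvg_in_distribution P
            (fun n w => (rhobar n w - rho n w) / Num.sqrt n%:R)
            P' (fun w => Gmax w - Gmean w),
          (fun n => fine 'E_P[rho n]) =
            (fun n => n%:R * gamma) +o_\oo (fun n => Num.sqrt n%:R) &
          0 < m]].

Proof.
exists gaussian_max_mean; first exact: gaussian_max_mean_gt0.
move=> c c_measurable c_ge0 c_bounded c_bin1 c_symmetric c_lipschitz d Omega P X X_independent X_uniform.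
move=> gamma sigma2 sigma rho rhobar d' Omega' P' G Gs G_gaussian Gs_gaussian G_Gs_independent.
move=> Gmax Gmean m.
have s20 : 0 <= sigma2 := sigma2_ge0 c_measurable c_ge0 c_bounded X_uniform.
have v0 : 0 <= sigma2 / 3 - gamma ^+ 2 := mean_variance_ge0 c_measurable c_ge0 c_bounded X_uniform.
have lawS l := gaussian_law s20 (Gs_gaussian l).
have lawG := gaussian_law v0 G_gaussian.
have L1S l : L1 P' (Gs l) by apply: L1_norm3_id => //; exact: normal_law_L1_norm3 (lawS l).
have L1G : L1 P' G by apply: L1_norm3_id => //; exact: normal_law_L1_norm3 lawG.
have mS l : measurable_fun setT (Gs l) by [].
have L1max : L1 P' Gmax.
  apply: (@L1_le _ _ _ P' _ (fun w => \sum_(l < 3) `|Gs l w|)).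
  - exact: measurable_max3.
  - by apply: L1_sum => l; exact: L1_norm.
  - by move=> w; exact: max3_norm_le.
have mE : m = \int[P']_w Gmax w by rewrite /m unlock.
have mK : m = gaussian_max_mean * sigma.
  rewrite mE; apply: (@gaussian_max_meanE R _ _ P' _ (oapp Gs G) Some); last exact: G_Gs_independent.
  - exact: sqrtr_ge0.
  - by move=> i j [].
  - exact: lawS.
have Gmean0 : L1 P' Gmean /\ \int[P']_w Gmean w = 0.
  have e : Gmean = (fun w => 3^-1 * \sum_(l < 3) Gs l w) by apply/funext => w; rewrite mulrC.
  have l1 : L1 P' (fun w => \sum_(l < 3) Gs l w) by exact: L1_sum.
  rewrite e; split; first exact: L1Z.
  rewrite RintegralZl// Exp_sum// big1 ?mulr0// => l _.
  exact: (normal_law_mean (mS l) (lawS l)).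
have cbar := suboptimal_cvg c_measurable c_ge0 c_bounded X_independent X_uniform G_gaussian Gs_gaussian G_Gs_independent.
have cmean := mean_load_cvg c_measurable c_ge0 c_bounded X_independent X_uniform G_gaussian Gs_gaussian G_Gs_independent.
have cgap := load_dev_cvg c_measurable c_ge0 c_bounded X_independent X_uniform G_gaussian Gs_gaussian G_Gs_independent.
split.
- exact: tight_cvg_distribution cbar.
- apply: mean_asymptotics; first by move=> n; exact: bmeas_suboptimal_load.
  have [lM EM] := Gmean0.
  have <- : \int[P']_w (Gmax w - Gmean w + G w) = m.
    rewrite RintegralD//; last exact: L1B.
    by rewrite RintegralB// EM subr0 -mE (normal_law_mean _ lawG)// addr0.
  exact: (tight_cvg_mean cbar).
- exact: mK.
move=> pos.
have sw := positive_swappable c_symmetric c_lipschitz pos.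
have s2p := swappable_second_moment_gt0 c_measurable c_ge0 c_bounded X_uniform sw.
have copt := optimal_tight_cvg c_measurable c_ge0 c_bounded c_bin1 c_symmetric X_independent X_uniform sw cmean cbar.
have cgap' := gap_tight_cvg c_measurable c_ge0 c_bounded c_bin1 c_symmetric X_independent X_uniform sw cgap.
split.
- exact: tight_cvg_distribution copt.
- exact: tight_cvg_distribution cgap'.
- have -> : (fun n => n%:R * gamma) = (fun n => n%:R * gamma + 0 * Num.sqrt (n%:R : R)).
    by apply/funext => n; rewrite mul0r addr0.
  apply: mean_asymptotics; first by move=> n; exact: bmeas_optimal_load.
  rewrite -(normal_law_mean _ lawG)//; exact: (tight_cvg_mean copt).
- by rewrite mK mulr_gt0 ?gaussian_max_mean_gt0// sqrtr_gt0.
Qed.
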